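(* Let $\mathcal K,\mathcal J,\mathcal N$ be ideals in a right tensor $C^*$-precategory $\mathcal T$ such that $\mathcal J\subset J(\mathcal K)$ and $\mathcal N\subset\mathcal K$ is $\mathcal K$-invariant. Let $\iota=\{\iota_{n,m}\}_{n,m\in\mathbb N}$ be the universal representation of $\mathcal K$ in $\mathcal O_{\mathcal T}(\mathcal K,\mathcal J)$. The subspace $$\mathcal O(\mathcal N)=\overline{\mathrm{span}}\{\iota_{n,m}(a):a\in\mathcal N(n,m),\ n,m\in\mathbb N\}\subset\mathcal O_{\mathcal T}(\mathcal K,\mathcal J)$$ is an ideal in $\mathcal O_{\mathcal T}(\mathcal K,\mathcal J)$ and there are natural isomorphisms $$\mathcal O(\mathcal N)\cong\mathcal O_{\mathcal T}(\mathcal N,\mathcal J\cap\mathcal N),\qquad \mathcal O_{\mathcal T}(\mathcal K,\mathcal J)/\mathcal O(\mathcal N)\cong\mathcal O_{\mathcal T/\widetilde{\mathcal N}}(\mathcal K/\widetilde{\mathcal N},\mathcal J/\widetilde{\mathcal N}),\qquad( * )$$ where $\widetilde{\mathcal N}$ is an arbitrary invariant ideal in $\mathcal T$ such that $\mathcal N=\widetilde{\mathcal N}\cap\mathcal K$. Moreover, for the $\mathcal J$-saturation $\mathcal S_{\mathcal J}(\mathcal N)$ of $\mathcal N$ we have $$\mathcal S_{\mathcal J}(\mathcal N)=\iota^{-1}(\mathcal O(\mathcal N)),\quad\text{i.e. } \mathcal S_{\mathcal J}(\mathcal N)(n,m)=\iota_{n,m}^{-1}(\mathcal O(\mathcal N))\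 \text{for all } n,m.$$ Hence $\mathcal O(\mathcal S_{\mathcal J}(\mathcal N))=\mathcal O(\mathcal N)$, and in the right-hand sides of $( * )$ the ideals $\mathcal N$ and $\widetilde{\mathcal N}$ may be replaced by their $\mathcal J$-saturations $\mathcal S_{\mathcal J}(\mathcal N)$ and $\mathcal S_{\mathcal J}(\widetilde{\mathcal N})$.
   Context: $\mathbb N=\{0,1,2,\dots\}$. A $C^*$-precategory $\mathcal T$ with object set $\mathbb N$ consists of complex Banach spaces $\mathcal T(n,m)$, bilinear associative compositions $\mathcal T(n,m)\times\mathcal T(m,l)\to\mathcal T(n,l)$ with $\|ab\|\le\|a\|\|b\|$, and antilinear involutive maps $*:\mathcal T(n,m)\to\mathcal T(m,n)$ with $(ab)^*=b^*a^*$ and $\|a^*a\|=\|a\|^2$. An ideal $\mathcal K$ in $\mathcal T$ is a family of closed subspaces $\mathcal K(n,m)\subset\mathcal T(n,m)$ with $\mathcal T(n,m)\mathcal K(m,l)\subset\mathcal K(n,l)$, $\mathcal K(n,m)\mathcal T(m,l)\subset\mathcal K(n,l)$; inclusions, intersections and sums are entrywise. A right tensor $C^*$-precategory is such a $\mathcal T$ with linear maps $\otimes1:\mathcal T(n,m)\to\mathcal T(n+1,m+1)$ preserving composition and involution; $\otimes1^k$ is the $k$-th iterate; $(\otimes1)^{-1}(\mathcal N)(n,m)=\{a\in\mathcal T(n,m):a\otimes1\in\mathcal N(n+1,m+1)\}$; $J(\mathcal K)=\mathcal K\cap(\otimes1)^{-1}(\mathcal K)$. An ideal $\mathcal N$ is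 invariant if $\mathcal N\otimes1\subset\mathcal N$; then $\mathcal T/\mathcal N=\{\mathcal T(n,m)/\mathcal N(n,m)\}$ is a right tensor $C^*$-precategory with the quotient right tensoring, and for an ideal $\mathcal K$ in $\mathcal T$, $\mathcal K/\mathcal N$ denotes the image of $\mathcal K$ in $\mathcal T/\mathcal N$. $\mathcal N$ is $\mathcal K$-invariant if $(\mathcal N(n,m)\otimes1)\mathcal K(m+1,l)\subset\mathcal N(n+1,l)$ for all $n,m,l\in\mathbb N$. The $\mathcal J$-saturation of $\mathcal N$ is $\mathcal S_{\mathcal J}(\mathcal N)=\overline{\bigcup_k\mathcal S_k}$ (entrywise), where $\mathcal S_0=\mathcal N$ and $\mathcal S_k=\mathcal J\cap(\otimes1)^{-1}(\mathcal S_{k-1})+\mathcal S_{k-1}$; it is the smallest ideal $\mathcal S\supset\mathcal N$ with $\mathcal J\cap(\otimes1)^{-1}(\mathcal S)\subset\mathcal S$. A right tensor representation of $\mathcal K$ in a $C^*$-algebra $B$ is a family of linear maps $\pi_{n,m}:\mathcal K(n,m)\to B$ with $\pi_{n,m}(a)^*=\pi_{m,n}(a^* )$ and $\pi_{n,m}(a)\pi_{m+k,l}(b)=\pi_{n+k,l}((a\otimes1^k)b)$ for $a\in\mathcal K(n,m)$, $b\in\mathcal K(m+k,l)$; it is coisometric on $\mathcal J\subset J(\mathcal K)$ if $\pi_{n,m}(a)=\pi_{n+1,m+1}(a\otimes1)$ for $a\in\mathcal J(n,m)$. $(\mathcal O_{\mathcal T}(\mathcal K,\mathcal J),\iota)$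 is the universal pair: $\iota$ is a right tensor representation of $\mathcal K$ coisometric on $\mathcal J$ whose image generates the $C^*$-algebra, and every right tensor representation $\pi$ of $\mathcal K$ coisometric on $\mathcal J$ is $\pi_{n,m}=\Psi_\pi\circ\iota_{n,m}$ for a $*$-homomorphism $\Psi_\pi$.
   Formalization: C*-precategories are also required to have a*a positive in T(m,m), and an invariant ideal Ñ with N = Ñ∩K is assumed to exist for every part of the claim; without either, counterexamples exist (K-invariance as defined does not guarantee such an Ñ or that O(N) is an ideal). *)

(* Defs.v *)
(* The complex scalars are [R[i]] for a
   realType [R]; norms on normed [R[i]]-modules take their values in [R[i]]. *)
From HB Require Import structures.
From mathcomp Require Import all_boot all_order all_algebra.
From mathcomp Require Import complex.
From mathcomp Require Import all_classical all_reals all_analysis.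

Set Implicit Arguments.
Unset Strict Implicit.
Unset Printing Implicit Defensive.

Import Order.TTheory GRing.Theory Num.Theory numFieldNormedType.Exports.
Local Open Scope complex_scope.
Local Open Scope classical_set_scope.
Local Open Scope ring_scope.

Section BanachSpaces.
Variable R : realType.

Definition is_subspace (V : completeNormedModType R[i]) (A : set V) : Prop :=
  A 0 /\ forall (c : R[i]) a b, A a -> A b -> A (c *: a + b).

Definition lspan (V : completeNormedModType R[i]) (A : set V) : set V :=
  smallest (@is_subspace V) A.

(* [q] exhibits [W] as the Banach quotient [V / A] with the quotient norm. *)
Definition is_quotient_map (V W : completeNormedModType R[i]) (A : set V)
    (q : V -> W) : Prop :=
  [/\ linear q,
      range q = [set: W],
      forall a, q a = 0 <-> A a &
      forall a, `|q a| = (inf [set complex.Re `|a + b| | b in A])%:C].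

End BanachSpaces.

(* Not necessarily unital; the zero algebra is allowed. *)
Record cstarAlg (R : realType) := CstarAlg {
  alg_sort :> completeNormedModType R[i];
  amul : alg_sort -> alg_sort -> alg_sort;
  astar : alg_sort -> alg_sort;
  amulA : forall x y z, amul x (amul y z) = amul (amul x y) z;
  amul_linl : forall (c : R[i]) x y z,
    amul (c *: x + y) z = c *: amul x z + amul y z;
  amul_linr : forall (c : R[i]) x y z,
    amul x (c *: y + z) = c *: amul x y + amul x z;
  anormM : forall x y, `|amul x y| <= `|x| * `|y|;
  astar_antilin : forall (c : R[i]) x y,
    astar (c *: x + y) = c^* *: astar x + astar y;
  astarK : forall x, astar (astar x) = x;
  astarM : forall x y, astar (amul x y) = amul (astar y) (astar x);
  anorm_cstar : forall x, `|amul (astar x) x| = `|x| ^+ 2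
}.

Section CstarAlgebras.
Variable R : realType.
Implicit Types A B : cstarAlg R.

Definition is_starhom A B (f : A -> B) : Prop :=
  [/\ linear f,
      forall x y, f (amul x y) = amul (f x) (f y) &
      forall x, f (astar x) = astar (f x)].

Definition is_cstar_subalg A (S : set A) : Prop :=
  [/\ is_subspace S, closed S,
      forall x y, S x -> S y -> S (amul x y) &
      forall x, S x -> S (astar x)].

Definition is_alg_ideal A (I : set A) : Prop :=
  [/\ is_subspace I, closed I,
      forall x y, I y -> I (amul x y) &
      forall x y, I x -> I (amul x y)].

(* [p] exhibits [D] as the quotient C*-algebra [A / I]. *)
Definition is_alg_quotient A (I : set A) (D : cstarAlg R) (p : A -> D) : Prop :=
  is_quotient_map I p /\ is_starhom p.

End CstarAlgebras.

(* C*-precategories with object set nat, together with a right tensoring.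
   Composition is diagrammatic in the indices: T(n,m) x T(m,l) -> T(n,l).
   Positivity of a*a in the C*-algebra T(m,m), i.e. [hom_pos], is the usual
   axiom of C*-categories.  For a single object it follows from the C*-identity,
   but in general it does not: given signs e(n) in {1,-1}, replacing a* by
   e(n) e(m) a* on T(n,m) preserves all the other axioms on composition,
   involution and norm. *)
Record rtCstarPrecat (R : realType) := RtCstarPrecat {
  hom :> nat -> nat -> completeNormedModType R[i];
  hcomp : forall n m l, hom n m -> hom m l -> hom n l;
  hstar : forall n m, hom n m -> hom m n;
  tens : forall n m, hom n m -> hom n.+1 m.+1;
  hcompA : forall n m l k (a : hom n m) (b : hom m l) (c : hom l k),
    hcomp a (hcomp b c) = hcomp (hcomp a b) c;
  hcomp_linl : forall n m l (c : R[i]) (a b : hom n m) (d : hom m l),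
    hcomp (c *: a + b) d = c *: hcomp a d + hcomp b d;
  hcomp_linr : forall n m l (c : R[i]) (a : hom n m) (b d : hom m l),
    hcomp a (c *: b + d) = c *: hcomp a b + hcomp a d;
  hnormM : forall n m l (a : hom n m) (b : hom m l),
    `|hcomp a b| <= `|a| * `|b|;
  hstar_antilin : forall n m (c : R[i]) (a b : hom n m),
    hstar (c *: a + b) = c^* *: hstar a + hstar b;
  hstarK : forall n m (a : hom n m), hstar (hstar a) = a;
  hstarM : forall n m l (a : hom n m) (b : hom m l),
    hstar (hcomp a b) = hcomp (hstar b) (hstar a);
  hnorm_cstar : forall n m (a : hom n m), `|hcomp (hstar a) a| = `|a| ^+ 2;
  hom_pos : forall n m (a : hom n m),
    exists b : hom m m, hcomp (hstar a) a = hcomp (hstar b) b;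
  tens_lin : forall n m (c : R[i]) (a b : hom n m),
    tens (c *: a + b) = c *: tens a + tens b;
  tensM : forall n m l (a : hom n m) (b : hom m l),
    tens (hcomp a b) = hcomp (tens a) (tens b);
  tens_star : forall n m (a : hom n m), tens (hstar a) = hstar (tens a)
}.

Section Ideals.
Variables (R : realType) (T : rtCstarPrecat R).

Definition homfam := forall n m, set (T n m).
Implicit Types K J N : homfam.

Definition fam_sub N K : Prop := forall n m, N n m `<=` K n m.
Definition fam_cap N K : homfam := fun n m => N n m `&` K n m.
Definition fam_add N K : homfam :=
  fun n m => [set a + b | a in N n m & b in K n m].

Definition is_ideal K : Prop :=
  [/\ forall n m, is_subspace (K n m),
      forall n m, closed (K n m),
      forall n m l (a : T n m) (b : T m l), K m l b -> K n l (hcomp a b) &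
      forall n m l (a : T n m) (b : T m l), K n m a -> K n l (hcomp a b)].

(* The k-th iterate lands in T(k + n, k + m), not T(n + k, m + k), so that it
   typechecks by conversion. *)
Fixpoint tens_iter (k n m : nat) (a : T n m) : T (k + n)%N (k + m)%N :=
  match k with
  | 0 => a
  | k'.+1 => tens (tens_iter k' a)
  end.

Definition tens_preim N : homfam := fun n m => [set a | N n.+1 m.+1 (tens a)].

Definition Jfam K : homfam := fam_cap K (tens_preim K).

Definition is_invariant N : Prop :=
  forall n m (a : T n m), N n m a -> N n.+1 m.+1 (tens a).

Definition is_K_invariant K N : Prop :=
  forall n m l (a : T n m) (b : T m.+1 l),
    N n m a -> K m.+1 l b -> N n.+1 l (hcomp (tens a) b).

Fixpoint sat_step J N (k : nat) : homfam :=
  match k with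
  | 0 => N
  | k'.+1 => fam_add (fam_cap J (tens_preim (sat_step J N k'))) (sat_step J N k')
  end.

Arguments sat_step J N k n m _ : clear implicits.

Definition saturation J N : homfam :=
  fun n m => closure (\bigcup_k sat_step J N k n m).

End Ideals.

Arguments fam_cap {R T} N K n m _.
Arguments fam_add {R T} N K n m _.
Arguments tens_preim {R T} N n m _.
Arguments Jfam {R T} K n m _.
Arguments sat_step {R T} J N k n m _.
Arguments saturation {R T} J N n m _.

(* [q] exhibits [Q] as the quotient right tensor C*-precategory [T / N]. *)
Definition is_precat_quotient (R : realType) (T : rtCstarPrecat R)
    (N : homfam T) (Q : rtCstarPrecat R) (q : forall n m, T n m -> Q n m) :
    Prop :=
  [/\ forall n m, is_quotient_map (N n m) (q n m),
      forall n m l (a : T n m) (b : T m l),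
        q n l (hcomp a b) = hcomp (q n m a) (q m l b),
      forall n m (a : T n m), q m n (hstar a) = hstar (q n m a) &
      forall n m (a : T n m), q n.+1 m.+1 (tens a) = tens (q n m a)].

Definition fam_image (R : realType) (T Q : rtCstarPrecat R)
    (q : forall n m, T n m -> Q n m) (K : homfam T) : homfam Q :=
  fun n m => q n m @` K n m.
Arguments fam_image {R T Q} q K n m _.

Section Representations.
Variables (R : realType) (T : rtCstarPrecat R).
Implicit Types (K J N : homfam T) (B : cstarAlg R).

(* A representation of the ideal [K] is given by functions on the whole spaces
   T(n,m), whose values outside K(n,m) are irrelevant. *)
Definition is_rep K B (pi : forall n m, T n m -> B) : Prop :=
  [/\ forall n m (c : R[i]) (a b : T n m), K n m a -> K n m b ->
        pi n m (c *: a + b) = c *: pi n m a + pi n m b,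
      forall n m (a : T n m), K n m a ->
        astar (pi n m a) = pi m n (hstar a) &
      forall n m k l (a : T n m) (b : T (k + m)%N l),
        K n m a -> K (k + m)%N l b ->
        amul (pi n m a) (pi (k + m)%N l b)
          = pi (k + n)%N l (hcomp (tens_iter k a) b)].

Definition coisometric_on J B (pi : forall n m, T n m -> B) : Prop :=
  forall n m (a : T n m), J n m a -> pi n m a = pi n.+1 m.+1 (tens a).

Definition rep_image K B (pi : forall n m, T n m -> B) : set B :=
  \bigcup_n \bigcup_m (pi n m @` K n m).

(* [(O, iota)] is (a model of) the universal pair O_T(K,J). *)
Definition is_universal K J (O : cstarAlg R) (iota : forall n m, T n m -> O) :
    Prop :=
  [/\ is_rep K iota,
      coisometric_on J iota,
      smallest (@is_cstar_subalg R O) (rep_image K iota) = [set: O] &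
      forall (B : cstarAlg R) (pi : forall n m, T n m -> B),
        is_rep K pi -> coisometric_on J pi ->
        exists Psi : O -> B, is_starhom Psi /\
          forall n m (a : T n m), K n m a -> pi n m a = Psi (iota n m a)].

(* The subspace O(N) of the target of [iota]. *)
Definition Osub N (O : cstarAlg R) (iota : forall n m, T n m -> O) : set O :=
  closure (lspan (rep_image N iota)).

(* The ideal [I] of [O] is naturally isomorphic to O_T(N,J'): the isomorphism
   matches the universal representation of N with the restriction of [iota]. *)
Definition natural_ideal_iso (O : cstarAlg R) (iota : forall n m, T n m -> O)
    (I : set O) N J' : Prop :=
  forall (O' : cstarAlg R) (iota' : forall n m, T n m -> O'),
    is_universal N J' iota' ->
    exists Phi : O' -> O,
      [/\ is_starhom Phi, injective Phi, range Phi = I &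
          forall n m (a : T n m), N n m a -> Phi (iota' n m a) = iota n m a].

End Representations.

(* O / I is naturally isomorphic to O_{T/N}(K/N, J/N): the isomorphism sends
   the class of iota(a) to iota'(class of a). *)
Definition natural_quotient_iso (R : realType) (T : rtCstarPrecat R)
    (O : cstarAlg R) (iota : forall n m, T n m -> O) (I : set O)
    (K J N : homfam T) : Prop :=
  forall (D : cstarAlg R) (p : O -> D), is_alg_quotient I p ->
  forall (Q : rtCstarPrecat R) (q : forall n m, T n m -> Q n m),
    is_precat_quotient N q ->
  forall (O' : cstarAlg R) (iota' : forall n m, Q n m -> O'),
    is_universal (fam_image q K) (fam_image q J) iota' ->
    exists Phi : D -> O',
      [/\ is_starhom Phi, bijective Phi &
          forall n m (a : T n m), K n m a ->
            Phi (p (iota n m a)) = iota' n m (q n m a)].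

(* Main.v *)
(* The algebra O is only known through its universal property, so everything
   about it is read off from explicit representations.  For an ideal I of T, let
   a in T(n,m) act on families x = (x_p) with x_p in T(p,r) by
   (a x)_(k+n) = (a tensored k times) x_(k+m); these operators are adjointable
   for the form sum_p x_p^* y_p modulo I and obey the relations of a right tensor
   representation.  For fixed r and I = J + Nt this representation is
   coisometric on J, kills N, and kills a only if each iterated tensoring of a
   lies in J + Nt.  For I = Nt, in the limit r -> oo and on families whose
   coordinates escape to infinity, a and its tensoring act in the same way, and
   the representation kills a only if the distance from its k-fold tensoring to
   Nt tends to 0.  An a in K with iota a in O(N) satisfies both conclusions, and
   a functional calculus argument deduces from them that a is in the saturation
   of N.
   The map from O_T(N, J cap N) to O is isometric because O_T(K, J) acts on
   O_T(N, J cap N) by left multiplication, the copy of N acting as itself; the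
   quotient isomorphism is formal. *)
Require Import Defs.
From HB Require Import structures.
From mathcomp Require Import all_boot all_order all_algebra.
From mathcomp Require Import complex zify ring lra.
From mathcomp Require Import all_classical all_reals all_analysis.

Set Implicit Arguments.
Unset Strict Implicit.
Unset Printing Implicit Defensive.

Import Order.TTheory GRing.Theory Num.Theory numFieldNormedType.Exports.
Local Open Scope classical_set_scope.
Local Open Scope complex_scope.
Local Open Scope ring_scope.

(** * Norms and Cauchy sequences *)
Section RealNorm.
Variable R : realType.
Implicit Types c : R[i].

(** The obstacle is coisometry. On families, [a] in T(n,m) and its tensoring act alike except at
    coordinate [n], where the tensoring gives 0 and [a] gives [a x_m]. A representation coisometric
    on J must not see this defect: either it is taken modulo an ideal containing J, which forgets J,
    or the coordinate is pushed to infinity, which sees the tensorings of [a] only in the limit. The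
    two kernels complement each other: if the tensorings of [a] lie in J + Nt and one of them lies
    in Nt, then [a] is pulled back into the saturation one tensoring at a time, and the calculus
    turns small distance to Nt into approximation by such elements. The forms are positive because
    [a^* a] is positive also for [a] off the diagonal, which is [hom_pos]. The theory of C*-algebras
    is derived without spectra, from the iteration for [1 - sqrt(1 - x)] and the bound of [|x|^2] by
    [|x^2 + y^2|] for commuting self-adjoint [x], [y]. Seminorms and Hausdorff completions produce
    the quotients and operator algebras. *)

Definition cabs c : R := complex.Re `|c|.

Lemma cabsE c : `|c| = (cabs c)%:C.
Proof. by rewrite /cabs RRe_real // ger0_real. Qed.

Lemma cabs_ge0 c : 0 <= cabs c.
Proof. by rewrite -lecR -cabsE; exact: normr_ge0. Qed.

Lemma cabsD c d : cabs (c + d) <= cabs c + cabs d.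
Proof. by rewrite -lecR rmorphD /= -!cabsE ler_normD. Qed.

Lemma cabsM c d : cabs (c * d) = cabs c * cabs d.
Proof. by apply: complexI; rewrite rmorphM /= -!cabsE normrM. Qed.

Lemma cabs0 : cabs 0 = 0.
Proof. by rewrite /cabs normr0. Qed.

Lemma cabs_eq0 c : cabs c = 0 -> c = 0.
Proof. by move=> h; apply/eqP; rewrite -normr_eq0 cabsE h. Qed.

Lemma cabs_real (r : R) : cabs r%:C = `|r|.
Proof.
rewrite /cabs normc_def /= expr0n /= addr0 sqrtr_sqr //.
Qed.

Lemma cabsJ c : cabs c^* = cabs c.
Proof. by rewrite /cabs normcJ. Qed.

Lemma cabsN c : cabs (- c) = cabs c.
Proof. by rewrite /cabs normrN. Qed.

Lemma cabs1 : cabs 1 = 1.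
Proof. by rewrite /cabs normr1. Qed.

Lemma cabs_sqr c : cabs (c^* * c) = cabs c ^+ 2.
Proof. by rewrite cabsM cabsJ expr2. Qed.

Lemma abs_Re_le c : `|complex.Re c| <= cabs c.
Proof.
by rewrite /cabs normc_def /= -sqrtr_sqr ler_wsqrtr // lerDl sqr_ge0.
Qed.

Lemma abs_Im_le c : `|complex.Im c| <= cabs c.
Proof.
by rewrite /cabs normc_def /= -sqrtr_sqr ler_wsqrtr // lerDr sqr_ge0.
Qed.

Lemma cabs_i : cabs 'i%C = 1.
Proof. by rewrite /cabs normc_def /= expr0n /= expr1n add0r sqrtr1. Qed.

Lemma cabs_le c : cabs c <= `|complex.Re c| + `|complex.Im c|.
Proof.
rewrite {1}(complexE c); apply: le_trans (cabsD _ _) _.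
by rewrite cabsM cabs_i mul1r !cabs_real.
Qed.

Lemma ReB c d : complex.Re (c - d) = complex.Re c - complex.Re d.
Proof. by case: c d => [? ?] [? ?]. Qed.

Lemma ImB c d : complex.Im (c - d) = complex.Im c - complex.Im d.
Proof. by case: c d => [? ?] [? ?]. Qed.

(** Norms are [R[i]]-valued, out of reach of [lra] and [nra]; estimates use this real-valued
    copy. *)
Definition nm (V : normedModType R[i]) (x : V) : R := complex.Re `|x|.

Variable V : normedModType R[i].
Implicit Types x y : V.

Lemma nmE x : `|x| = (nm x)%:C.
Proof. by rewrite /nm RRe_real // ger0_real. Qed.

Lemma nm_ge0 x : 0 <= nm x.
Proof. by rewrite -lecR -nmE; exact: normr_ge0. Qed.

Lemma nmD x y : nm (x + y) <= nm x + nm y.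
Proof. by rewrite -lecR rmorphD /= -!nmE ler_normD. Qed.

Lemma nmZ c x : nm (c *: x) = cabs c * nm x.
Proof. by apply: complexI; rewrite rmorphM /= -nmE -cabsE -nmE normrZ. Qed.

Lemma nm0 : nm (0 : V) = 0.
Proof. by rewrite /nm normr0. Qed.

Lemma nm_eq0 x : nm x = 0 -> x = 0.
Proof. by move=> h; apply/eqP; rewrite -normr_eq0 nmE h. Qed.

Lemma nmN x : nm (- x) = nm x.
Proof. by rewrite /nm normrN. Qed.

Lemma nmB x y : nm (x - y) = nm (y - x).
Proof. by rewrite -nmN opprB. Qed.

Lemma nmBD y x z : nm (x - z) <= nm (x - y) + nm (y - z).
Proof. by rewrite -(subrKA y x) nmD. Qed.

End RealNorm.

Section SequentialConvergence.
Variable R : realType.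

(** The function [nu] is arbitrary, to cover also [un] and [ps_nm], which come without a
    topology. *)
Definition scauchy (V : zmodType) (nu : V -> R) (u : nat -> V) :=
  forall e, 0 < e ->
    exists N, forall n m, (N <= n)%N -> (N <= m)%N -> nu (u n - u m) < e.

Definition slim (V : zmodType) (nu : V -> R) (u : nat -> V) (x : V) :=
  forall e, 0 < e -> exists N, forall n, (N <= n)%N -> nu (u n - x) < e.

Lemma gt0_complex (e : R[i]) : 0 < e -> exists2 r : R, 0 < r & e = r%:C.
Proof.
move=> e0; exists (complex.Re e); last by rewrite RRe_real // gtr0_real.
by rewrite -ltcR RRe_real // gtr0_real.
Qed.

Lemma closure_nmP (V : normedModType R[i]) (S : set V) x :
  closure S x <-> forall e, 0 < e -> exists2 y, S y & nm (x - y) < e.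
Proof.
split=> [Sx e e0|h B].
  have /Sx[y [Sy]] : nbhs x (ball x (e%:C)) by apply: nbhsx_ballx; rewrite ltcR.
  rewrite -ball_normE /= => xy; exists y => //.
  by rewrite -ltcR -nmE.
case/nbhs_ballP => e' /= /gt0_complex[e e0 ->] eB.
have [y Sy xy] := h e e0; exists y; split=> //; apply: eB.
by rewrite -ball_normE /= nmE ltcR.
Qed.

Lemma closed_nmP (V : normedModType R[i]) (S : set V) :
  closed S <->
  (forall x, (forall e, 0 < e -> exists2 y, S y & nm (x - y) < e) -> S x).
Proof.
split=> [cS x /closure_nmP /cS //|h x /closure_nmP]; exact: h.
Qed.

Lemma scauchy_slim (V : completeNormedModType R[i]) (u : nat -> V) :
  scauchy (@nm R V) u -> exists x, slim (@nm R V) u x.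
Proof.
move=> cu.
have /cauchy_cvg /cvg_ex[x /= ux] : cauchy (u @ \oo).
  apply: cauchy_exP => e' /gt0_complex[e e0 ->].
  have [N hN] := cu e e0; exists (u N).
  exists N => //= n Nn; rewrite /= -ball_normE /= nmE ltcR.
  exact: hN.
exists x => e e0.
have [N _ hN] : \forall n \near \oo, ball x e%:C (u n).
  by apply: ux; apply: nbhsx_ballx; rewrite ltcR.
exists N => n Nn; have := hN n Nn; rewrite /= -ball_normE /= nmE ltcR.
by rewrite nmB.
Qed.

Lemma scauchy_slim_real (u : nat -> R) :
  scauchy (fun x : R => `|x|) u -> exists x, slim (fun x : R => `|x|) u x.
Proof.
move=> cu.
have /cauchy_cvg /cvg_ex[x /= ux] : cauchy (u @ \oo).
  apply: cauchy_exP => e e0.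
  have [N hN] := cu e e0; exists (u N).
  exists N => //= n Nn; rewrite /= -ball_normE /=.
  exact: hN.
exists x => e e0.
have [N _ hN] : \forall n \near \oo, ball x e (u n).
  by apply: ux; apply: nbhsx_ballx.
exists N => n Nn; have := hN n Nn; rewrite /= -ball_normE /=.
by rewrite distrC.
Qed.

Lemma ler_eps (x y : R) : (forall e, 0 < e -> x <= y + e) -> x <= y.
Proof. by move=> h; apply/ler_addgt0Pr => e; exact: h. Qed.

Lemma ler_sqrW (x y : R) : 0 <= x -> 0 <= y -> x * x <= y * x -> x <= y.
Proof.
rewrite le_eqVlt => /predU1P[<- //|x0] _; by rewrite ler_pM2r.
Qed.

Lemma invS_lt (e : R) : 0 < e ->
  exists N, forall n, (N <= n)%N -> n.+1%:R^-1 < e.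
Proof.
move=> e0; exists (Num.truncn e^-1).+1 => n Nn.
rewrite -[e]invrK ltf_pV2 ?posrE ?invr_gt0 ?ltr0n //.
apply: lt_le_trans (truncnS_gt _) _; rewrite ler_nat.
exact: leq_trans Nn (leqnSn _).
Qed.

End SequentialConvergence.

(** * Hausdorff completion of a seminormed *-algebra *)
(** The laws hold only on [ps_dom] and up to elements of seminorm 0. Operators force this: an
    adjoint is determined only up to such elements, and the bounded adjointable maps are a mere
    subset of all maps. *)
Record prestar (R : realType) := Prestar {
  ps_sort :> lmodType R[i];
  ps_dom : set ps_sort;
  ps_nm : ps_sort -> R;
  ps_mul : ps_sort -> ps_sort -> ps_sort;
  ps_star : ps_sort -> ps_sort;
  ps_dom0 : ps_dom 0;
  ps_domL : forall (c : R[i]) x y, ps_dom x -> ps_dom y -> ps_dom (c *: x + y);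
  ps_domM : forall x y, ps_dom x -> ps_dom y -> ps_dom (ps_mul x y);
  ps_domS : forall x, ps_dom x -> ps_dom (ps_star x);
  ps_nm_ge0 : forall x, ps_dom x -> 0 <= ps_nm x;
  ps_nmD : forall x y, ps_dom x -> ps_dom y ->
    ps_nm (x + y) <= ps_nm x + ps_nm y;
  ps_nmZ : forall (c : R[i]) x, ps_dom x -> ps_nm (c *: x) = cabs c * ps_nm x;
  ps_nmM : forall x y, ps_dom x -> ps_dom y ->
    ps_nm (ps_mul x y) <= ps_nm x * ps_nm y;
  ps_mulA : forall x y z, ps_dom x -> ps_dom y -> ps_dom z ->
    ps_nm (ps_mul x (ps_mul y z) - ps_mul (ps_mul x y) z) = 0;
  ps_mul_linl : forall (c : R[i]) x y z, ps_dom x -> ps_dom y -> ps_dom z ->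
    ps_nm (ps_mul (c *: x + y) z - (c *: ps_mul x z + ps_mul y z)) = 0;
  ps_mul_linr : forall (c : R[i]) x y z, ps_dom x -> ps_dom y -> ps_dom z ->
    ps_nm (ps_mul x (c *: y + z) - (c *: ps_mul x y + ps_mul x z)) = 0;
  ps_star_lin : forall (c : R[i]) x y, ps_dom x -> ps_dom y ->
    ps_nm (ps_star (c *: x + y) - (c^* *: ps_star x + ps_star y)) = 0;
  ps_starK : forall x, ps_dom x -> ps_nm (ps_star (ps_star x) - x) = 0;
  ps_starM : forall x y, ps_dom x -> ps_dom y ->
    ps_nm (ps_star (ps_mul x y) - ps_mul (ps_star y) (ps_star x)) = 0;
  ps_cstar : forall x, ps_dom x ->
    ps_nm (ps_mul (ps_star x) x) = ps_nm x ^+ 2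
}.

Section PrestarTheory.
Variables (R : realType) (A : prestar R).
Local Notation P := (@ps_dom R A).
Local Notation nu := (@ps_nm R A).
Local Notation mu := (@ps_mul R A).
Local Notation st := (@ps_star R A).
Implicit Types x y z : A.

Lemma ps_domD x y : P x -> P y -> P (x + y).
Proof. by move=> Px Py; rewrite -[x]scale1r; exact: ps_domL. Qed.

Lemma ps_domZ (c : R[i]) x : P x -> P (c *: x).
Proof. by move=> Px; rewrite -[_ *: _]addr0; apply: ps_domL => //; exact: ps_dom0. Qed.

Lemma ps_domN x : P x -> P (- x).
Proof. by move=> Px; rewrite -scaleN1r; exact: ps_domZ. Qed.

Lemma ps_domB x y : P x -> P y -> P (x - y).
Proof. by move=> Px Py; apply: ps_domD => //; exact: ps_domN. Qed.

Lemma ps_nm0 : nu 0 = 0.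
Proof. by rewrite -(scale0r (0 : A)) ps_nmZ ?cabs0 ?mul0r //; exact: ps_dom0. Qed.

Lemma ps_nmN x : P x -> nu (- x) = nu x.
Proof. by move=> Px; rewrite -scaleN1r ps_nmZ // cabsN cabs1 mul1r. Qed.

Lemma ps_nmC x y : P x -> P y -> nu (x - y) = nu (y - x).
Proof. by move=> Px Py; rewrite -ps_nmN ?opprB //; exact: ps_domB. Qed.

Lemma ps_nmBD y x z : P x -> P y -> P z -> nu (x - z) <= nu (x - y) + nu (y - z).
Proof. by move=> Px Py Pz; rewrite -(subrKA y x) ps_nmD //; exact: ps_domB. Qed.

Lemma ps_nm_le x y : P x -> P y -> nu x <= nu (x - y) + nu y.
Proof.
by move=> Px Py; rewrite -{1}(subrK y x) ps_nmD //; exact: ps_domB.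
Qed.

Lemma ps_nm_eq x y : P x -> P y -> nu (x - y) = 0 -> nu x = nu y.
Proof.
move=> Px Py h; apply/eqP; rewrite eq_le; apply/andP; split.
  by have := ps_nm_le Px Py; rewrite h add0r.
by have := ps_nm_le Py Px; rewrite ps_nmC // h add0r.
Qed.

Lemma ps_nm_star x : P x -> nu (st x) = nu x.
Proof.
have le y : P y -> nu y <= nu (st y).
  move=> Py; have Psy := ps_domS Py.
  have := ps_nmM Psy Py; rewrite ps_cstar // expr2.
  have := ps_nm_ge0 Py; have := ps_nm_ge0 Psy => h1.
  rewrite le_eqVlt => /predU1P[<- _ //|h2].
  by rewrite ler_pM2r.
move=> Px; apply/eqP; rewrite eq_le le // andbT.
rewrite -(ps_nm_eq _ Px (ps_starK Px)); first exact/le/ps_domS.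
by do 2!apply: ps_domS.
Qed.

Lemma ps_nm_mulB x y x' y' : P x -> P y -> P x' -> P y' ->
  nu (mu x y - mu x' y') <= nu (x - x') * nu y + nu x' * nu (y - y').
Proof.
move=> Px Py Px' Py'.
have PM := @ps_domM _ A; have PB := ps_domB; have PD := ps_domD.
have e1 : nu (mu x y - mu x' y) = nu (mu (x - x') y).
  apply/esym/ps_nm_eq; [by apply: PM; auto|by auto|].
  have := ps_mul_linl (-1) Px' Px Py.
  by rewrite !scaleN1r [- x' + x]addrC [- _ + mu x y]addrC.
have e2 : nu (mu x' y - mu x' y') = nu (mu x' (y - y')).
  apply/esym/ps_nm_eq; [by apply: PM; auto|by auto|].
  have := ps_mul_linr (-1) Px' Py' Py.
  by rewrite !scaleN1r [- y' + y]addrC [- _ + mu x' y]addrC.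
apply: le_trans (@ps_nmBD (mu x' y) _ _ _ _ _) _; auto.
by rewrite e1 e2; apply: lerD; apply: ps_nmM; auto.
Qed.

Lemma ps_nm_starB x y : P x -> P y -> nu (st x - st y) = nu (x - y).
Proof.
move=> Px Py; have PS := @ps_domS _ A; have PB := ps_domB.
rewrite -[RHS]ps_nm_star; auto.
apply/esym/ps_nm_eq; auto.
have := ps_star_lin (-1) Py Px.
by rewrite rmorphN1 !scaleN1r [- y + x]addrC [- _ + st x]addrC.
Qed.

Definition good (u : nat -> A) := (forall n, P (u n)) /\ scauchy nu u.

Definition eqv (u v : nat -> A) :=
  forall e, 0 < e -> exists N, forall n, (N <= n)%N -> nu (u n - v n) < e.

Lemma eqv_refl u : eqv u u.
Proof. by move=> e e0; exists 0%N => n _; rewrite subrr ps_nm0. Qed.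

Lemma eqv_sym u v : good u -> good v -> eqv u v -> eqv v u.
Proof.
move=> [Pu _] [Pv _] uv e e0; have [N h] := uv e e0.
by exists N => n Nn; rewrite ps_nmC // h.
Qed.

Lemma eqv_trans v u w : good u -> good v -> good w ->
  eqv u v -> eqv v w -> eqv u w.
Proof.
move=> [Pu _] [Pv _] [Pw _] uv vw e e0.
have e20 : 0 < e / 2 by rewrite divr_gt0.
have [N h] := uv _ e20; have [M k] := vw _ e20.
exists (maxn N M) => n; rewrite geq_max => /andP[Nn Mn].
apply: le_lt_trans (ps_nmBD (Pu n) (Pv n) (Pw n)) _.
by have := h n Nn; have := k n Mn; lra.
Qed.

Lemma eqv_null u v : (forall n, nu (u n - v n) = 0) -> eqv u v.
Proof. by move=> h e e0; exists 0%N => n _; rewrite h. Qed.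

Lemma good_cst x : P x -> good (fun=> x).
Proof. by move=> Px; split=> // e e0; exists 0%N => *; rewrite subrr ps_nm0. Qed.

Lemma good_lin (c : R[i]) u v : good u -> good v ->
  good (fun n => c *: u n + v n).
Proof.
move=> [Pu cu] [Pv cv]; split=> [n|e e0]; first exact: ps_domL.
have c0 := cabs_ge0 c.
have e20 : 0 < e / 2 / (cabs c + 1) by rewrite !divr_gt0 //; lra.
have e30 : 0 < e / 2 by rewrite divr_gt0.
have [N h] := cu _ e20; have [M k] := cv _ e30.
exists (maxn N M) => n m; rewrite !geq_max => /andP[Nn Mn] /andP[Nm Mm].
rewrite opprD addrACA -scalerBr.
apply: le_lt_trans (ps_nmD _ _) _; [exact/ps_domZ/ps_domB|exact: ps_domB|].
rewrite ps_nmZ; last exact: ps_domB.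
have h1 := h n m Nn Nm; have h2 := k n m Mn Mm.
have : cabs c * nu (u n - u m) <= e / 2; last lra.
have h3 := ps_nm_ge0 (ps_domB (Pu n) (Pu m)).
apply: le_trans (_ : (cabs c + 1) * (e / 2 / (cabs c + 1)) <= _).
  by apply: ler_pM => //; [lra|exact: ltW].
rewrite mulrC divfK //; lra.
Qed.

Lemma good_bounded u : good u -> exists N, exists2 M, 0 < M &
  forall n, (N <= n)%N -> nu (u n) <= M.
Proof.
move=> [Pu cu]; have [N h] := cu 1 ltr01.
exists N, (1 + nu (u N)); first by have := ps_nm_ge0 (Pu N); lra.
move=> n Nn; apply: le_trans (ps_nm_le (Pu n) (Pu N)) _.
by have := h n N Nn (leqnn _); lra.
Qed.

Lemma mul_small (M e a b a' b' : R) : 0 < M -> 0 < e -> 0 <= a -> 0 <= a' ->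
  0 <= b -> 0 <= b' ->
  a < e / 2 / M -> b <= M -> a' <= M -> b' < e / 2 / M -> a * b + a' * b' < e.
Proof.
move=> M0 e0 a0 a'0 b0 b'0 aM bM a'M b'M.
have h1 : a * b <= a * M by rewrite ler_wpM2l.
have h2 : a' * b' <= M * b' by rewrite ler_wpM2r.
have h3 : a * M < e / 2 by rewrite -ltr_pdivlMr.
have h4 : M * b' < e / 2 by rewrite mulrC -ltr_pdivlMr.
lra.
Qed.

Lemma good_mul u v : good u -> good v -> good (fun n => mu (u n) (v n)).
Proof.
move=> gu gv; have [Pu cu] := gu; have [Pv cv] := gv.
split=> [n|e e0]; first exact: ps_domM.
have [N1 [M1 M10 h1]] := good_bounded gu.
have [N2 [M2 M20 h2]] := good_bounded gv.
pose M := M1 + M2.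
have e20 : 0 < e / 2 / M by rewrite /M !divr_gt0 //; lra.
have [N3 h3] := cu _ e20; have [N4 h4] := cv _ e20.
exists (maxn (maxn N1 N2) (maxn N3 N4)) => n m; rewrite !geq_max.
case/andP=> /andP[n1 n2] /andP[n3 n4] /andP[/andP[m1 m2] /andP[m3 m4]].
apply: le_lt_trans (ps_nm_mulB (Pu n) (Pv n) (Pu m) (Pv m)) _.
apply: (@mul_small M) => //; rewrite ?ps_nm_ge0 ?/M //; try exact: ps_domB.
- lra.
- exact: h3.
- by have := h2 n n2; lra.
- by have := h1 m m1; lra.
- exact: h4.
Qed.

Lemma eqv_mul u v u' v' : good u -> good v -> good u' -> good v' ->
  eqv u u' -> eqv v v' -> eqv (fun n => mu (u n) (v n)) (fun n => mu (u' n) (v' n)).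
Proof.
move=> gu gv gu' gv' cu cv e e0.
have [[Pu _] [Pv _] [Pu' _] [Pv' _]] := And4 gu gv gu' gv'.
have [N1 [M1 M10 h1]] := good_bounded gu'.
have [N2 [M2 M20 h2]] := good_bounded gv.
pose M := M1 + M2.
have e20 : 0 < e / 2 / M by rewrite /M !divr_gt0 //; lra.
have [N3 h3] := cu _ e20; have [N4 h4] := cv _ e20.
exists (maxn (maxn N1 N2) (maxn N3 N4)) => n; rewrite !geq_max.
case/andP=> /andP[n1 n2] /andP[n3 n4].
apply: le_lt_trans (ps_nm_mulB (Pu n) (Pv n) (Pu' n) (Pv' n)) _.
apply: (@mul_small M) => //; rewrite ?ps_nm_ge0 ?/M //; try exact: ps_domB.
- lra.
- exact: h3.
- by have := h2 n n2; lra.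
- by have := h1 n n1; lra.
- exact: h4.
Qed.

Lemma eqv_lin (c : R[i]) u v u' v' : good u -> good v -> good u' -> good v' ->
  eqv u u' -> eqv v v' ->
  eqv (fun n => c *: u n + v n) (fun n => c *: u' n + v' n).
Proof.
move=> [Pu _] [Pv _] [Pu' _] [Pv' _] cu cv e e0.
have c0 := cabs_ge0 c.
have e20 : 0 < e / 2 / (cabs c + 1) by rewrite !divr_gt0 //; lra.
have e30 : 0 < e / 2 by rewrite divr_gt0.
have [N h] := cu _ e20; have [M k] := cv _ e30.
exists (maxn N M) => n; rewrite !geq_max => /andP[Nn Mn].
rewrite opprD addrACA -scalerBr.
apply: le_lt_trans (ps_nmD _ _) _; [exact/ps_domZ/ps_domB|exact: ps_domB|].
rewrite ps_nmZ; last exact: ps_domB.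
have h1 := h n Nn; have h2 := k n Mn.
have : cabs c * nu (u n - u' n) <= e / 2; last lra.
have h3 := ps_nm_ge0 (ps_domB (Pu n) (Pu' n)).
apply: le_trans (_ : (cabs c + 1) * (e / 2 / (cabs c + 1)) <= _).
  by apply: ler_pM => //; [lra|exact: ltW].
rewrite mulrC divfK //; lra.
Qed.

Lemma good_star u : good u -> good (fun n => st (u n)).
Proof.
move=> [Pu cu]; split=> [n|e /cu[N h]]; first exact: ps_domS.
by exists N => n m Nn Nm; rewrite ps_nm_starB // h.
Qed.

Lemma eqv_star u v : good u -> good v -> eqv u v ->
  eqv (fun n => st (u n)) (fun n => st (v n)).
Proof.
move=> [Pu _] [Pv _] uv e /uv[N h].
by exists N => n Nn; rewrite ps_nm_starB // h.
Qed.

(** Classes are encoded as sets of sequences, so that equality of points is plain equality, by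
    extensionality and proof irrelevance. *)
Record hc := Hc {
  hc_set : set (nat -> A);
  hc_setP : exists2 u, good u & hc_set = [set v | good v /\ eqv u v] }.

Lemma hc_eq p q : hc_set p = hc_set q -> p = q.
Proof.
case: p q => S hS [S' hS'] /= e; case: _ / e hS' => hS'.
by congr Hc; exact: Prop_irrelevance.
Qed.

HB.instance Definition _ := gen_eqMixin hc.
HB.instance Definition _ := gen_choiceMixin hc.

Definition cl u (gu : good u) : hc :=
  @Hc [set v | good v /\ eqv u v] (ex_intro2 _ _ u gu erefl).

Lemma cl_eq u v (gu : good u) (gv : good v) : eqv u v -> cl gu = cl gv.
Proof.
move=> uv; apply: hc_eq => /=; apply/seteqP; split=> w [gw h]; split=> //.
  exact: eqv_trans gv gu gw (eqv_sym gu gv uv) h.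
exact: eqv_trans gu gv gw uv h.
Qed.

Lemma cl_inj u v (gu : good u) (gv : good v) : cl gu = cl gv -> eqv u v.
Proof.
move=> /(congr1 hc_set) /= e.
have : [set w | good w /\ eqv u w] v by rewrite e; split=> //; exact: eqv_refl.
by case.
Qed.

Lemma clP q : {u | exists gu : good u, q = cl gu}.
Proof.
by apply: cid; case: q => S [u gu e]; exists u, gu; exact: hc_eq.
Qed.

Definition rep q := sval (clP q).

Lemma good_rep q : good (rep q).
Proof. by rewrite /rep; case: clP => u []. Qed.

Lemma rep_dom q n : P (rep q n).
Proof. by have [] := good_rep q. Qed.

Lemma repK q : cl (good_rep q) = q.
Proof.
move: (good_rep q); rewrite /rep; case: clP => u [gu e] /= g.
by rewrite e; congr cl; exact: Prop_irrelevance.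
Qed.

Lemma rep_cl u (gu : good u) : eqv (rep (cl gu)) u.
Proof. by apply: (@cl_inj _ _ (good_rep _) gu); rewrite repK. Qed.

(** Addition, opposite and scaling are all instances of this one operation, so that compatibility
    with the equivalence is checked once. *)
Definition hlin (c : R[i]) q r := cl (good_lin c (good_rep q) (good_rep r)).

Lemma hlin_cl c u v (gu : good u) (gv : good v) :
  hlin c (cl gu) (cl gv) = cl (good_lin c gu gv).
Proof.
by apply: cl_eq; apply: eqv_lin => //; try exact: good_rep; exact: rep_cl.
Qed.

Definition hzero := cl (good_cst (ps_dom0 A)).

Lemma cl_ext u v (gu : good u) (gv : good v) : u =1 v -> cl gu = cl gv.
Proof. by move=> /funext uv; case: _ / uv gv => gv; exact: cl_eq (eqv_refl _). Qed.

Lemma haddA : associative (hlin 1).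
Proof.
move=> p q r; rewrite -(repK p) -(repK q) -(repK r) !hlin_cl.
by apply: cl_ext => n; rewrite !scale1r addrA.
Qed.
Lemma haddC : commutative (hlin 1).
Proof.
move=> p q; rewrite -(repK p) -(repK q) !hlin_cl.
by apply: cl_ext => n; rewrite !scale1r addrC.
Qed.
Lemma hadd0 : left_id hzero (hlin 1).
Proof.
move=> p; rewrite -(repK p) /hzero !hlin_cl.
by apply: cl_ext => n /=; rewrite !scale1r add0r.
Qed.
Lemma haddN : left_inverse hzero (fun q => hlin (-1) q hzero) (hlin 1).
Proof.
move=> p /=; rewrite -(repK p) /hzero !hlin_cl.
by apply: cl_ext => n /=; rewrite scale1r addr0 scaleN1r addNr.
Qed.

HB.instance Definition _ := GRing.isZmodule.Build hc haddA haddC hadd0 haddN.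

Definition hscale (c : R[i]) q := hlin c q hzero.

Lemma hscaleA a b v : hscale a (hscale b v) = hscale (a * b) v.
Proof.
rewrite -(repK v) /hscale /hzero !hlin_cl.
by apply: cl_ext => n /=; rewrite !addr0 scalerA.
Qed.
Lemma hscale1 : left_id 1 hscale.
Proof.
move=> v; rewrite -(repK v) /hscale /hzero !hlin_cl.
by apply: cl_ext => n /=; rewrite !addr0 scale1r.
Qed.
Lemma hscaleDr : right_distributive hscale +%R.
Proof.
move=> c u v; rewrite -(repK u) -(repK v) /hscale /hzero /GRing.add /= !hlin_cl.
by apply: cl_ext => n /=; rewrite !scale1r !addr0 scalerDr.
Qed.
Lemma hscaleDl v : {morph hscale^~ v : a b / a + b}.
Proof.
move=> a b; rewrite -(repK v) /hscale /hzero [in RHS]/GRing.add /= !hlin_cl.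
by apply: cl_ext => n /=; rewrite !scale1r !addr0 scalerDl.
Qed.

HB.instance Definition _ :=
  GRing.Zmodule_isLmodule.Build R[i] hc hscaleA hscale1 hscaleDr hscaleDl.

Lemma cl_lin (c : R[i]) u v (gu : good u) (gv : good v) :
  c *: cl gu + cl gv = cl (good_lin c gu gv).
Proof.
rewrite /GRing.scale /GRing.add /= /hscale /hzero !hlin_cl.
by apply: cl_ext => n /=; rewrite !scale1r !addr0.
Qed.

Lemma good_nm_cvg u : good u ->
  exists x : R, slim (fun x : R => `|x|) (fun n => nu (u n)) x.
Proof.
move=> [Pu cu]; apply: scauchy_slim_real => e /cu[N h].
exists N => n m Nn Nm; apply: le_lt_trans (h n m Nn Nm).
have h1 := ps_nm_le (Pu n) (Pu m).
have h2 := ps_nm_le (Pu m) (Pu n).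
by rewrite ps_nmC // in h2; rewrite ler_norml; apply/andP; split; lra.
Qed.

Definition hnm q : R := sval (cid (good_nm_cvg (good_rep q))).

Lemma hnmP u (gu : good u) :
  slim (fun x : R => `|x|) (fun n => nu (u n)) (hnm (cl gu)).
Proof.
rewrite /hnm; case: cid => x /= hx e e0.
have e20 : 0 < e / 2 by rewrite divr_gt0.
have [N h] := hx _ e20; have [M k] := rep_cl gu e20.
exists (maxn N M) => n; rewrite !geq_max => /andP[Nn Mn].
have := h n Nn; have := k n Mn.
have [Pu _] := gu; have [Pr _] := good_rep (cl gu).
have h1 := ps_nm_le (Pr n) (Pu n).
have h2 := ps_nm_le (Pu n) (Pr n).
rewrite ps_nmC // in h2.
by rewrite !ltr_norml => ? /andP[? ?]; apply/andP; split; lra.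
Qed.

Lemma hnm_le u (gu : good u) M N : (forall n, (N <= n)%N -> nu (u n) <= M) ->
  hnm (cl gu) <= M.
Proof.
move=> h; apply: ler_eps => e e0; have [K k] := hnmP gu e0.
have := h (maxn N K) (leq_maxl _ _).
have := k (maxn N K) (leq_maxr _ _).
by rewrite ltr_norml => /andP[? ?] ?; lra.
Qed.

Lemma hnm_ge u (gu : good u) M N : (forall n, (N <= n)%N -> M <= nu (u n)) ->
  M <= hnm (cl gu).
Proof.
move=> h; apply: ler_eps => e e0; have [K k] := hnmP gu e0.
have := h (maxn N K) (leq_maxl _ _).
have := k (maxn N K) (leq_maxr _ _).
by rewrite ltr_norml => /andP[? ?] ?; lra.
Qed.

Arguments hnm_le {u gu} M N _.
Arguments hnm_ge {u gu} M N _.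

Lemma hnm_ge0 q : 0 <= hnm q.
Proof.
rewrite -(repK q); apply: (hnm_ge _ (0%N)) => n _.
by apply: ps_nm_ge0; have [] := good_rep q.
Qed.

Lemma hnm_near u (gu : good u) e : 0 < e -> exists N, forall n, (N <= n)%N ->
  nu (u n) <= hnm (cl gu) + e /\ hnm (cl gu) <= nu (u n) + e.
Proof.
move=> e0; have [N h] := hnmP gu e0; exists N => n /h.
by rewrite ltr_norml => /andP[? ?]; split; lra.
Qed.

Lemma hnmD p q : hnm (p + q) <= hnm p + hnm q.
Proof.
rewrite -(repK p) -(repK q) -[X in hnm (X + _)]scale1r cl_lin.
apply: ler_eps => e e0; have e20 : 0 < e / 2 by rewrite divr_gt0.
have [N h] := hnm_near (good_rep p) e20.
have [M k] := hnm_near (good_rep q) e20.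
apply: (hnm_le _ (maxn N M)) => n; rewrite geq_max => /andP[Nn Mn].
rewrite scale1r; apply: le_trans (ps_nmD _ _) _;
  [by have [] := good_rep p|by have [] := good_rep q|].
by have [? _] := h n Nn; have [? _] := k n Mn; lra.
Qed.

Lemma hnmZ (c : R[i]) p : hnm (c *: p) = cabs c * hnm p.
Proof.
have Pp : forall n, P (rep p n) by have [] := good_rep p.
rewrite -(repK p).
have -> : c *: cl (good_rep p) = cl (good_lin c (good_rep p) (good_cst (ps_dom0 A))).
  by rewrite -cl_lin; exact/esym/addr0.
apply/eqP; rewrite eq_le; apply/andP; split; apply: ler_eps => e e0.
  have e20 : 0 < e / (cabs c + 1) by rewrite divr_gt0 //; have := cabs_ge0 c; lra.
  have [N h] := hnm_near (good_rep p) e20.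
  apply: (hnm_le _ (N)) => n /h [h1 _].
  rewrite addr0 ps_nmZ //; apply: le_trans (ler_wpM2l (cabs_ge0 c) h1) _.
  rewrite mulrDr lerD2l mulrA ler_pdivrMr; have := cabs_ge0 c; nra.
rewrite -lerBlDr; have [N h] := hnmP (good_rep p) e0.
have e20 : 0 < e / (cabs c + 1) by rewrite divr_gt0 //; have := cabs_ge0 c; lra.
have [M k] := hnm_near (good_rep p) e20.
apply: (hnm_ge _ (M)) => n /k [_ h1].
rewrite addr0 ps_nmZ // lerBlDr; apply: le_trans (ler_wpM2l (cabs_ge0 c) h1) _.
rewrite mulrDr lerD2l mulrA ler_pdivrMr; have := cabs_ge0 c; nra.
Qed.

Lemma hnm_eq0 p : hnm p = 0 -> p = 0.
Proof.
rewrite -(repK p) => h; apply: cl_eq => e e0.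
have e20 : 0 < e / 2 by rewrite divr_gt0.
have [N k] := hnm_near (good_rep p) e20.
exists N => n /k [+ _]; rewrite h subr0; lra.
Qed.

Fact hnmC_D p q : (hnm (p + q))%:C <= (hnm p)%:C + (hnm q)%:C.
Proof. by rewrite -rmorphD /= lecR; exact: hnmD. Qed.
Fact hnmC_Z (c : R[i]) p : (hnm (c *: p))%:C = `|c| * (hnm p)%:C.
Proof. by rewrite hnmZ rmorphM /= -cabsE. Qed.
Fact hnmC_eq0 p : (hnm p)%:C = 0 -> p = 0.
Proof. by move=> h; apply: hnm_eq0; apply: complexI. Qed.

HB.instance Definition _ :=
  @Lmodule_isNormed.Build R[i] hc (fun q => (hnm q)%:C) hnmC_D hnmC_Z hnmC_eq0.

Lemma nm_hc (q : hc) : nm q = hnm q.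
Proof. by []. Qed.

(* The value at an element outside the domain is irrelevant. *)
Definition hj (x : A) : hc :=
  if pselect (P x) is left Px then cl (good_cst Px) else 0.

Lemma hjE x (Px : P x) : hj x = cl (good_cst Px).
Proof.
rewrite /hj; case: pselect => // Px'.
by congr cl; exact: Prop_irrelevance.
Qed.

Lemma nm_hj x : P x -> nm (hj x) = nu x.
Proof.
move=> Px; rewrite nm_hc (hjE Px); apply/eqP; rewrite eq_le.
by rewrite (hnm_le _ (0%N)) ?(hnm_ge _ (0%N)).
Qed.

Lemma hj_lin (c : R[i]) x y : P x -> P y ->
  hj (c *: x + y) = c *: hj x + hj y.
Proof.
move=> Px Py; rewrite (hjE Px) (hjE Py) (hjE (ps_domL c Px Py)) cl_lin.
exact: cl_ext.
Qed.

Lemma hjB x y : P x -> P y -> hj (x - y) = hj x - hj y.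
Proof.
by move=> Px Py; rewrite addrC -scaleN1r hj_lin // scaleN1r addrC.
Qed.

Lemma nm_hjB x y : P x -> P y -> nm (hj x - hj y) = nu (x - y).
Proof. by move=> Px Py; rewrite -hjB // nm_hj //; exact: ps_domB. Qed.

Lemma cl_hj u (gu : good u) : slim (@nm R hc) (fun n => hj (u n)) (cl gu).
Proof.
move=> e e0; have [Pu cu] := gu.
have e20 : 0 < e / 2 by rewrite divr_gt0.
have [N h] := cu _ e20; exists N => n Nn.
rewrite nmB (hjE (Pu n)) addrC -scaleN1r cl_lin nm_hc.
apply: le_lt_trans (_ : e / 2 < e); last lra.
apply: (hnm_le _ (N)) => m Nm.
by rewrite scaleN1r addrC ltW // h.
Qed.

Lemma hj_dense q e : 0 < e -> exists2 x, P x & nm (q - hj x) < e.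
Proof.
move=> e0; have [N h] := cl_hj (good_rep q) e0.
exists (rep q N); first by have [] := good_rep q.
by have := h N (leqnn _); rewrite repK nmB.
Qed.

Lemma hc_complete (F : set_system hc) : ProperFilter F -> cauchy F -> cvg F.
Proof.
move=> FF cF.
have /cauchyP cF' := cF.
pose ep n : R := n.+1%:R^-1.
have ep0 n : 0 < ep n by rewrite invr_gt0 ltr0n.
(* By density, a ball of radius [ep n] belonging to [F] may be centred at the image of an element of
   [A]. Any two of these balls meet, so the centres form a Cauchy sequence. *)
have H n : exists x, P x /\ F (ball (hj x) (ep n)%:C).
  have e20 : 0 < ep n / 2 by rewrite divr_gt0.
  have [q Fq] : exists q : hc, F (ball q (ep n / 2)%:C) by apply: cF'; rewrite ltcR.
  have [x Px qx] := hj_dense q e20; exists x; split=> //.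
  apply: filterS Fq => r; rewrite -!ball_normE /= !nmE !ltcR => h.
  by apply: le_lt_trans (nmBD q _ _) _; rewrite nmB; lra.
have [u /all_and2[Pu Fu]] := choice H.
have uB n m : nu (u n - u m) < ep n + ep m.
  have /filter_ex[q [/=]] : F (ball (hj (u n)) (ep n)%:C `&` ball (hj (u m)) (ep m)%:C).
    by apply: filterI.
  rewrite -!ball_normE /= !nmE !ltcR -nm_hjB // => h1 h2.
  by apply: le_lt_trans (nmBD q _ _) _; rewrite (nmB q); lra.
have epE (e : R) : 0 < e -> exists N, forall n, (N <= n)%N -> ep n < e by exact: invS_lt.
have gu : good u.
  split=> // e e0; have [N h] := epE (e / 2) ltac:(by rewrite divr_gt0).
  exists N => n m /h h1 /h h2; apply: lt_trans (uB n m) _; lra.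
apply/cvg_ex; exists (cl gu) => U /nbhs_ballP[e' /= /gt0_complex[e e0 ->]] eU.
have e20 : 0 < e / 2 by rewrite divr_gt0.
have [N h] := epE _ e20; have [M k] := cl_hj gu e20.
pose n := maxn N M.
apply: filterS (Fu n) => q; rewrite -ball_normE /= nmE ltcR => h1.
apply: eU; rewrite -ball_normE /= nmE ltcR.
apply: le_lt_trans (nmBD (hj (u n)) _ _) _; rewrite nmB.
have := h n (leq_maxl _ _); have := k n (leq_maxr _ _); lra.
Qed.

HB.instance Definition _ := Uniform_isComplete.Build hc hc_complete.

Definition hmul q r := cl (good_mul (good_rep q) (good_rep r)).

Lemma hmul_cl u v (gu : good u) (gv : good v) :
  hmul (cl gu) (cl gv) = cl (good_mul gu gv).
Proof.
by apply: cl_eq; apply: eqv_mul => //; try exact: good_rep; exact: rep_cl.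
Qed.

Definition hst q := cl (good_star (good_rep q)).

Lemma hst_cl u (gu : good u) : hst (cl gu) = cl (good_star gu).
Proof.
by apply: cl_eq; apply: eqv_star => //; [exact: good_rep|exact: rep_cl].
Qed.

Lemma hmulA (x y z : hc) : hmul x (hmul y z) = hmul (hmul x y) z.
Proof.
rewrite -(repK x) -(repK y) -(repK z) !hmul_cl; apply/cl_eq/eqv_null => n.
by apply: ps_mulA; exact: rep_dom.
Qed.

Lemma hmul_linl (c : R[i]) (x y z : hc) :
  hmul (c *: x + y) z = c *: hmul x z + hmul y z.
Proof.
rewrite -(repK x) -(repK y) -(repK z) !(hmul_cl, cl_lin).
by apply/cl_eq/eqv_null => n; apply: ps_mul_linl; exact: rep_dom.
Qed.

Lemma hmul_linr (c : R[i]) (x y z : hc) :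
  hmul x (c *: y + z) = c *: hmul x y + hmul x z.
Proof.
rewrite -(repK x) -(repK y) -(repK z) !(hmul_cl, cl_lin).
by apply/cl_eq/eqv_null => n; apply: ps_mul_linr; exact: rep_dom.
Qed.

Lemma hmul_norm (x y : hc) : `|hmul x y| <= `|x| * `|y|.
Proof.
rewrite !nmE -rmorphM /= lecR !nm_hc -(repK x) -(repK y) hmul_cl.
set p := cl (good_rep x); set q := cl (good_rep y).
have [p0 q0] : 0 <= hnm p /\ 0 <= hnm q by rewrite !hnm_ge0.
apply: ler_eps => e e0.
(* As [d <= 1], the product [(hnm p + d) * (hnm q + d)] exceeds [hnm p * hnm q] by at most
   [d * (hnm p + hnm q + 1)]. *)
pose d := Num.min 1 (e / (hnm p + hnm q + 1)).
have d0 : 0 < d by rewrite lt_min ltr01 divr_gt0 //; lra.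
have [N h] := hnm_near (good_rep x) d0.
have [M k] := hnm_near (good_rep y) d0.
apply: (hnm_le _ (maxn N M)) => n; rewrite geq_max => /andP[/h[h1 _] /k[k1 _]].
have [Px _] := good_rep x; have [Py _] := good_rep y.
apply: le_trans (ps_nmM (Px n) (Py n)) _.
apply: le_trans (ler_pM (ps_nm_ge0 (Px n)) (ps_nm_ge0 (Py n)) h1 k1) _.
rewrite -/p -/q.
have d1 : d <= 1 by rewrite ge_min lexx.
have d2 : d * (hnm p + hnm q + 1) <= e.
  by rewrite -ler_pdivlMr; [rewrite ge_min lexx orbT|lra].
have : d * d <= d by rewrite -[leRHS]mulr1 ler_wpM2l // ltW.
nra.
Qed.

Lemma hst_lin (c : R[i]) (x y : hc) : hst (c *: x + y) = c^* *: hst x + hst y.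
Proof.
rewrite -(repK x) -(repK y) !(hst_cl, cl_lin).
by apply/cl_eq/eqv_null => n; apply: ps_star_lin; exact: rep_dom.
Qed.

Lemma hstK (x : hc) : hst (hst x) = x.
Proof.
rewrite -(repK x) !(hst_cl, cl_lin).
by apply/cl_eq/eqv_null => n; apply: ps_starK; exact: rep_dom.
Qed.

Lemma hstM (x y : hc) : hst (hmul x y) = hmul (hst y) (hst x).
Proof.
rewrite -(repK x) -(repK y) !(hst_cl, hmul_cl).
by apply/cl_eq/eqv_null => n; apply: ps_starM; exact: rep_dom.
Qed.

Lemma hcstar (x : hc) : `|hmul (hst x) x| = `|x| ^+ 2.
Proof.
rewrite !nmE -rmorphXn /= !nm_hc; congr (_ %:C); apply/eqP; rewrite eq_le.
rewrite -(repK x) hst_cl hmul_cl; set p := cl (good_rep x).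
have p0 : 0 <= hnm p by rewrite hnm_ge0.
have [Px _] := good_rep x.
apply/andP; split; apply: ler_eps => e e0.
all: pose d := Num.min 1 (e / (2 * hnm p + 1)).
all: have d0 : 0 < d by rewrite lt_min ltr01 divr_gt0 //; lra.
all: have d1 : d <= 1 by rewrite ge_min lexx.
all: have d2 : d * (2 * hnm p + 1) <= e
  by (rewrite -ler_pdivlMr; [rewrite ge_min lexx orbT|lra]).
all: have d3 : d * d <= d by rewrite -[leRHS]mulr1 ler_wpM2l // ltW.
all: have [N h] := hnm_near (good_rep x) d0.
  apply: (hnm_le _ N) => n /h[h1 _]; rewrite ps_cstar // !expr2.
  have u0 := ps_nm_ge0 (Px n).
  have := ler_pM u0 u0 h1 h1; rewrite -/p; lra.
rewrite -lerBlDr; apply: (hnm_ge _ N) => n /h[h1 h2]; rewrite ps_cstar // !expr2.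
have u0 := ps_nm_ge0 (Px n); rewrite -/p in h1 h2.
have h3 := ler_wpM2l p0 h2; have h4 := ler_wpM2l u0 h2.
have h5 := ler_wpM2l (ltW d0) h1; lra.
Qed.

Definition hcAlg : cstarAlg R :=
  @CstarAlg R hc hmul hst hmulA hmul_linl hmul_linr hmul_norm hst_lin hstK hstM hcstar.

Lemma hjM x y : P x -> P y -> hj (mu x y) = amul (hj x : hcAlg) (hj y).
Proof.
move=> Px Py; rewrite (hjE Px) (hjE Py) (hjE (ps_domM Px Py)) /= hmul_cl.
exact: cl_ext.
Qed.

Lemma hjS x : P x -> hj (st x) = astar (hj x : hcAlg).
Proof.
move=> Px; rewrite (hjE Px) (hjE (ps_domS Px)) /= hst_cl.
exact: cl_ext.
Qed.

(** If Cauchy sequences already converge, the completion adds nothing. This turns a closed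
    *-subalgebra, given as a set, into an algebra of its own. *)
Lemma hj_onto : (forall u, good u -> exists2 x, P x & slim nu u x) ->
  forall q : hcAlg, exists2 x, P x & q = hj x.
Proof.
move=> h q; have [x Px ux] := h _ (good_rep q); exists x => //.
rewrite (hjE Px) -[LHS](repK q); apply: cl_eq => e /ux[N k].
by exists N => n /k.
Qed.

End PrestarTheory.

(** * Unitization *)
Notation "x ** y" := (amul x y) (at level 40, left associativity).

Section OperatorSeminorm.
Variables (R : realType) (X : Type) (W : set X) (N : X -> R).
Hypothesis N_ge0 : forall x, W x -> 0 <= N x.

Definition opbound (f : X -> X) (M : R) := 0 <= M /\ forall x, W x -> N (f x) <= M * N x.

(** The infimum of the empty set is 0, so an unbounded [f] gets the value 0; this is why [opnP] asks
    for some bound. *)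
Definition opn (f : X -> X) : R := inf [set M | opbound f M].

Lemma opn_ge0 f : 0 <= opn f.
Proof.
rewrite /opn; have [->|/set0P ne] := eqVneq [set M | opbound f M] set0.
  by rewrite inf0.
by apply: lb_le_inf => // M [].
Qed.

Lemma opn_le f M : opbound f M -> opn f <= M.
Proof. by move=> b; apply: ge_inf => //; exists 0 => ? []. Qed.

Lemma opnP f M x : opbound f M -> W x -> N (f x) <= opn f * N x.
Proof.
move=> b Wx; have := N_ge0 Wx; rewrite le_eqVlt => /predU1P[e|Nx0].
  by case: b => _ /(_ x Wx); rewrite -e !mulr0.
rewrite -ler_pdivrMr //; apply: lb_le_inf; first by exists M.
by move=> K [K0 h]; rewrite ler_pdivrMr // h.
Qed.

End OperatorSeminorm.

Section CstarTheory.
Variables (R : realType) (A : cstarAlg R).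
Implicit Types x y z : A.

Lemma amulDl x y z : (x + y) ** z = x ** z + y ** z.
Proof. by rewrite -[x]scale1r amul_linl !scale1r. Qed.
Lemma amulDr x y z : x ** (y + z) = x ** y + x ** z.
Proof. by rewrite -[y]scale1r amul_linr !scale1r. Qed.
Lemma amul0l x : 0 ** x = 0.
Proof. by apply: (addrI (0 ** x)); rewrite -amulDl !addr0. Qed.
Lemma amul0r x : x ** 0 = 0.
Proof. by apply: (addrI (x ** 0)); rewrite -amulDr !addr0. Qed.
Lemma amulZl (c : R[i]) x y : (c *: x) ** y = c *: (x ** y).
Proof. by rewrite -[c *: x]addr0 amul_linl amul0l addr0. Qed.
Lemma amulZr (c : R[i]) x y : x ** (c *: y) = c *: (x ** y).
Proof. by rewrite -[c *: y]addr0 amul_linr amul0r addr0. Qed.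
Lemma amulNl x y : (- x) ** y = - (x ** y).
Proof. by rewrite -scaleN1r amulZl scaleN1r. Qed.
Lemma amulNr x y : x ** (- y) = - (x ** y).
Proof. by rewrite -scaleN1r amulZr scaleN1r. Qed.
Lemma amulBl x y z : (x - y) ** z = x ** z - y ** z.
Proof. by rewrite amulDl amulNl. Qed.
Lemma amulBr x y z : x ** (y - z) = x ** y - x ** z.
Proof. by rewrite amulDr amulNr. Qed.
Lemma astarD x y : astar (x + y) = astar x + astar y.
Proof. by rewrite -[x]scale1r astar_antilin conjC1 !scale1r. Qed.
Lemma astar0 : astar (0 : A) = 0.
Proof. by apply: (addrI (astar 0)); rewrite -astarD !addr0. Qed.
Lemma astarZ (c : R[i]) x : astar (c *: x) = c^* *: astar x.
Proof. by rewrite -[c *: x]addr0 astar_antilin astar0 addr0. Qed.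
Lemma astarN x : astar (- x) = - astar x.
Proof. by rewrite -scaleN1r astarZ rmorphN1 scaleN1r. Qed.
Lemma astarB x y : astar (x - y) = astar x - astar y.
Proof. by rewrite astarD astarN. Qed.

Lemma nmM x y : nm (x ** y) <= nm x * nm y.
Proof. by rewrite -lecR rmorphM /= -!nmE anormM. Qed.
Lemma nm_cstar x : nm (astar x ** x) = nm x ^+ 2.
Proof. by apply: complexI; rewrite rmorphXn /= -!nmE anorm_cstar. Qed.

Lemma nm_astar x : nm (astar x) = nm x.
Proof.
have le y : nm y <= nm (astar y).
  have := nmM (astar y) y; rewrite nm_cstar expr2.
  have := nm_ge0 y; rewrite le_eqVlt => /predU1P[<- _|h]; first exact: nm_ge0.
  by rewrite ler_pM2r.
by apply/eqP; rewrite eq_le le andbT -{2}[x]astarK le.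
Qed.

End CstarTheory.

Section Unitization.
Variables (R : realType) (A : cstarAlg R).

(* A new unit is adjoined even if [A] is unital. *)
Definition unitz : Type := (R[i] * A)%type.
HB.instance Definition _ := GRing.Lmodule.copy unitz (R[i]^o * A)%type.

Implicit Types x y z : unitz.

Definition umul x y : unitz :=
  (x.1 * y.1, x.1 *: y.2 + y.1 *: x.2 + x.2 ** y.2).
Definition uone : unitz := (1, 0).

Lemma unitzP x y : x.1 = y.1 -> x.2 = y.2 -> x = y.
Proof. by case: x y => [c a] [d b] /= -> ->. Qed.
Lemma u1D x y : (x + y).1 = x.1 + y.1. Proof. by []. Qed.
Lemma u2D x y : (x + y).2 = x.2 + y.2. Proof. by []. Qed.
Lemma u1Z (c : R[i]) x : (c *: x).1 = c * x.1. Proof. by []. Qed.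
Lemma u2Z (c : R[i]) x : (c *: x).2 = c *: x.2. Proof. by []. Qed.
Lemma u1N x : (- x).1 = - x.1. Proof. by []. Qed.
Lemma u2N x : (- x).2 = - x.2. Proof. by []. Qed.

Fact umulA : associative umul.
Proof.
move=> x y z; apply: unitzP; rewrite /umul /= ?mulrA //.
rewrite !scalerDr !amulDl !amulDr !amulZl !amulZr amulA !scalerA.
rewrite ?addrA [z.1 * x.1]mulrC [z.1 * y.1]mulrC; congr (_ + _).
rewrite -!addrA; congr (_ + (_ + _)).
by rewrite addrCA; congr (_ + _); rewrite addrA addrC.
Qed.
Fact umul1r : left_id uone umul.
Proof.
by move=> x; apply: unitzP; rewrite /umul /= ?mul1r // scale1r scaler0 amul0l !addr0.
Qed.
Fact umulr1 : right_id uone umul.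
Proof.
by move=> x; apply: unitzP; rewrite /umul /= ?mulr1 // scale1r scaler0 amul0r !addr0 add0r.
Qed.
Fact umulDl : left_distributive umul +%R.
Proof.
move=> x y z; apply: unitzP; rewrite /umul /= ?mulrDl //.
by rewrite scalerDl scalerDr amulDl [RHS]addrACA [X in _ = X + _]addrACA.
Qed.
Fact umulDr : right_distributive umul +%R.
Proof.
move=> x y z; apply: unitzP; rewrite /umul /= ?mulrDr //.
by rewrite scalerDl scalerDr amulDr [RHS]addrACA [X in _ = X + _]addrACA.
Qed.
Fact uone_neq0 : uone != 0.
Proof. by apply/eqP => /(congr1 fst) /= /eqP; rewrite oner_eq0. Qed.

HB.instance Definition _ := GRing.Zmodule_isNzRing.Build unitz
  umulA umul1r umulr1 umulDl umulDr uone_neq0.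

Lemma u11 : (1 : unitz).1 = 1. Proof. by []. Qed.
Lemma u21 : (1 : unitz).2 = 0. Proof. by []. Qed.
Lemma u1M x y : (x * y).1 = x.1 * y.1. Proof. by []. Qed.

Fact uscalerAl (c : R[i]) x y : c *: (x * y) = (c *: x) * y.
Proof.
apply: unitzP; first exact: mulrA.
by rewrite /GRing.mul /= !scalerDr !scalerA [y.1 * c]mulrC amulZl.
Qed.
HB.instance Definition _ := GRing.Lmodule_isLalgebra.Build R[i] unitz uscalerAl.
Fact uscalerAr (c : R[i]) x y : c *: (x * y) = x * (c *: y).
Proof.
apply: unitzP; first by rewrite /GRing.mul /= mulrCA.
by rewrite /GRing.mul /= !scalerDr !scalerA [x.1 * c]mulrC amulZr.
Qed.
HB.instance Definition _ := GRing.Lalgebra_isAlgebra.Build R[i] unitz uscalerAr.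

Definition ustar x : unitz := (x.1^*, astar x.2).

Lemma ustarD x y : ustar (x + y) = ustar x + ustar y.
Proof. by apply: unitzP; rewrite /= ?rmorphD ?astarD. Qed.
Lemma ustarZ (c : R[i]) x : ustar (c *: x) = c^* *: ustar x.
Proof. by apply: unitzP; rewrite /= ?rmorphM ?astarZ. Qed.
Lemma ustarN x : ustar (- x) = - ustar x.
Proof. by apply: unitzP; rewrite /= ?rmorphN ?astarN. Qed.
Lemma ustarB x y : ustar (x - y) = ustar x - ustar y.
Proof. by rewrite ustarD ustarN. Qed.
Lemma ustarK x : ustar (ustar x) = x.
Proof. by apply: unitzP; rewrite /= ?conjCK ?astarK. Qed.
Lemma ustarM x y : ustar (x * y) = ustar y * ustar x.
Proof.
apply: unitzP; rewrite /GRing.mul /= ?rmorphM /=; first by rewrite mulrC.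
by rewrite !astarD !astarZ astarM [X in X + _]addrC.
Qed.
Lemma ustar1 : ustar 1 = 1.
Proof. by apply: unitzP; rewrite /= ?conjC1 ?astar0. Qed.
Lemma ustar0 : ustar 0 = 0.
Proof. by apply: unitzP; rewrite /= ?conjC0 ?astar0. Qed.

Definition uact x (a : A) : A := x.1 *: a + x.2 ** a.

Lemma uactM x y a : uact (x * y) a = uact x (uact y a).
Proof.
rewrite /uact /GRing.mul /= !amulDl !amulDr !scalerDr !scalerA !amulZl !amulZr amulA.
by rewrite -!addrA; congr (_ + _); congr (_ + _).
Qed.
Lemma uactD x y a : uact (x + y) a = uact x a + uact y a.
Proof. by rewrite /uact /= scalerDl amulDl addrACA. Qed.
Lemma uactZ (c : R[i]) x a : uact (c *: x) a = c *: uact x a.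
Proof. by rewrite /uact /= amulZl scalerDr scalerA. Qed.
Lemma uact1 a : uact 1 a = a.
Proof. by rewrite /uact /= scale1r amul0l addr0. Qed.
Lemma uact_star x a b : astar (uact x a) ** b = astar a ** uact (ustar x) b.
Proof.
by rewrite /uact /= astarD astarZ astarM amulDl amulDr !amulZl !amulZr amulA.
Qed.

Local Notation bnd x := (@opbound R A setT (@nm R A) (uact x)).

(** The operator norm of left multiplication alone is not a norm when [A] has a unit [e]: then
    [(-1, e)] acts as zero. The scalar part repairs this. *)
Definition un x : R := Num.max (cabs x.1) (@opn R A setT (@nm R A) (uact x)).

Lemma uact_bound x : bnd x (cabs x.1 + nm x.2).
Proof.
split=> [|a _]; first by rewrite addr_ge0 ?cabs_ge0 ?nm_ge0.
by apply: le_trans (nmD _ _) _; rewrite nmZ mulrDl lerD2l nmM.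
Qed.

Lemma un_act x a : nm (uact x a) <= un x * nm a.
Proof.
apply: le_trans (opnP (fun a _ => nm_ge0 a) (uact_bound x) _) _ => //.
by rewrite ler_wpM2r ?nm_ge0 // le_max lexx orbT.
Qed.

Lemma un_scal x : cabs x.1 <= un x.
Proof. by rewrite le_max lexx. Qed.

Lemma un_ge0 x : 0 <= un x.
Proof. exact: le_trans (cabs_ge0 _) (un_scal x). Qed.

Lemma un_le x M : 0 <= M -> cabs x.1 <= M -> (forall a, nm (uact x a) <= M * nm a) ->
  un x <= M.
Proof. by move=> M0 h1 h2; rewrite ge_max h1 opn_le. Qed.

Lemma unD x y : un (x + y) <= un x + un y.
Proof.
apply: un_le => [||a]; first by rewrite addr_ge0 ?un_ge0.
  by apply: le_trans (cabsD _ _) _; rewrite lerD ?un_scal.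
by rewrite uactD mulrDl (le_trans (nmD _ _)) // lerD ?un_act.
Qed.

Lemma unZ_le (c : R[i]) x : un (c *: x) <= cabs c * un x.
Proof.
apply: un_le => [||a]; first by rewrite mulr_ge0 ?cabs_ge0 ?un_ge0.
  by rewrite cabsM ler_wpM2l ?cabs_ge0 ?un_scal.
by rewrite uactZ nmZ -mulrA ler_wpM2l ?cabs_ge0 ?un_act.
Qed.

Lemma unZ (c : R[i]) x : un (c *: x) = cabs c * un x.
Proof.
apply/eqP; rewrite eq_le unZ_le /=.
have [->|c0] := eqVneq c 0; first by rewrite cabs0 mul0r un_ge0.
rewrite -{1}[x]scale1r -[X in _ * un (X *: _)](mulVf c0) -scalerA.
apply: le_trans (ler_wpM2l (cabs_ge0 c) (unZ_le _ _)) _.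
by rewrite mulrA -cabsM mulfV // cabs1 mul1r.
Qed.

Lemma unN x : un (- x) = un x.
Proof. by rewrite -scaleN1r unZ cabsN cabs1 mul1r. Qed.

Lemma unBC x y : un (x - y) = un (y - x).
Proof. by rewrite -unN opprB. Qed.

Lemma unB x y : un (x - y) <= un x + un y.
Proof. by rewrite -(unN y) unD. Qed.

Lemma unM x y : un (x * y) <= un x * un y.
Proof.
apply: un_le => [||a]; first by rewrite mulr_ge0 ?un_ge0.
  by rewrite cabsM ler_pM ?cabs_ge0 ?un_scal.
rewrite uactM (le_trans (un_act _ _)) // -mulrA ler_wpM2l ?un_ge0 //.
exact: un_act.
Qed.

Lemma un0 : un 0 = 0.
Proof. by rewrite -(scale0r (0 : unitz)) unZ cabs0 mul0r. Qed.

Lemma un1 : un 1 = 1.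
Proof.
apply/eqP; rewrite eq_le; apply/andP; split.
  by apply: un_le => // [|a]; rewrite ?cabs1 // uact1 mul1r.
by apply: le_trans (un_scal 1); rewrite cabs1.
Qed.

(** As on a Hilbert space: [|x a|^2] is the norm of [a^* x^* x a], at most [|x^* x| |a|^2]. *)
Lemma un_cstar_ge x : un x ^+ 2 <= un (ustar x * x).
Proof.
have h0 := un_ge0 (ustar x * x).
rewrite -(@ler_sqrt R) // sqrtr_sqr (ger0_norm (un_ge0 _)).
apply: un_le => [||a]; first exact: sqrtr_ge0.
  rewrite -(ger0_norm (cabs_ge0 _)) -sqrtr_sqr ler_sqrt //.
  by rewrite -cabs_sqr; exact: (un_scal (ustar x * x)).
have n0 := nm_ge0 a; have n1 := nm_ge0 (uact x a).
rewrite -(ger0_norm n1) -(ger0_norm n0) -!sqrtr_sqr -sqrtrM // ler_sqrt ?mulr_ge0 ?sqr_ge0 //.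
rewrite -nm_cstar uact_star -uactM (le_trans (nmM _ _)) // nm_astar.
by have := un_act (ustar x * x) a; nra.
Qed.

Lemma un_star x : un (ustar x) = un x.
Proof.
have le y : un y <= un (ustar y).
  have := le_trans (un_cstar_ge y) (unM (ustar y) y); rewrite expr2.
  have := un_ge0 y; rewrite le_eqVlt => /predU1P[<- _|h]; first exact: un_ge0.
  by rewrite ler_pM2r.
by apply/eqP; rewrite eq_le le andbT -{2}[x]ustarK le.
Qed.

Lemma un_cstar x : un (ustar x * x) = un x ^+ 2.
Proof.
by apply/eqP; rewrite eq_le un_cstar_ge andbT (le_trans (unM _ _)) // un_star expr2.
Qed.

Definition uin (a : A) : unitz := (0, a).

Lemma un_uin a : un (uin a) = nm a.
Proof.
apply/eqP; rewrite eq_le; apply/andP; split.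
  apply: un_le => [||b]; rewrite ?nm_ge0 //= ?cabs0 ?nm_ge0 //.
  by rewrite /uact /= scale0r add0r nmM.
(* The test vector [astar a] attains the norm of left multiplication by [a], by the C*-identity. *)
have := un_act (uin a) (astar a); rewrite /uact /= scale0r add0r nm_astar.
rewrite -{1}[a]astarK nm_cstar nm_astar expr2.
by apply: ler_sqrW; [exact: nm_ge0|exact: un_ge0].
Qed.

Lemma nm_u2 x : nm x.2 <= 2 * un x.
Proof.
have e : uin x.2 = x - x.1 *: 1.
  apply: unitzP; first by rewrite u1D u1N u1Z u11 mulr1 subrr.
  by rewrite u2D u2N u2Z u21 scaler0 subr0.
rewrite -un_uin e (le_trans (unB _ _)) // unZ un1 mulr1.
by have := un_scal x; lra.
Qed.

Lemma un_eq0 x : un x = 0 -> x = 0.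
Proof.
move=> h; apply: unitzP => /=.
  by apply/cabs_eq0/eqP; rewrite eq_le cabs_ge0 andbT -h un_scal.
by apply/nm_eq0/eqP; rewrite eq_le nm_ge0 (le_trans (nm_u2 x)) // h mulr0.
Qed.

Lemma uinM a b : uin a * uin b = uin (a ** b).
Proof. by apply: unitzP; rewrite /GRing.mul /= ?mul0r // !scale0r !add0r. Qed.
Lemma uinD a b : uin (a + b) = uin a + uin b.
Proof. by apply: unitzP => //; rewrite u1D addr0. Qed.
Lemma uinZ (c : R[i]) a : uin (c *: a) = c *: uin a.
Proof. by apply: unitzP => //; rewrite u1Z mulr0. Qed.
Lemma uinN a : uin (- a) = - uin a.
Proof. by apply: unitzP => //; rewrite u1N oppr0. Qed.
Lemma uinB a b : uin (a - b) = uin a - uin b.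
Proof. by rewrite uinD uinN. Qed.
Lemma uin_star a : ustar (uin a) = uin (astar a).
Proof. by apply: unitzP => //=; rewrite conjC0. Qed.
Lemma uin_inj : injective uin.
Proof. by move=> a b []. Qed.
Lemma uinP x : x.1 = 0 -> x = uin x.2.
Proof. by move=> h; exact: unitzP. Qed.
Lemma un_scauchy (u : nat -> unitz) : scauchy un u -> exists x, slim un u x.
Proof.
move=> cu.
have [c hc] : exists c : R[i], slim (@cabs R) (fun n => (u n).1) c.
  have [a ha] : exists a : R, slim (fun x : R => `|x|) (fun n => complex.Re (u n).1) a.
    apply: scauchy_slim_real => e /cu[N h]; exists N => n m Nn Nm.
    apply: le_lt_trans (h n m Nn Nm); apply: le_trans (un_scal _).
    by rewrite -ReB; exact: abs_Re_le.
  have [b hb] : exists b : R, slim (fun x : R => `|x|) (fun n => complex.Im (u n).1) b.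
    apply: scauchy_slim_real => e /cu[N h]; exists N => n m Nn Nm.
    apply: le_lt_trans (h n m Nn Nm); apply: le_trans (un_scal _).
    by rewrite -ImB; exact: abs_Im_le.
  exists (Complex a b) => e e0; have e20 : 0 < e / 2 by rewrite divr_gt0.
  have [N h] := ha _ e20; have [M k] := hb _ e20.
  exists (maxn N M) => n; rewrite geq_max => /andP[/h h1 /k k1].
  by apply: le_lt_trans (cabs_le _) _; rewrite ReB ImB /=; lra.
have [a ha] : exists a : A, slim (@nm R A) (fun n => (u n).2) a.
  apply: scauchy_slim => e e0; have e20 : 0 < e / 2 by rewrite divr_gt0.
  have [N h] := cu _ e20; exists N => n m Nn Nm.
  have := nm_u2 (u n - u m); have := h n m Nn Nm => /=; lra.
exists (c, a) => e e0; have e20 : 0 < e / 2 by rewrite divr_gt0.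
have [N h] := hc _ e20; have [M k] := ha _ e20.
exists (maxn N M) => n; rewrite geq_max => /andP[/h h1 /k k1].
have -> : u n - (c, a) = ((u n).1 - c) *: 1 + uin ((u n).2 - a).
  apply: unitzP; first by rewrite !u1D u1Z u11 mulr1 addr0.
  by rewrite !u2D u2Z u21 scaler0 add0r.
by apply: le_lt_trans (unD _ _) _; rewrite unZ un1 mulr1 un_uin; lra.
Qed.

End Unitization.

Global Opaque un.

(** * Square roots of self-adjoint elements *)
Lemma conjR (R : realType) (r : R) : (r%:C)^* = r%:C.
Proof. by apply/CrealP; rewrite complex_real. Qed.

Lemma conj_i (R : realType) : ('i%C : R[i])^* = - 'i%C.
Proof. by apply/eqP; rewrite eq_complex /= oppr0 !eqxx. Qed.

Section UnitizationLimits.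
Variables (R : realType) (A : cstarAlg R).
Local Notation U := (unitz A).
Implicit Types (x y z : U) (u v : nat -> U).

Lemma ulim_uniq u x y : slim (@un R A) u x -> slim (@un R A) u y -> x = y.
Proof.
move=> hx hy; apply/subr0_eq/un_eq0/eqP; rewrite eq_le un_ge0 andbT.
apply: ler_eps => e e0; have e20 : 0 < e / 2 by rewrite divr_gt0.
have [N h] := hx _ e20; have [M k] := hy _ e20; pose n := maxn N M.
have := h n (leq_maxl _ _); have := k n (leq_maxr _ _).
have := unD (x - u n) (u n - y); rewrite (subrKA (u n)) (unBC x); lra.
Qed.

Lemma ulim_le u x M : slim (@un R A) u x -> (forall n, un (u n) <= M) -> un x <= M.
Proof.
move=> hx hM; apply: ler_eps => e /hx[N /(_ N (leqnn _)) h].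
have := unB (u N) (u N - x); rewrite subKr; have := hM N; lra.
Qed.

Lemma ulim_shift u x : slim (@un R A) u x -> slim (@un R A) (fun n => u n.+1) x.
Proof. by move=> hx e /hx[N h]; exists N => n /leqW /h. Qed.

Lemma ulim_ext u v x : slim (@un R A) u x -> u =1 v -> slim (@un R A) v x.
Proof. by move=> hx /funext <-. Qed.

Lemma ulim_cst x : slim (@un R A) (fun=> x) x.
Proof. by move=> e e0; exists 0%N => n _; rewrite subrr un0. Qed.

Lemma ulim_lin (c : R[i]) u v x y : slim (@un R A) u x -> slim (@un R A) v y ->
  slim (@un R A) (fun n => c *: u n + v n) (c *: x + y).
Proof.
move=> hx hy e e0; have c0 := cabs_ge0 c.
have e20 : 0 < e / 2 by rewrite divr_gt0.
have e30 : 0 < e / 2 / (cabs c + 1) by rewrite !divr_gt0 //; lra.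
have [N h] := hx _ e30; have [M k] := hy _ e20.
exists (maxn N M) => n; rewrite geq_max => /andP[/h h1 /k k1].
rewrite opprD addrACA -scalerBr; apply: le_lt_trans (unD _ _) _; rewrite unZ.
have : un (u n - x) * (cabs c + 1) < e / 2 by rewrite -ltr_pdivlMr //; lra.
have := un_ge0 (u n - x); nra.
Qed.

Lemma ulimM u v x y M : (forall n, un (u n) <= M) ->
  slim (@un R A) u x -> slim (@un R A) v y ->
  slim (@un R A) (fun n => u n * v n) (x * y).
Proof.
move=> hM hx hy e e0.
have M0 : 0 <= M := le_trans (un_ge0 _) (hM 0%N).
pose K := M + un y + 1; have K0 : 0 < K by have := un_ge0 y; rewrite /K; lra.
have e20 : 0 < e / 2 / K by rewrite !divr_gt0.
have [N1 h] := hx _ e20; have [N2 k] := hy _ e20.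
exists (maxn N1 N2) => n; rewrite geq_max => /andP[/h h1 /k k1].
have -> : u n * v n - x * y = u n * (v n - y) + (u n - x) * y.
  by rewrite mulrBr mulrBl addrA subrK.
apply: le_lt_trans (unD _ _) _.
have h2 := unM (u n) (v n - y); have h3 := unM (u n - x) y.
have h4 : un (v n - y) * K < e / 2 by rewrite -ltr_pdivlMr.
have h5 : un (u n - x) * K < e / 2 by rewrite -ltr_pdivlMr.
have := hM n; have := un_ge0 (v n - y); have := un_ge0 (u n - x).
have := un_ge0 (u n); have := un_ge0 y; rewrite /K in h4 h5; nra.
Qed.

Lemma ulim_star u x : slim (@un R A) u x ->
  slim (@un R A) (fun n => ustar (u n)) (ustar x).
Proof. by move=> hx e /hx[N h]; exists N => n /h; rewrite -ustarB un_star. Qed.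

(** The method of majorants: [g] is monotone and bounded, hence convergent, and its increments
    dominate those of [u]. *)
Lemma majorized_scauchy u (g : nat -> R) (M : R) :
  (forall n, un (u n.+1 - u n) <= g n.+1 - g n) -> (forall n, g n <= M) ->
  scauchy (@un R A) u.
Proof.
move=> hu hM.
have mono : {homo g : n m / (n <= m)%N >-> n <= m}.
  apply: homo_leq => [//|? ? ?|n]; first exact: le_trans.
  by have := hu n; have := un_ge0 (u n.+1 - u n); lra.
have dist n m : (n <= m)%N -> un (u m - u n) <= g m - g n.
  elim: m => [|m IH]; first by rewrite leqn0 => /eqP ->; rewrite !subrr un0.
  rewrite leq_eqVlt => /predU1P[->|]; first by rewrite !subrr un0.
  rewrite ltnS => /IH h; rewrite -(subrKA (u m)).
  by apply: le_trans (unD _ _) _; have := hu m; lra.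
have cg : cvgn g.
  by apply: nondecreasing_is_cvgn => //; exists M => _ [n _ <-].
move=> e e0; have e20 : 0 < e / 2 by rewrite divr_gt0.
have /cvgrPdist_lt/(_ _ e20)[N _ h] := cg.
exists N.
suff H n m : (n <= m)%N -> (N <= n)%N -> (N <= m)%N -> un (u m - u n) < e.
  by move=> n m Nn Nm; case/orP: (leq_total n m) => nm; [rewrite unBC|]; exact: H.
move=> nm /h + /h; rewrite /= !ltr_norml => /andP[? ?] /andP[? ?].
by apply: le_lt_trans (dist _ _ nm) _; lra.
Qed.

End UnitizationLimits.

Section SquareRoot.
Variables (R : realType) (A : cstarAlg R).
Local Notation U := (unitz A).
Implicit Types (x y z w : U).

Definition usa x := ustar x = x.

Lemma usaD x y : usa x -> usa y -> usa (x + y).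
Proof. by rewrite /usa ustarD => -> ->. Qed.
Lemma usaZ (r : R) x : usa x -> usa (r%:C *: x).
Proof. by rewrite /usa ustarZ conjR => ->. Qed.
Lemma usaN x : usa x -> usa (- x).
Proof. by rewrite /usa ustarN => ->. Qed.
Lemma usaB x y : usa x -> usa y -> usa (x - y).
Proof. by move=> ? ?; apply: usaD => //; exact: usaN. Qed.
Lemma usaM x y : usa x -> usa y -> GRing.comm x y -> usa (x * y).
Proof. by rewrite /usa ustarM => -> ->. Qed.
Lemma usaMM x : usa x -> usa (x * x).
Proof. by move=> h; exact: usaM. Qed.
Lemma usa1 : usa 1. Proof. exact: ustar1. Qed.
Lemma un_sqr x : usa x -> un (x * x) = un x ^+ 2.
Proof. by move=> h; rewrite -un_cstar h. Qed.

Lemma commrZ (c : R[i]) x y : GRing.comm x y -> GRing.comm x (c *: y).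
Proof. by rewrite /GRing.comm => h; rewrite -scalerAr -scalerAl h. Qed.

(* [x + iy] is normal with square modulus [x^2 + y^2]. *)
Lemma un_two_squares x y : usa x -> usa y -> GRing.comm x y ->
  un x ^+ 2 <= un (x * x + y * y).
Proof.
move=> sx sy xy; pose u := x + 'i%C *: y.
have us : ustar u = x - 'i%C *: y by rewrite ustarD ustarZ conj_i sx sy scaleNr.
have -> : x * x + y * y = ustar u * u.
  have ii : 'i%C * 'i%C = -1 :> R[i] by rewrite -expr2 sqr_i.
  rewrite us /u mulrBl !mulrDr -!scalerAr -!scalerAl xy scalerA ii.
  by rewrite scaleN1r opprB addrACA subrr addr0.
rewrite un_cstar ler_pXn2r ?nnegrE ?un_ge0 //.
have : un (2%:R *: x) <= un u + un u.
  rewrite -{2}(un_star u); apply: le_trans (unD _ _).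
  by rewrite us addrACA subrr addr0 scaler_nat mulr2n.
have e2 : 2%:R = (2%:R : R)%:C :> R[i] by rewrite rmorph_nat.
by rewrite unZ e2 cabs_real normr_nat; lra.
Qed.

(** Iterates for the equation [g = (x + g^2) / 2], which is equivalent to [(1 - g)^2 = 1 - x]; the
    limit [sq1 x] is [1 - sqrt(1 - x)]. *)
Fixpoint sqseq x n : U :=
  if n is n'.+1 then (2^-1)%:C *: (x + sqseq x n' * sqseq x n') else 0.

(* The same iteration for the scalar [1] majorizes the one in [U]. *)
Fixpoint sqmaj n : R :=
  if n is n'.+1 then 2^-1 * (1 + sqmaj n' * sqmaj n') else 0.

Lemma sqmajP n : [/\ 0 <= sqmaj n, sqmaj n <= 1 & sqmaj n <= sqmaj n.+1].
Proof.
have le (t : R) : t <= 2^-1 * (1 + t * t) by have := sqr_ge0 (1 - t); rewrite expr2; lra.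
elim: n => [|n [h1 h2 _]]; split; rewrite //= ?le //.
  by apply: mulr_ge0; rewrite ?invr_ge0 // addr_ge0 // mulr_ge0.
have : sqmaj n * sqmaj n <= 1 by nra.
lra.
Qed.

Lemma cabs_half : cabs (2^-1 : R)%:C = 2^-1.
Proof. by rewrite cabs_real ger0_norm // invr_ge0. Qed.

Lemma un_sqseq x n : un x <= 1 -> un (sqseq x n) <= sqmaj n.
Proof.
move=> x1; elim: n => [|n IH] /=; first by rewrite un0.
rewrite unZ cabs_half ler_pM2l ?invr_gt0 //.
apply: le_trans (unD _ _) _; apply: lerD => //; apply: le_trans (unM _ _) _.
by have := un_ge0 (sqseq x n); nra.
Qed.

Lemma un_sqseqS x n : un x <= 1 ->
  un (sqseq x n.+1 - sqseq x n) <= sqmaj n.+1 - sqmaj n.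
Proof.
move=> x1; elim: n => [|n IH].
  by rewrite /= !(mul0r, subr0, addr0) unZ cabs_half; lra.
rewrite [sqseq _ n.+2]/= [sqseq _ n.+1]/= -/(sqseq x n.+1) -scalerBr.
rewrite opprD addrACA subrr add0r unZ cabs_half.
set g := sqseq x n.+1 in IH *; set g' := sqseq x n in IH *.
have -> : g * g - g' * g' = g * (g - g') + (g - g') * g'.
  by rewrite mulrBr mulrBl addrA subrK.
have h1 := unM g (g - g'); have h2 := unM (g - g') g'.
have h3 := unD (g * (g - g')) ((g - g') * g').
have h4 := un_sqseq n.+1 x1; have h5 := un_sqseq n x1; rewrite -/g -/g' in h4 h5.
have [a1 a2 a3] := sqmajP n; have [b1 b2 b3] := sqmajP n.+1.
have u1 := un_ge0 g; have u2 := un_ge0 g'; have u3 := un_ge0 (g - g').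
have -> : sqmaj n.+2 - sqmaj n.+1 =
    2^-1 * ((sqmaj n.+1 - sqmaj n) * (sqmaj n.+1 + sqmaj n)).
  by rewrite /=; field.
rewrite ler_pM2l ?invr_gt0 //.
have h6 := ler_pM u1 u3 h4 IH; have h7 := ler_pM u3 u2 IH h5; lra.
Qed.

Definition sq1 x : U := xget 0 [set g | slim (@un R A) (sqseq x) g].

Lemma sq1_lim x : un x <= 1 -> slim (@un R A) (sqseq x) (sq1 x).
Proof.
move=> x1; rewrite /sq1; case: xgetP => [g -> //|/= h].
have [|g /h //] := @un_scauchy R A (sqseq x).
by apply: (majorized_scauchy (M := 1) (fun n => un_sqseqS n x1)) => n; have [] := sqmajP n.
Qed.

Lemma un_sqseq1 x n : un x <= 1 -> un (sqseq x n) <= 1.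
Proof. by move=> x1; apply: le_trans (un_sqseq n x1) _; have [] := sqmajP n. Qed.

Lemma un_sq1 x : un x <= 1 -> un (sq1 x) <= 1.
Proof. by move=> x1; apply: ulim_le (sq1_lim x1) _ => n; exact: un_sqseq1. Qed.

Lemma usa_sq1 x : un x <= 1 -> usa x -> usa (sq1 x).
Proof.
move=> x1 sx; apply: (ulim_uniq _ (sq1_lim x1)).
have /ulim_ext := ulim_star (sq1_lim x1); apply; elim=> [|n IH] /=; first exact: ustar0.
by rewrite ustarZ conjR ustarD ustarM sx IH.
Qed.

Lemma sq1_eq x : un x <= 1 -> sq1 x = (2^-1)%:C *: (x + sq1 x * sq1 x).
Proof.
move=> x1; apply: (ulim_uniq (ulim_shift (sq1_lim x1))) => /=.
have l1 := sq1_lim x1; have l2 := ulimM (fun n => un_sqseq1 n x1) l1 l1.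
have l3 := ulim_lin 1 (ulim_cst x) l2.
have := ulim_lin (2^-1)%:C l3 (ulim_cst 0).
rewrite addr0 scale1r => /ulim_ext; apply=> n /=.
by rewrite addr0 ?scale1r.
Qed.

Lemma double_half x : (2^-1)%:C *: x + (2^-1)%:C *: x = x.
Proof.
have e : 2^-1 + 2^-1 = 1 :> R by lra.
by rewrite -scalerDl -rmorphD /= e scale1r.
Qed.

Lemma sq1_sqr x : un x <= 1 -> (1 - sq1 x) * (1 - sq1 x) = 1 - x.
Proof.
move=> x1; set g := sq1 x.
have e : g + g = x + g * g by rewrite {1 2}/g sq1_eq // double_half.
have ex : x = g + g - g * g by rewrite e addrK.
rewrite mulrBl mul1r mulrBr mulr1 [in RHS]ex -addrA; congr (_ + _).
by rewrite -opprD addrA.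
Qed.

Lemma sq1_comm x z : un x <= 1 -> GRing.comm z x -> GRing.comm z (sq1 x).
Proof.
move=> x1 zx; have l1 := sq1_lim x1.
have l2 := ulimM (M := un z) (fun=> lexx _) (ulim_cst z) l1.
have l3 := ulimM (fun n => un_sqseq1 n x1) l1 (ulim_cst z).
apply: (ulim_uniq l2); apply: (ulim_ext l3); elim=> [|n IH] /=; first by rewrite mul0r mulr0.
rewrite -scalerAr -scalerAl mulrDr mulrDl zx; congr (_ *: (_ + _)).
by rewrite -mulrA IH mulrA IH -mulrA.
Qed.

(** The root [k] of [1 - y^2] satisfies [k^2 + y^2 = 1], so [un_two_squares] bounds [k], hence
    [k^2]. *)
Lemma un_1Bsqr y : usa y -> un y <= 1 -> un (1 - y * y) <= 1.
Proof.
move=> sy y1.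
have yy1 : un (y * y) <= 1 by rewrite un_sqr // expr_le1 // un_ge0.
have syy := usaMM sy; have sg := usa_sq1 yy1 syy.
have sk : usa (1 - sq1 (y * y)) by apply: usaB => //; exact: usa1.
rewrite -(sq1_sqr yy1) un_sqr //; apply: le_trans (un_two_squares sk sy _) _.
  apply/commr_sym/commrB; first exact: commr1.
  by apply: sq1_comm => //; exact: commrM.
by rewrite sq1_sqr // subrK un1.
Qed.

(** The absolute value of a self-adjoint contraction, as the root of [w * w]. The root [sqabsu w] of
    [absu w] stands in for positivity: it exhibits [absu w] as a square. *)
Definition absu w : U := 1 - sq1 (1 - w * w).
Definition sqabsu w : U := 1 - sq1 (sq1 (1 - w * w)).

Section AbsU.
Variable w : U.
Hypotheses (sw : usa w) (w1 : un w <= 1).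
Let x1 : un (1 - w * w) <= 1 := un_1Bsqr sw w1.
Let sx : usa (1 - w * w). Proof. exact: usaB usa1 (usaMM sw). Qed.

Lemma absu_sqr : absu w * absu w = w * w.
Proof. by rewrite /absu sq1_sqr // subKr. Qed.

Lemma sqabsu_sqr : sqabsu w * sqabsu w = absu w.
Proof. by rewrite /sqabsu sq1_sqr ?un_sq1. Qed.

Lemma usa_absu : usa (absu w).
Proof. by apply: usaB; [exact: usa1|exact: usa_sq1]. Qed.

Lemma usa_sqabsu : usa (sqabsu w).
Proof. by apply: usaB; [exact: usa1|apply: usa_sq1; [exact: un_sq1|exact: usa_sq1]]. Qed.

Lemma sqabsu_comm z : GRing.comm z w -> GRing.comm z (sqabsu w).
Proof.
move=> zw; apply: commrB; first exact: commr1.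
apply: sq1_comm; first exact: un_sq1.
apply: sq1_comm => //; apply: commrB; first exact: commr1.
exact: commrM.
Qed.

Lemma absu_comm z : GRing.comm z w -> GRing.comm z (absu w).
Proof. by move=> /sqabsu_comm h; rewrite -sqabsu_sqr; exact: commrM. Qed.

End AbsU.

Lemma un_eq0_sqr x : usa x -> x * x = 0 -> x = 0.
Proof.
move=> sx h; apply: un_eq0; have := un_sqr sx; rewrite h un0 => /esym/eqP.
by rewrite sqrf_eq0 => /eqP.
Qed.

Lemma two_squares_eq0 x y : usa x -> usa y -> GRing.comm x y ->
  x * x + y * y = 0 -> x = 0.
Proof.
move=> sx sy xy h; have := un_two_squares sx sy xy; rewrite h un0 => h1.
by apply: un_eq0; apply/eqP; rewrite -sqrf_eq0 eq_le h1 sqr_ge0.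
Qed.

(** Uniqueness of the positive square root. With [d = t - t'] one has [d (t + t') = 0], so the
    squares of [d s] and [d s'] add up to 0; both vanish, hence so does [d^2 = d s^2 - d s'^2]. *)
Lemma pos_root_uniq s s' : usa s -> usa s' -> GRing.comm s s' ->
  (s * s) * (s * s) = (s' * s') * (s' * s') -> s * s = s' * s'.
Proof.
move=> ss ss' c h; set t := s * s in h *; set t' := s' * s' in h *.
have cst : GRing.comm s t by exact: commrM.
have cs't' : GRing.comm s' t' by exact: commrM.
have cst' : GRing.comm s t' by exact: commrM.
have cs't : GRing.comm s' t by apply: commrM; exact/commr_sym.
have ctt' : GRing.comm t t' by apply: commr_sym; apply: commrM; exact/commr_sym.
pose d := t - t'.
have sd : usa d by apply: usaB; exact: usaMM.
have csd : GRing.comm d s by apply: commr_sym; exact: commrB.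
have cs'd : GRing.comm d s' by apply: commr_sym; exact: commrB.
have sds : usa (d * s) by exact: usaM.
have sds' : usa (d * s') by exact: usaM.
have cc : GRing.comm (d * s) (d * s').
  by apply: commrM; apply: commr_sym; apply: commrM => //; apply/commr_sym.
have sq z : GRing.comm d z -> (d * z) * (d * z) = d * d * (z * z).
  by move=> dz; rewrite !mulrA -(mulrA d z d) -dz !mulrA.
have e0 : (d * s) * (d * s) + (d * s') * (d * s') = 0.
  rewrite !sq // -mulrDr -/t -/t' -mulrA.
  suff -> : d * (t + t') = 0 by rewrite mulr0.
  by rewrite /d mulrBl !mulrDr h ctt' [X in X - _]addrC subrr.
have ds : d * s = 0 := two_squares_eq0 sds sds' cc e0.
have ds' : d * s' = 0.
  by apply: (two_squares_eq0 sds' sds (commr_sym cc)); rewrite addrC.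
apply/subr0_eq/un_eq0_sqr => //.
by rewrite -/d {2}/d mulrBr !mulrA ds ds' !mul0r subrr.
Qed.

End SquareRoot.

Global Opaque sq1.

(** * Homomorphisms and positive elements *)
Section Homomorphisms.
Variables (R : realType) (A B : cstarAlg R) (f : A -> B).
Hypothesis hf : is_starhom f.
Implicit Types x y : unitz A.

Lemma shom_lin (c : R[i]) (a b : A) : f (c *: a + b) = c *: f a + f b.
Proof. by case: hf => h _ _; exact: h. Qed.
Lemma shomD (a b : A) : f (a + b) = f a + f b.
Proof. by rewrite -[a]scale1r shom_lin !scale1r. Qed.
Lemma shom0 : f 0 = 0.
Proof. by apply: (addrI (f 0)); rewrite -shomD !addr0. Qed.
Lemma shomZ (c : R[i]) (a : A) : f (c *: a) = c *: f a.
Proof. by rewrite -[c *: a]addr0 shom_lin shom0 addr0. Qed.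
Lemma shomN (a : A) : f (- a) = - f a.
Proof. by rewrite -scaleN1r shomZ scaleN1r. Qed.
Lemma shomB (a b : A) : f (a - b) = f a - f b.
Proof. by rewrite shomD shomN. Qed.
Lemma shomM (a b : A) : f (a ** b) = f a ** f b.
Proof. by case: hf => _ h _; exact: h. Qed.
Lemma shomS (a : A) : f (astar a) = astar (f a).
Proof. by case: hf => _ _ h; exact: h. Qed.

Definition umap x : unitz B := (x.1, f x.2).

Lemma umapD x y : umap (x + y) = umap x + umap y.
Proof. by apply: unitzP => //=; rewrite shomD. Qed.
Lemma umapZ (c : R[i]) x : umap (c *: x) = c *: umap x.
Proof. by apply: unitzP => //=; rewrite shomZ. Qed.
Lemma umapN x : umap (- x) = - umap x.
Proof. by apply: unitzP => //=; rewrite shomN. Qed.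
Lemma umapB x y : umap (x - y) = umap x - umap y.
Proof. by rewrite umapD umapN. Qed.
Lemma umapM x y : umap (x * y) = umap x * umap y.
Proof. by apply: unitzP => //=; rewrite !shomD !shomZ shomM. Qed.
Lemma umap_star x : umap (ustar x) = ustar (umap x).
Proof. by apply: unitzP => //=; rewrite shomS. Qed.
Lemma umap1 : umap 1 = 1.
Proof. by apply: unitzP => //=; rewrite shom0. Qed.
Lemma umap0 : umap 0 = 0.
Proof. by apply: unitzP => //=; rewrite shom0. Qed.
Lemma umap_uin a : umap (uin a) = uin (f a).
Proof. by []. Qed.

Lemma umap_usa x : usa x -> usa (umap x).
Proof. by rewrite /usa -umap_star => ->. Qed.

Lemma umap_comm x y : GRing.comm x y -> GRing.comm (umap x) (umap y).
Proof. by rewrite /GRing.comm -!umapM => ->. Qed.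

(** Contractivity without spectra: the identity [x^2 + k^2 = 1], with [k] the root of [1 - x^2], is
    preserved by the homomorphism, and [un_two_squares] applies to the images. *)
Lemma un_umap_sa x : usa x -> un x <= 1 -> un (umap x) <= 1.
Proof.
move=> sx x1; have xx1 : un (x * x) <= 1 by rewrite un_sqr // expr_le1 // un_ge0.
have sg := usa_sq1 xx1 (usaMM sx).
have sk : usa (1 - sq1 (x * x)) by apply: usaB => //; exact: usa1.
have c : GRing.comm x (1 - sq1 (x * x)).
  apply: commrB; first exact: commr1.
  by apply: sq1_comm => //; exact: commrM.
have := un_two_squares (umap_usa sx) (umap_usa sk) (umap_comm c).
rewrite -!umapM -umapD sq1_sqr // addrC subrK umap1 un1.
by rewrite expr_le1 // un_ge0.
Qed.

Lemma un_umap x : un (umap x) <= un x.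
Proof.
have sac y : usa y -> un (umap y) <= un y.
  move=> sy; apply: ler_eps => e e0; pose r := un y + e.
  have r0 : 0 < r by have := un_ge0 y; rewrite /r; lra.
  have := @un_umap_sa ((r^-1)%:C *: y) (usaZ _ sy).
  rewrite umapZ !unZ cabs_real ger0_norm ?invr_ge0 ?(ltW r0) //.
  rewrite !ler_pdivrMl // !mulr1; apply; rewrite /r; lra.
have := sac (ustar x * x).
rewrite umapM umap_star !un_cstar /usa ustarM ustarK => /(_ erefl).
by rewrite ler_pXn2r ?nnegrE ?un_ge0.
Qed.

Lemma shom_nm (a : A) : nm (f a) <= nm a.
Proof. by rewrite -!un_uin -umap_uin un_umap. Qed.

Lemma umap_slim (u : nat -> unitz A) x : slim (@un R A) u x ->
  slim (@un R B) (fun n => umap (u n)) (umap x).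
Proof.
move=> hx e /hx[N h]; exists N => n /h; apply: le_lt_trans.
by rewrite -umapB un_umap.
Qed.

Lemma umap_sq1 x : un x <= 1 -> umap (sq1 x) = sq1 (umap x).
Proof.
move=> x1; have y1 := le_trans (un_umap x) x1.
apply: (ulim_uniq _ (sq1_lim y1)).
apply: (ulim_ext (umap_slim (sq1_lim x1))); elim => [|n IH] /=; first exact: umap0.
by rewrite umapZ umapD umapM IH.
Qed.

Lemma umap_absu x : usa x -> un x <= 1 -> umap (absu x) = absu (umap x).
Proof.
by move=> sx x1; rewrite /absu umapB umap1 umap_sq1; [rewrite umapB umap1 umapM|exact: un_1Bsqr].
Qed.

End Homomorphisms.

(** * Positivity by a norm criterion *)

Section Positivity.
Variables (R : realType) (A : cstarAlg R).
Local Notation U := (unitz A).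
Implicit Types (x y z b c : U).

(** This says that the spectrum of [c] lies in [[0, 2t]]. In this form sums are visibly positive,
    while roots and elements [b^* b] take work. *)
Definition upos c := usa c /\ exists2 t : R, 0 <= t & un (t%:C *: 1 - c) <= t.

Lemma cabs_pos (t : R) : 0 <= t -> cabs t%:C = t.
Proof. by move=> t0; rewrite cabs_real ger0_norm. Qed.

Lemma uposD c d : upos c -> upos d -> upos (c + d).
Proof.
move=> [sc [t t0 ht]] [sd [s s0 hs]]; split; first exact: usaD.
exists (t + s); first exact: addr_ge0.
rewrite rmorphD /= scalerDl opprD addrACA (le_trans (unD _ _)) //.
exact: lerD.
Qed.

Lemma uposZ (r : R) c : 0 <= r -> upos c -> upos (r%:C *: c).
Proof.
move=> r0 [sc [t t0 ht]]; split; first exact: usaZ.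
exists (r * t); first exact: mulr_ge0.
by rewrite rmorphM /= -scalerA -scalerBr unZ cabs_pos // ler_wpM2l.
Qed.

Lemma upos_sub (t : R) c : usa c -> 0 <= t -> un c <= t -> upos (t%:C *: 1 - c).
Proof.
move=> sc t0 ct; split; first by apply: usaB => //; apply: usaZ; exact: usa1.
by exists t => //; rewrite subKr.
Qed.

(** The criterion says that [x = 1 - c / t] is a contraction, so the root is [sqrt(t) (1 - sq1 x)].
    Replacing [t'] by [t' + 1] allows the division. *)
Lemma upos_root c : upos c -> exists s,
  [/\ usa s, s * s = c & forall z, GRing.comm z c -> GRing.comm z s].
Proof.
case=> sc [t' t'0 ht']; pose t := t' + 1; have t0 : 0 < t by rewrite /t; lra.
have ht : un (t%:C *: 1 - c) <= t.
  rewrite /t rmorphD /= scalerDl addrAC (le_trans (unD _ _)) //.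
  by rewrite unZ un1 mulr1 rmorph1 cabs1 lerD2r.
pose x := (t^-1)%:C *: (t%:C *: 1 - c).
have tK (d : R) : (t^-1)%:C * (t * d)%:C = d%:C.
  by rewrite -rmorphM /= mulKf // gt_eqF.
have ex : 1 - x = (t^-1)%:C *: c.
  rewrite /x scalerBr scalerA -rmorphM /= mulVf ?gt_eqF // rmorph1 scale1r.
  by rewrite subKr.
have x1 : un x <= 1.
  rewrite unZ cabs_pos ?invr_ge0 ?(ltW t0) // ler_pdivrMl // mulr1 //.
have sx : usa x by apply/usaZ/usaB => //; apply: usaZ; exact: usa1.
exists ((Num.sqrt t)%:C *: (1 - sq1 x)); split.
- by apply/usaZ/usaB; [exact: usa1|exact: usa_sq1].
- rewrite -scalerAl -scalerAr sq1_sqr // ex !scalerA -!rmorphM /=.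
  by rewrite -expr2 sqr_sqrtr ?ltW // mulfV ?gt_eqF // rmorph1 scale1r.
move=> z zc; apply/commrZ/commrB; first exact: commr1.
apply: sq1_comm => //; apply/commrZ/commrB => //.
by apply: commrZ; exact: commr1.
Qed.

(** After scaling to a contraction, [un_1Bsqr] is exactly the norm criterion. *)
Lemma upos_sqr y : usa y -> upos (y * y).
Proof.
move=> sy; split; first exact: usaMM.
pose r := un y + 1; have r0 : 0 < r by have := un_ge0 y; rewrite /r; lra.
exists (r * r); first by rewrite mulr_ge0 // ltW.
have y1 : un ((r^-1)%:C *: y) <= 1.
  by rewrite unZ cabs_pos ?invr_ge0 ?(ltW r0) // ler_pdivrMl // mulr1 /r; lra.
have := un_1Bsqr (usaZ _ sy) y1.
rewrite -scalerAl -scalerAr scalerA -rmorphM /= => H.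
have -> : (r * r)%:C *: 1 - y * y = (r * r)%:C *: (1 - (r^-1 * r^-1)%:C *: (y * y)).
  rewrite scalerBr scalerA -rmorphM /= -invfM mulfV ?mulf_neq0 ?gt_eqF //.
  by rewrite rmorph1 scale1r.
by rewrite unZ cabs_pos ?mulr_ge0 ?(ltW r0) // ler_piMr ?mulr_ge0 ?(ltW r0).
Qed.

(** Let [s^2 = c] and [r^2 = |c + d| - c], the latter being positive as the sum of
    [|c + d| - (c + d)] and [d]. Then [s^2 + r^2] is the scalar [|c + d|], and it dominates
    [|s|^2 = |c|]. *)
Lemma upos_le c d : upos c -> upos d -> un c <= un (c + d).
Proof.
move=> pc pd; have [s [ss es cs]] := upos_root pc.
have scd : usa (c + d) by case: (uposD pc pd).
have := uposD (upos_sub scd (un_ge0 _) (lexx _)) pd.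
rewrite opprD addrA subrK => /upos_root[r [sr er cr]].
have csc : GRing.comm s c by rewrite -es; exact: commrM.
have csr : GRing.comm s r.
  by apply: cr; apply: commrB => //; apply: commrZ; exact: commr1.
have := un_two_squares ss sr csr.
by rewrite es er [c + (_ - _)]addrC subrK unZ un1 mulr1 cabs_pos ?un_ge0 // -un_sqr // es.
Qed.

(* Kaplansky's theorem.  Let [m] be the negative part of [h = b^* b] and
   [y = b m].  Then [y^* y = - m^3 = - k^2], so [y y^*] is positive, and
   [(tau - y y^* ) y = y (tau + k^2)] with [tau = |y|^2] forces [k = 0]. *)
Lemma upos_star b : upos (ustar b * b).
Proof.
wlog h1 : b / un (ustar b * b) <= 1.
  move=> H; pose r := un b + 1; have r0 : 0 < r by have := un_ge0 b; rewrite /r; lra.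
  have := H ((r^-1)%:C *: b); rewrite ustarZ conjR -scalerAl -scalerAr scalerA.
  rewrite -rmorphM /= unZ cabs_pos ?mulr_ge0 ?invr_ge0 ?(ltW r0) //.
  rewrite un_cstar -invfM ler_pdivrMl ?mulr_gt0 // mulr1 => H1.
  have := uposZ (_ : 0 <= r * r) (H1 _); rewrite scalerA -rmorphM /=.
  rewrite mulfV ?mulf_neq0 ?gt_eqF // rmorph1 scale1r; apply.
    by rewrite mulr_ge0 // ltW.
  by rewrite expr2; apply: ler_pM; rewrite ?un_ge0 // /r; lra.
set h := ustar b * b in h1 *.
have sh : usa h by rewrite /usa /h ustarM ustarK.
pose t := absu h; pose s := sqabsu h.
have st : usa t by exact: usa_absu.
have ss : usa s by exact: usa_sqabsu.
have es : s * s = t by exact: sqabsu_sqr.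
have tt : t * t = h * h by exact: absu_sqr.
have hs : GRing.comm h s by exact: sqabsu_comm.
have ht : GRing.comm h t by exact: absu_comm.
clearbody t s.
have ts : GRing.comm t s.
  by rewrite -es; apply: commr_sym; exact: commrM.
(* This is twice the negative part of [h], which avoids halves. The identities used are
   [m h m = - m t m] and [(m s)^2 = m t m]. *)
have [m em] : exists m, m = t - h by exists (t - h).
have sm : usa m by rewrite em; exact: usaB.
have hm : GRing.comm h m by rewrite em; exact: commrB.
have sM : GRing.comm s m by rewrite em; apply: commrB; exact: commr_sym.
have mhm : m * h * m = - (m * t * m).
  apply/eqP; rewrite -addr_eq0 -mulrDl -mulrDr.
  by rewrite em mulrDr !mulrBl tt ht addrC subrKA subrr mul0r.
have [k ek] : exists k, k = m * s by exists (m * s).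
have sk : usa k by rewrite ek; apply: usaM => //; exact: commr_sym.
have kk : k * k = m * t * m.
  by rewrite ek -es [m * (s * s)]mulrA -(mulrA (m * s)) sM.
pose y := b * m.
have yy : ustar y * y = - (k * k).
  by rewrite /y ustarM sm mulrA -[m * _ * b]mulrA -/h mhm kk.
pose S := y * ustar y + ustar y * y.
(* If [y = y1 + i y2] with self-adjoint [y1], [y2], then [S + S] is the sum of the squares of [2 y1]
   and [2 y2]. *)
have pS : upos (S + S).
  pose x1 := y + ustar y; pose x2 := 'i%C *: (ustar y - y).
  have s1 : usa x1 by rewrite /usa ustarD ustarK addrC.
  have s2 : usa x2.
    by rewrite /usa ustarZ conj_i ustarB ustarK scaleNr -scalerN opprB.
  have -> : S + S = x1 * x1 + x2 * x2.
    have ii : 'i%C * 'i%C = -1 :> R[i] by rewrite -expr2 sqr_i.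
    rewrite /x1 /x2 -scalerAl -scalerAr scalerA ii scaleN1r /S.
    rewrite [in RHS]mulrDl mulrBl !mulrDr !mulrN.
    set a := y * y; set c := y * ustar y; set d := ustar y * y; set e := ustar y * ustar y.
    rewrite !opprB [RHS]addrACA (addrC c (- a)) (addrACA a) subrr add0r.
    by rewrite (addrACA d) subrr addr0 addrACA.
  by apply: uposD; exact: upos_sqr.
have pyy : upos (y * ustar y).
  have -> : y * ustar y = S + k * k by rewrite /S yy subrK.
  apply: uposD; last exact: upos_sqr.
  rewrite -[S]double_half -scalerDr; apply: uposZ pS.
  by rewrite invr_ge0.
have [tau etau] : exists tau, tau = un y ^+ 2 by exists (un y ^+ 2).
have tau0 : 0 <= tau by rewrite etau sqr_ge0.
have unk : un k ^+ 2 = tau by rewrite -un_sqr // etau -un_cstar yy unN.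
have unz : un (tau%:C *: 1 - y * ustar y) <= tau.
  have [sp _] := pyy.
  have ty : un (y * ustar y) <= tau.
    by rewrite -{1}[y]ustarK un_cstar un_star etau.
  apply: le_trans (upos_le (upos_sub sp tau0 ty) pyy) _.
  by rewrite subrK unZ un1 mulr1 cabs_pos.
pose w := y * (tau%:C *: 1 + k * k).
have ew : (tau%:C *: 1 - y * ustar y) * y = w.
  rewrite /w mulrBl mulrDr -scalerAl -scalerAr mul1r mulr1; congr (_ + _).
  by rewrite -mulrA yy mulrN opprK.
have unw : un w <= tau * un y.
  by rewrite -ew; apply: le_trans (unM _ _) _; rewrite ler_wpM2r ?un_ge0.
pose q := tau%:C *: k + k * k * k.
have skk : usa (k * k) by exact: usaMM.
have skkk : usa (k * k * k).
  by apply: usaM => //; apply: commr_sym; apply: commrM.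
have ww : ustar w * w = - (q * q).
  have eq1 : q = (tau%:C *: 1 + k * k) * k by rewrite /q mulrDl -scalerAl mul1r.
  have eq2 : q = k * (tau%:C *: 1 + k * k).
    by rewrite /q mulrDr -scalerAr mulr1 mulrA.
  rewrite /w ustarM ustarD ustarZ conjR ustar1 skk mulrA -(mulrA _ (ustar y)) yy.
  by rewrite mulrN mulNr {1}eq1 eq2 !mulrA.
have pkkkk : upos (k * k * (k * k)) by exact: upos_sqr.
have qq : q * q = (2 * tau)%:C *: (k * k * (k * k)) +
    ((tau%:C *: k) * (tau%:C *: k) + (k * k * k) * (k * k * k)).
  rewrite /q mulrDl !mulrDr -!scalerAl -!scalerAr !mulrA.
  set a := _ *: (_ *: _); set c := k * k * k * k * k * k; set d := _ *: _ : unitz A.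
  have -> : (2 * tau)%:C *: (k * k * k * k) = d + d.
    by rewrite mulr_natl mulr2n rmorphD /= scalerDl.
  by rewrite [RHS]addrACA [d + a]addrC.
(* The positive element [q * q] dominates [2 tau k^4], of norm [2 tau^3], while its own norm is
   [|w|^2], at most [tau^2 |y|^2 = tau^3]. *)
have t0 : tau = 0.
  have sqt : usa (tau%:C *: k) by exact: usaZ.
  have h5 : un ((2 * tau)%:C *: (k * k * (k * k))) <= un (q * q).
    rewrite qq; apply: upos_le.
      by apply: uposZ => //; rewrite mulr_ge0.
    by apply: uposD; apply: upos_sqr.
  have h6 : un (q * q) = un w ^+ 2 by rewrite -un_cstar ww unN.
  rewrite h6 unZ cabs_pos ?mulr_ge0 // !un_sqr // unk in h5.
  have h7 : un w ^+ 2 <= (tau * un y) ^+ 2.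
    by rewrite ler_pXn2r ?nnegrE ?mulr_ge0 ?un_ge0.
  rewrite exprMn -etau in h7.
  have : tau ^+ 3 <= 0 by rewrite !exprS expr0 in h5 h7 *; lra.
  by rewrite exprn_odd_le0 // => tau00; apply/eqP; rewrite eq_le tau00.
have k0 : k = 0.
  by apply: un_eq0; apply/eqP; rewrite -sqrf_eq0 unk t0.
have mt : m * t = 0 by rewrite -es mulrA -ek k0 mul0r.
have m3 : m * m * m = 0.
  by rewrite {2}em mulrBr mulrBl mhm mt mul0r oppr0 subrr.
have mm : m * m = 0.
  by apply: un_eq0_sqr; [exact: usaMM|rewrite mulrA m3 mul0r].
have -> : h = s * s by rewrite es; apply/esym/subr0_eq; rewrite -em; exact: un_eq0_sqr.
exact: upos_sqr.
Qed.

End Positivity.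

(** * Closed *-subalgebras and truncation *)
Section Subalgebras.
Variables (R : realType) (A : cstarAlg R) (S : set A).
Hypothesis hS : is_cstar_subalg S.

Let S0 : S 0. Proof. by case: hS => [[]]. Qed.
Let SL (c : R[i]) x y : S x -> S y -> S (c *: x + y).
Proof. by case: hS => [[_ h] _ _ _]; exact: h. Qed.
Let SM x y : S x -> S y -> S (x ** y).
Proof. by case: hS => [_ _ h _]; exact: h. Qed.
Let SS x : S x -> S (astar x).
Proof. by case: hS => [_ _ _ h]; exact: h. Qed.

Definition sub_prestar : prestar R.
Proof.
refine (@Prestar R A S (@nm R A) (@amul R A) (@astar R A) S0 SL SM SS
  _ _ _ _ _ _ _ _ _ _ _).
- by move=> x _; exact: nm_ge0.
- by move=> x y _ _; exact: nmD.
- by move=> c x _; exact: nmZ.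
- by move=> x y _ _; exact: nmM.
- by move=> x y z _ _ _; rewrite amulA subrr nm0.
- by move=> c x y z _ _ _; rewrite amul_linl subrr nm0.
- by move=> c x y z _ _ _; rewrite amul_linr subrr nm0.
- by move=> c x y _ _; rewrite astar_antilin subrr nm0.
- by move=> x _; rewrite astarK subrr nm0.
- by move=> x y _ _; rewrite astarM subrr nm0.
- by move=> x _; rewrite nm_cstar.
Defined.

(** With [S] realized as the range of an isometry, the calculus can be carried out in [C], and its
    results land in [S]. *)
Lemma csub_ex : exists (C : cstarAlg R) (i : C -> A),
  [/\ is_starhom i, forall x, nm (i x) = nm x & range i = S].
Proof.
pose C := hcAlg sub_prestar; pose j : A -> C := @hj R sub_prestar.
have onto (q : C) : exists2 x, S x & q = j x.
  apply: (@hj_onto R sub_prestar _ q) => u [Su cu].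
  have [x ux] := scauchy_slim cu; exists x => //.
  have [_ /closed_nmP cS _ _] := hS; apply: cS => e /ux[N /(_ N (leqnn _)) h].
  by exists (u N); [exact: Su|rewrite nmB].
have iP (q : C) : {x | S x & q = j x}.
  by apply: cid2; have [x Sx e] := onto q; exists x.
pose i q : A := s2val (iP q).
have iS q : S (i q) by exact: (s2valP (iP q)).
have ij q : j (i q) = q by rewrite -(s2valP' (iP q)).
have nj x : S x -> nm (j x) = nm x by move=> Sx; exact: (@nm_hj R sub_prestar).
have jL (c : R[i]) x y : S x -> S y -> j (c *: x + y) = c *: j x + j y.
  exact: (@hj_lin R sub_prestar).
have jM x y : S x -> S y -> j (x ** y) = j x ** j y.
  exact: (@hjM R sub_prestar).
have jS x : S x -> j (astar x) = astar (j x) by exact: (@hjS R sub_prestar).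
have jinj x y : S x -> S y -> j x = j y -> x = y.
  move=> Sx Sy e; apply/subr0_eq/nm_eq0.
  have SB : S (x - y) by rewrite addrC -scaleN1r; exact: SL.
  by rewrite -nj // addrC -scaleN1r jL // e scaleN1r addNr nm0.
have ji x : S x -> i (j x) = x.
  by move=> Sx; apply: jinj => //; rewrite ij.
exists C, i; split.
- split=> [c x y|x y|x].
  + by apply: jinj; [exact: iS|exact: SL|rewrite jL // !ij].
  + apply: jinj; [exact: iS|exact: SM|rewrite ij].
    by rewrite jM // !ij.
  + apply: jinj; [exact: iS|exact: SS|rewrite ij].
    by rewrite jS // !ij.
- by move=> q; rewrite -{2}(ij q) nj.
- apply/seteqP; split=> [_ [q _ <-] //|x Sx].
  by exists (j x); rewrite ?ji.
Qed.

(** Representations of an ideal are controlled only on the ideal, so contractivity is also needed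
    for maps multiplicative on a subalgebra only. *)
Definition is_starhom_on (B : cstarAlg R) (f : A -> B) : Prop :=
  [/\ forall (c : R[i]) x y, S x -> S y -> f (c *: x + y) = c *: f x + f y,
      forall x y, S x -> S y -> f (x ** y) = f x ** f y &
      forall x, S x -> f (astar x) = astar (f x)].

Lemma starhom_on_nm (B : cstarAlg R) (f : A -> B) x :
  is_starhom_on f -> S x -> nm (f x) <= nm x.
Proof.
move=> [fL fM fS] Sx; have [C [i [hi ni ri]]] := csub_ex.
have iS q : S (i q) by rewrite -ri; exists q.
have [q _ <-] : range i x by rewrite ri.
rewrite ni; apply: (@shom_nm _ _ _ (f \o i)); split=> [c a b|a b|a] /=.
- by rewrite (shom_lin hi) fL.
- by rewrite (shomM hi) fM.
- by rewrite (shomS hi) fS.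
Qed.

End Subalgebras.

(** * Functional calculus by square roots *)

Section Calculus.
Variables (R : realType).

Lemma usa_uin (A : cstarAlg R) (a : A) : astar a = a -> usa (uin a).
Proof. by rewrite /usa uin_star => ->. Qed.

(** The equation means [(1 - g)^2 = 1 - h]. It is stated for [g] because the root [1 - g] lives in
    the unitization, whereas [g] stays in [S]. *)
Lemma csquare_ex (A : cstarAlg R) (S : set A) (h : A) : is_cstar_subalg S ->
  S h -> astar h = h -> nm h <= 1 ->
  exists g, [/\ S g, astar g = g & g + g - g ** g = h].
Proof.
move=> hS Sh sh h1; have [C [i [hi ni ri]]] := csub_ex hS.
have [q _ qh] : range i h by rewrite ri.
have iinj : injective i.
  move=> a b e; apply/subr0_eq/nm_eq0.
  by rewrite -ni (shomB hi) e subrr nm0.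
have sq : astar q = q by apply: iinj; rewrite (shomS hi) qh.
have q1 : un (uin q) <= 1 by rewrite un_uin -ni qh.
have sg := usa_sq1 q1 (usa_uin sq); have eg := sq1_sqr q1.
set g := sq1 _ in sg eg.
(* The scalar part satisfies [(1 - g.1)^2 = 1], so it is 0 or 2, and [|g| <= 1] excludes 2. *)
have g1 : g.1 = 0.
  have /(congr1 fst) := eg; rewrite u1M !u1D !u1N u11 /= oppr0 addr0 => e.
  have : g.1 * (2 - g.1) = 0.
    have -> : g.1 * (2 - g.1) = 1 - (1 - g.1) * (1 - g.1) by ring.
    by rewrite e subrr.
  move/eqP; rewrite mulf_eq0 => /orP[/eqP //|/eqP /subr0_eq e2].
  have := le_trans (un_scal g) (un_sq1 q1).
  have E : 2 = (2 : R)%:C :> R[i] by rewrite rmorph_nat.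
  by rewrite -e2 E cabs_real normr_nat (ler_nat R 2 1).
rewrite (uinP g1) in sg eg; move: g.2 sg eg => a sa ea.
exists (i a); split; first by rewrite -ri; exists a.
  by rewrite -(shomS hi); congr (i _); apply: uin_inj; rewrite -uin_star.
rewrite -(shomD hi) -(shomM hi) -(shomB hi) -qh; congr (i _).
apply: uin_inj; rewrite uinB uinD -uinM.
rewrite -[RHS](subKr 1) -ea mulrBl mul1r mulrBr mulr1.
by rewrite -(addrA 1) -(opprD (uin a)) subKr addrA.
Qed.

(* The element [p] is the positive part of [h^2 - d^2]. *)
Lemma truncation (A : cstarAlg R) (h : A) (d : R) :
  astar h = h -> nm h <= 2^-1 -> 0 < d -> d <= 2^-1 ->
  let m p := uin p - uin (h ** h) + (d ^+ 2)%:C *: 1 in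
  exists p, [/\ astar p = p, un (m p) <= d ^+ 2,
    un (uin h * m p) ^+ 2 <= 2 * d ^+ 6 &
    forall (B : cstarAlg R) (f : A -> B), is_starhom f -> nm (f h) <= d -> f p = 0].
Proof.
move=> sh h1 d0 d1 /=; pose H := uin h; pose D : unitz A := (d ^+ 2)%:C *: 1.
have sH : usa H by exact: usa_uin.
have unH : un H = nm h by exact: un_uin.
have [k ek] : exists k, k = H * H - D by exists (H * H - D).
have sD : usa D by apply: usaZ; exact: usa1.
have sk : usa k by rewrite ek; apply: usaB => //; exact: usaMM.
have unD2 : un D = d ^+ 2 by rewrite unZ un1 mulr1 cabs_pos // sqr_ge0.
have k1 : un k <= 1.
  rewrite ek; apply: le_trans (unB _ _) _; rewrite un_sqr // unH unD2.
  by have := nm_ge0 h; rewrite !expr2; nra.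
have cD x : GRing.comm x D by apply: commrZ; exact: commr1.
have Hk : GRing.comm H k by rewrite ek; apply: commrB => //; exact: commrM.
(* If [|f h| <= d], then [d^2 - (f h)^2] is a square [y^2], so [- f k] is positive and equals its
   absolute value by uniqueness of positive roots. Hence [f] kills the positive part of [k]. *)
have kill (B : cstarAlg R) (f : A -> B) : is_starhom f -> nm (f h) <= d ->
    umap f (absu k) = - umap f k.
  move=> hf fh; rewrite umap_absu //.
  have fk1 := le_trans (un_umap hf k) k1.
  have sfk := umap_usa hf sk.
  pose x := umap f H; have sx : usa x by exact: umap_usa.
  pose w := (d^-1)%:C *: x; have sw : usa w by exact: usaZ.
  have w1 : un (w * w) <= 1.
    rewrite un_sqr // expr_le1 ?un_ge0 //.
    rewrite unZ cabs_pos ?invr_ge0 ?(ltW d0) // ler_pdivrMl // mulr1.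
    by rewrite /x umap_uin un_uin.
  have [y ey] : exists y, y = d%:C *: (1 - sq1 (w * w)) by eexists.
  have sy : usa y.
    by rewrite ey; apply/usaZ/usaB; [exact: usa1|apply: usa_sq1 => //; exact: usaMM].
  have fk : umap f k = - (y * y).
    rewrite ek umapB // umapM // umapZ // umap1 // -/x ey -scalerAl -scalerAr sq1_sqr //.
    rewrite /w -scalerAl -scalerAr !scalerA scalerBr scalerA -!rmorphM /= -expr2.
    have -> : d ^+ 2 * (d^-1 * d^-1) = 1 by rewrite -invfM -expr2 mulfV ?gt_eqF // exprn_gt0.
    by rewrite rmorph1 scale1r opprB.
  have cyf : GRing.comm y (umap f k) by rewrite fk; apply/commrN/commrM.
  have -> : - umap f k = y * y by rewrite fk opprK.
  have fk' := sqabsu_sqr sfk fk1; have fk2 := absu_sqr sfk fk1.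
  have sa := usa_sqabsu sfk fk1; have cs := sqabsu_comm sfk fk1 cyf.
  move: (absu _) (sqabsu _) fk' fk2 sa cs => t s fk' fk2 sa cs.
  rewrite -fk'; apply: (pos_root_uniq sa sy (commr_sym cs)).
  by rewrite fk' fk2 fk mulrNN.
have st : usa (absu k) by exact: usa_absu.
have ss : usa (sqabsu k) by exact: usa_sqabsu.
have es : sqabsu k * sqabsu k = absu k by exact: sqabsu_sqr.
have tt : absu k * absu k = k * k by exact: absu_sqr.
have ks : GRing.comm k (sqabsu k) by exact: sqabsu_comm.
have kt : GRing.comm k (absu k) by exact: absu_comm.
have Hs : GRing.comm H (sqabsu k) by exact: sqabsu_comm.
move: (absu k) (sqabsu k) kill st ss es tt ks kt Hs => t s kill st ss es tt ks kt Hs.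
have ts : GRing.comm t s by rewrite -es; apply: commr_sym; exact: commrM.
have Ht : GRing.comm H t by rewrite -es; exact: commrM.
have [p' ep'] : exists p', p' = (2^-1)%:C *: (t + k) by eexists.
have [m em] : exists m, m = (2^-1)%:C *: (t - k) by eexists.
have pm : p' - k = m.
  by rewrite em ep' -{2}[k]double_half scalerBr scalerDr opprD addrA addrK.
have mp : m * p' = 0.
  rewrite em ep' -scalerAl -scalerAr mulrBl !mulrDr tt kt.
  by rewrite [X in X - _]addrC subrr !scaler0.
have tpm : t = m + p'.
  by rewrite em ep' -scalerDr addrACA addNr addr0 scalerDr double_half.
have sm : usa m by rewrite em; apply/usaZ/usaB.
have sp' : usa p' by rewrite ep'; apply/usaZ/usaD.
have Hm : GRing.comm H m by rewrite em; apply/commrZ/commrB.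
have ms : GRing.comm m s.
  by apply/commr_sym; rewrite em; apply/commrZ/commrB; exact: commr_sym.
have mt : m * t = m * m by rewrite tpm mulrDr mp addr0.
have pp'm : p' * m = 0.
  by apply: (@can_inj _ _ (@ustar R A) (@ustar R A) (@ustarK R A)); rewrite ustarM sm sp' mp ustar0.
have [ep1 ep2] : p' = uin p'.2 /\ forall (B : cstarAlg R) (f : A -> B),
    is_starhom f -> nm (f h) <= d -> umap f p' = 0.
  have kp (B : cstarAlg R) (f : A -> B) : is_starhom f -> nm (f h) <= d -> umap f p' = 0.
    by move=> hf fh; rewrite ep' umapZ // umapD // kill // addNr scaler0.
  split=> //; apply: uinP.
  (* The zero map sends [h] to 0, hence kills [p'] in the unitization; since [umap] keeps scalar
     parts, [p'] lies in [A]. *)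
  have z0 : @is_starhom R A A (fun=> 0).
    split=> [c x y|x y|x]; first by rewrite scaler0 addr0.
      by rewrite amul0l.
    by rewrite astar0.
  by have := kp A _ z0; rewrite nm0 => /(_ (ltW d0)) /(congr1 fst).
exists p'.2.
have eM : uin p'.2 - uin (h ** h) + D = m.
  by rewrite -ep1 -uinM -/H -pm ek opprB addrA [RHS]addrAC.
rewrite eM.
(* Here [m] is the negative part of [k]. The squares [(m s)^2 = m^3] and [(H m)^2 = d^2 m^2 - m^3]
   sum to [d^2 m^2], so [|m^3| <= d^2 |m|^2]. Together with [|m|^4 <= |m^3| |m|] this gives
   [|m| <= d^2], and then the bound on [H m]. *)
have msms : (m * s) * (m * s) = m * m * m.
  by rewrite mulrA -(mulrA m s m) -ms !mulrA -mulrA es -mulrA mt mulrA.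
have HmHm : (H * m) * (H * m) = (d ^+ 2)%:C *: (m * m) - m * m * m.
  rewrite mulrA -(mulrA H m H) -Hm !mulrA.
  have -> : H * H = D + p' - m by rewrite -addrA -pm subKr ek addrC subrK.
  by rewrite mulrBl (mulrDl D) pp'm addr0 mulrBl /D -!scalerAl mul1r.
have n0 := un_ge0 m.
have sum : un (m * s) ^+ 2 <= d ^+ 2 * un m ^+ 2.
  have := @un_two_squares R A (m * s) (H * m) _ _ _.
  rewrite msms HmHm addrC subrK unZ cabs_pos ?sqr_ge0 // un_sqr //; apply.
  - exact: usaM.
  - exact: usaM.
  - apply: commr_sym; apply: commrM; apply: commr_sym; apply: commrM => //; exact: commr_sym.
have mmm : un (m * m * m) <= d ^+ 2 * un m ^+ 2.
  by apply: le_trans sum; rewrite -un_sqr; [rewrite msms|exact: usaM].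
have mle : un m <= d ^+ 2.
  have m4 : un m ^+ 4 <= un (m * m * m) * un m.
    have -> : un m ^+ 4 = un (m * m * (m * m)).
      by rewrite un_sqr ?un_sqr // -?exprM //; exact: usaMM.
    by rewrite mulrA unM.
  move: n0; rewrite le_eqVlt => /predU1P[<-|n0]; first exact: sqr_ge0.
  rewrite -(@ler_pM2r _ (un m ^+ 3)) ?exprn_gt0 // -exprS.
  by apply: le_trans m4 _; have := ler_wpM2r (ltW n0) mmm; rewrite !exprS expr0; lra.
split=> //.
- by apply: uin_inj; rewrite -uin_star -ep1.
- rewrite -un_sqr; last exact: usaM.
  rewrite HmHm; apply: le_trans (unB _ _) _.
  rewrite unZ cabs_pos ?sqr_ge0 // un_sqr //.
  have : un m ^+ 2 <= (d ^+ 2) ^+ 2 by rewrite ler_pXn2r ?nnegrE // sqr_ge0.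
  have := sqr_ge0 d => dd0 hh.
  have := ler_wpM2l dd0 hh; rewrite -!exprM -exprD => hd.
  by move: mmm hd; rewrite /=; lra.
- by move=> B f hf /(ep2 B f hf) /(congr1 snd).
Qed.

End Calculus.

Section CalculusInSubalgebras.
Variables (R : realType) (A : cstarAlg R) (S : set A).
Hypothesis hS : is_cstar_subalg S.

Lemma truncation_sub (h : A) (d : R) :
  S h -> astar h = h -> nm h <= 2^-1 -> 0 < d -> d <= 2^-1 ->
  let m p := uin p - uin (h ** h) + (d ^+ 2)%:C *: 1 in
  exists p, [/\ S p, astar p = p, un (m p) <= d ^+ 2,
    un (uin h * m p) ^+ 2 <= 2 * d ^+ 6 &
    forall (B : cstarAlg R) (f : A -> B), is_starhom f -> nm (f h) <= d -> f p = 0].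
Proof.
move=> Sh sh h1 d0 d1 /=; have [C [i [hi ni ri]]] := csub_ex hS.
have [q _ qh] : range i h by rewrite ri.
have iinj : injective i.
  move=> a b e; apply/subr0_eq/nm_eq0.
  by rewrite -ni (shomB hi) e subrr nm0.
have sq : astar q = q by apply: iinj; rewrite (shomS hi) qh.
have q1 : nm q <= 2^-1 by rewrite -ni qh.
have [p [sp mp hp fp]] := truncation sq q1 d0 d1.
have e : uin (i p) - uin (h ** h) + (d ^+ 2)%:C *: 1 =
    umap i (uin p - uin (q ** q) + (d ^+ 2)%:C *: 1).
  by rewrite umapD // umapB // umapZ // umap1 // !umap_uin (shomM hi) qh.
exists (i p); split.
- by rewrite -ri; exists p.
- by rewrite -(shomS hi) sp.
- by rewrite e; apply: le_trans (un_umap hi _) mp.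
- rewrite e -qh -umap_uin -umapM //; apply: le_trans hp.
  by rewrite ler_pXn2r ?nnegrE ?un_ge0 // un_umap.
- move=> B f hf fh; apply: (fp B (f \o i)); last by rewrite /= qh.
  split=> [c a b|a b|a] /=.
  + by rewrite (shom_lin hi) (shom_lin hf).
  + by rewrite (shomM hi) (shomM hf).
  + by rewrite (shomS hi) (shomS hf).
Qed.

Lemma sub_dom0 : S 0. Proof. by case: hS => [[]]. Qed.
Lemma sub_domL (c : R[i]) x y : S x -> S y -> S (c *: x + y).
Proof. by case: hS => [[_ h] _ _ _]; exact: h. Qed.
Lemma sub_domZ (c : R[i]) x : S x -> S (c *: x).
Proof. by move=> Sx; rewrite -[_ *: _]addr0; apply: sub_domL => //; exact: sub_dom0. Qed.
Lemma sub_domB x y : S x -> S y -> S (x - y).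
Proof. by move=> Sx Sy; rewrite addrC -scaleN1r; exact: sub_domL. Qed.
Lemma sub_domM x y : S x -> S y -> S (x ** y).
Proof. by case: hS => [_ _ h _]; exact: h. Qed.
(** In functional calculus [u] is the minimum of 1 and [h^2 / d^2] for a multiple [h] of [i]: the
    truncation [p] is the part of [h^2] above [d^2], and [u = (h^2 - p) / d^2]. *)
Lemma approx_unit (i : A) (e : R) : S i -> astar i = i -> 0 < e ->
  exists u, [/\ S u, astar u = u, un (1 - uin u) <= 1 &
    un (uin i * (1 - uin u)) <= e].
Proof.
move=> Si si e0; pose r := 2 * nm i + 1.
have i0 := nm_ge0 i.
have r0 : 0 < r by rewrite /r; lra.
pose h := (r^-1)%:C *: i.
have Sh : S h by exact: sub_domZ.
have sh : astar h = h by rewrite astarZ conjR si.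
have h1 : nm h <= 2^-1.
  rewrite nmZ cabs_pos ?invr_ge0 ?(ltW r0) // ler_pdivrMl // /r; lra.
(* The truncation gives [|h (1 - u)| <= 2 d], and [i = r h]. *)
pose d := Num.min 2^-1 (e / (2 * r)).
have d0 : 0 < d by rewrite lt_min invr_gt0 ltr0n divr_gt0 // mulr_gt0.
have d1 : d <= 2^-1 by rewrite ge_min lexx.
have d2 : d * (2 * r) <= e.
  by rewrite -ler_pdivlMr ?mulr_gt0 // ge_min lexx orbT.
have [p [Sp sp mp hp _]] := truncation_sub Sh sh h1 d0 d1.
set m := uin p - _ + _ in mp hp.
have dd0 : 0 < d ^+ 2 by rewrite exprn_gt0.
pose u := ((d ^+ 2)^-1)%:C *: (h ** h - p).
have eu : 1 - uin u = ((d ^+ 2)^-1)%:C *: m.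
  rewrite /u uinZ uinB /m [in RHS]scalerDr scalerA -rmorphM /= mulVf ?gt_eqF //.
  by rewrite rmorph1 scale1r addrC -scalerN opprB.
exists u; split.
- by apply/sub_domZ/sub_domB => //; exact: sub_domM.
- by rewrite /u astarZ conjR astarB astarM sh sp.
- by rewrite eu unZ cabs_pos ?invr_ge0 ?(ltW dd0) // ler_pdivrMl // mulr1.
- have ei : uin i = r%:C *: uin h.
    by rewrite /h uinZ scalerA -rmorphM /= mulfV ?gt_eqF // rmorph1 scale1r.
  rewrite eu ei -scalerAl -scalerAr !unZ !cabs_pos ?invr_ge0 ?(ltW dd0) ?(ltW r0) //.
  have hm : un (uin h * m) <= 2 * d ^+ 3.
    rewrite -(@ler_pXn2r _ 2) ?nnegrE ?un_ge0 ?mulr_ge0 ?exprn_ge0 ?(ltW d0) //.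
    apply: le_trans hp _; rewrite exprMn -exprM ler_wpM2r ?exprn_ge0 ?(ltW d0) //.
    by rewrite -natrX ler_nat.
  have h3 : (d ^+ 2)^-1 * un (uin h * m) <= 2 * d.
    rewrite ler_pdivrMl //; have -> // : d ^+ 2 * (2 * d) = 2 * d ^+ 3 by ring.
  have := ler_wpM2l (ltW r0) h3; lra.
Qed.

End CalculusInSubalgebras.

Section PositiveElements.
Variables (R : realType) (A : cstarAlg R).
Implicit Types a b c : A.

Definition cpos c := exists b, c = astar b ** b.

Lemma cpos_upos c : cpos c <-> upos (uin c).
Proof.
split=> [[b ->]|]; first by rewrite -uinM -uin_star; exact: upos_star.
move=> /upos_root[s [ss es _]].
have s1 : s.1 = 0.
  by have /(congr1 fst) := es; rewrite u1M /= => /eqP; rewrite mulf_eq0 orbb => /eqP.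
rewrite (uinP s1) in ss es; exists s.2; apply: uin_inj.
by rewrite -es -uinM -uin_star ss.
Qed.

Lemma cposD a b : cpos a -> cpos b -> cpos (a + b).
Proof. by move=> /cpos_upos pa /cpos_upos pb; apply/cpos_upos; rewrite uinD; exact: uposD. Qed.

Lemma cpos_le a b : cpos a -> cpos b -> nm a <= nm (a + b).
Proof. by move=> /cpos_upos pa /cpos_upos pb; rewrite -!un_uin uinD; exact: upos_le. Qed.

Lemma cpos0 : cpos 0.
Proof. by exists 0; rewrite amul0r. Qed.

Lemma cpos_sum (I : Type) (r : seq I) (F : I -> A) :
  (forall i, cpos (F i)) -> cpos (\sum_(i <- r) F i).
Proof. by move=> h; elim/big_ind: _ => //; [exact: cpos0|exact: cposD]. Qed.

End PositiveElements.

(** * Ideals and distances in a precategory *)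
Notation "x ;; y" := (hcomp x y) (at level 40, left associativity).

Lemma half_double (R : realType) (V : lmodType R[i]) (x : V) :
  (2^-1)%:C *: (x + x) = x.
Proof.
have e : 2^-1 + 2^-1 = 1 :> R by lra.
by rewrite scalerDr -scalerDl -rmorphD /= e scale1r.
Qed.

Section PrecatTheory.
Variables (R : realType) (T : rtCstarPrecat R).

Lemma hcompDl n m l (a b : T n m) (d : T m l) : (a + b) ;; d = a ;; d + b ;; d.
Proof. by rewrite -[a]scale1r hcomp_linl !scale1r. Qed.
Lemma hcompDr n m l (a : T n m) (b d : T m l) : a ;; (b + d) = a ;; b + a ;; d.
Proof. by rewrite -[b]scale1r hcomp_linr !scale1r. Qed.
Lemma hcomp0l n m l (d : T m l) : (0 : T n m) ;; d = 0.
Proof. by apply: (addrI (0 ;; d)); rewrite -hcompDl !addr0. Qed.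
Lemma hcomp0r n m l (a : T n m) : a ;; (0 : T m l) = 0.
Proof. by apply: (addrI (a ;; 0)); rewrite -hcompDr !addr0. Qed.
Lemma hcompZl n m l (c : R[i]) (a : T n m) (d : T m l) : (c *: a) ;; d = c *: (a ;; d).
Proof. by rewrite -[c *: a]addr0 hcomp_linl hcomp0l addr0. Qed.
Lemma hcompZr n m l (c : R[i]) (a : T n m) (d : T m l) : a ;; (c *: d) = c *: (a ;; d).
Proof. by rewrite -[c *: d]addr0 hcomp_linr hcomp0r addr0. Qed.
Lemma hcompNl n m l (a : T n m) (d : T m l) : (- a) ;; d = - (a ;; d).
Proof. by rewrite -scaleN1r hcompZl scaleN1r. Qed.
Lemma hcompNr n m l (a : T n m) (d : T m l) : a ;; (- d) = - (a ;; d).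
Proof. by rewrite -scaleN1r hcompZr scaleN1r. Qed.
Lemma hcompBl n m l (a b : T n m) (d : T m l) : (a - b) ;; d = a ;; d - b ;; d.
Proof. by rewrite hcompDl hcompNl. Qed.
Lemma hcompBr n m l (a : T n m) (b d : T m l) : a ;; (b - d) = a ;; b - a ;; d.
Proof. by rewrite hcompDr hcompNr. Qed.
Lemma hstarD n m (a b : T n m) : hstar (a + b) = hstar a + hstar b.
Proof. by rewrite -[a]scale1r hstar_antilin conjC1 !scale1r. Qed.
Lemma hstar0 n m : hstar (0 : T n m) = 0.
Proof. by apply: (addrI (hstar 0)); rewrite -hstarD !addr0. Qed.
Lemma hstarZ n m (c : R[i]) (a : T n m) : hstar (c *: a) = c^* *: hstar a.
Proof. by rewrite -[c *: a]addr0 hstar_antilin hstar0 addr0. Qed.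
Lemma hstarN n m (a : T n m) : hstar (- a) = - hstar a.
Proof. by rewrite -scaleN1r hstarZ rmorphN1 scaleN1r. Qed.
Lemma hstarB n m (a b : T n m) : hstar (a - b) = hstar a - hstar b.
Proof. by rewrite hstarD hstarN. Qed.
Lemma tensD n m (a b : T n m) : tens (a + b) = tens a + tens b.
Proof. by rewrite -[a]scale1r tens_lin !scale1r. Qed.
Lemma tens0 n m : tens (0 : T n m) = 0.
Proof. by apply: (addrI (tens 0)); rewrite -tensD !addr0. Qed.

Lemma tensB n m (a b : T n m) : tens (a - b) = tens a - tens b.
Proof. by rewrite addrC -scaleN1r tens_lin scaleN1r addrC. Qed.

Lemma hnmM n m l (a : T n m) (b : T m l) : nm (a ;; b) <= nm a * nm b.
Proof. by rewrite -lecR rmorphM /= -!nmE hnormM. Qed.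
Lemma hnm_cstar n m (a : T n m) : nm (hstar a ;; a) = nm a ^+ 2.
Proof. by apply: complexI; rewrite rmorphXn /= -!nmE hnorm_cstar. Qed.
Lemma hnm_star n m (a : T n m) : nm (hstar a) = nm a.
Proof.
have le p q (b : T p q) : nm b <= nm (hstar b).
  by apply: ler_sqrW; rewrite ?nm_ge0 // -expr2 -hnm_cstar hnmM.
by apply/eqP; rewrite eq_le le andbT -{2}[a]hstarK le.
Qed.

Definition endo m : cstarAlg R :=
  @CstarAlg R (T m m) (@hcomp R T m m m) (@hstar R T m m)
    (@hcompA R T m m m m) (@hcomp_linl R T m m m) (@hcomp_linr R T m m m)
    (@hnormM R T m m m) (@hstar_antilin R T m m) (@hstarK R T m m)
    (@hstarM R T m m m) (@hnorm_cstar R T m m).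

Lemma tens_endo m : @is_starhom R (endo m) (endo m.+1) (@tens R T m m).
Proof.
split=> [c a b|a b|a]; [exact: tens_lin|exact: tensM|exact: tens_star].
Qed.

(** On [endo m] the tensoring is a homomorphism of C*-algebras, hence contractive; the C*-identity
    passes this on to all [T n m]. *)
Lemma nm_tens n m (a : T n m) : nm (tens a) <= nm a.
Proof.
have := @shom_nm _ _ _ _ (tens_endo m) (hstar a ;; a).
by rewrite tensM tens_star !hnm_cstar ler_pXn2r ?nnegrE ?nm_ge0.
Qed.

Section TensIter.
Variable k : nat.

Lemma tens_iter_lin n m (c : R[i]) (a b : T n m) :
  tens_iter k (c *: a + b) = c *: tens_iter k a + tens_iter k b.
Proof. by elim: k => //= j ->; rewrite tens_lin. Qed.
Lemma tens_iterD n m (a b : T n m) :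
  tens_iter k (a + b) = tens_iter k a + tens_iter k b.
Proof. by elim: k => //= j ->; rewrite tensD. Qed.
Lemma tens_iterM n m l (a : T n m) (b : T m l) :
  tens_iter k (a ;; b) = tens_iter k a ;; tens_iter k b.
Proof. by elim: k => //= j ->; rewrite tensM. Qed.
Lemma tens_iter_star n m (a : T n m) :
  tens_iter k (hstar a) = hstar (tens_iter k a).
Proof. by elim: k => //= j ->; rewrite tens_star. Qed.
Lemma tens_iter0 n m : tens_iter k (0 : T n m) = 0.
Proof. by elim: k => //= j ->; rewrite tens0. Qed.
Lemma tens_iterZ n m (c : R[i]) (a : T n m) :
  tens_iter k (c *: a) = c *: tens_iter k a.
Proof. by rewrite -[c *: a]addr0 tens_iter_lin tens_iter0 addr0. Qed.
Lemma tens_iterN n m (a : T n m) : tens_iter k (- a) = - tens_iter k a.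
Proof. by rewrite -scaleN1r tens_iterZ scaleN1r. Qed.
Lemma tens_iterB n m (a b : T n m) :
  tens_iter k (a - b) = tens_iter k a - tens_iter k b.
Proof. by rewrite tens_iterD tens_iterN. Qed.
Lemma nm_tens_iter n m (a : T n m) : nm (tens_iter k a) <= nm a.
Proof. by elim: k => //= j h; exact: le_trans (nm_tens _) h. Qed.

End TensIter.

(* [a (1 - u)] is controlled by [(1 - u) a^* a (1 - u)]. *)
Lemma nm_sub_unit n m (a : T n m) (u : endo m) (i : endo m) : astar u = u ->
  un (1 - uin u) <= 1 ->
  nm (a - a ;; (u : T m m)) ^+ 2 <=
    nm (hstar a ;; a - (i : T m m)) + un (uin i * (1 - uin u)).
Proof.
move=> su u1; set z := 1 - uin u in u1 *.
have sz : ustar z = z by rewrite ustarB ustar1 uin_star su.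
rewrite -hnm_cstar -[X in X <= _](@un_uin R (endo m)).
have -> : uin (hstar (a - a ;; u) ;; (a - a ;; u) : endo m) =
    z * uin (hstar a ;; a : endo m) * z.
  rewrite /z mulrBl mul1r mulrBr mulr1 mulrBl !uinM -!uinB; congr uin => /=.
  have -> : hstar (a - a ;; u) = hstar a - (u : T m m) ;; hstar a.
    by rewrite hstarB hstarM; congr (_ - _ ;; _); exact: su.
  by rewrite hcompBr !hcompBl !hcompA.
clearbody z.
have -> : uin (hstar a ;; a : endo m) = uin (hstar a ;; a - i : endo m) + uin i.
  by rewrite -uinD subrK.
rewrite mulrDr mulrDl; apply: le_trans (unD _ _) _; apply: lerD.
  apply: le_trans (unM _ _) _; apply: le_trans (ler_piMr (un_ge0 _) u1) _.
  by apply: le_trans (unM _ _) _; rewrite (@un_uin R (endo m)) ler_piMl ?nm_ge0.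
rewrite -mulrA; apply: le_trans (unM _ _) _.
by rewrite ler_piMl ?un_ge0.
Qed.

Section IdealTheory.
Variable K : homfam T.
Arguments K : clear implicits.
Hypothesis idK : is_ideal K.

Lemma idl0 n m : K n m 0.
Proof. by case: idK => h _ _ _; case: (h n m). Qed.
Lemma idlL n m (c : R[i]) a b : K n m a -> K n m b -> K n m (c *: a + b).
Proof. by case: idK => h _ _ _; case: (h n m) => _; apply. Qed.
Lemma idlD n m a b : K n m a -> K n m b -> K n m (a + b).
Proof. by move=> Ka Kb; rewrite -[a]scale1r; exact: idlL. Qed.
Lemma idlZ n m (c : R[i]) a : K n m a -> K n m (c *: a).
Proof. by move=> Ka; rewrite -[_ *: _]addr0; apply: idlL => //; exact: idl0. Qed.
Lemma idlN n m a : K n m a -> K n m (- a).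
Proof. by move=> Ka; rewrite -scaleN1r; exact: idlZ. Qed.
Lemma idlB n m a b : K n m a -> K n m b -> K n m (a - b).
Proof. by move=> Ka Kb; apply: idlD => //; exact: idlN. Qed.
Lemma idl_left n m l (a : T n m) (b : T m l) : K m l b -> K n l (a ;; b).
Proof. by case: idK => _ _ h _; exact: h. Qed.
Lemma idl_right n m l (a : T n m) (b : T m l) : K n m a -> K n l (a ;; b).
Proof. by case: idK => _ _ _ h; exact: h. Qed.
Lemma idl_closed n m (x : T n m) :
  (forall e, 0 < e -> exists2 y, K n m y & nm (x - y) < e) -> K n m x.
Proof. by case: idK => _ h _ _; have /closed_nmP := h n m; apply. Qed.

Lemma idl_star n m (a : T n m) : K n m a -> K m n (hstar a).
Proof.
move=> Ka; pose S : set (endo n) := [set x | K n n x /\ K n n (hstar (x : T n n))].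
have hS : is_cstar_subalg S.
  split.
  - split; first by split; rewrite /= ?hstar0; exact: idl0.
    by move=> c x y [? ?] [? ?]; split; rewrite /= ?hstar_antilin; exact: idlL.
  - apply/closed_nmP => x h; split; apply: idl_closed => e /h[y [Sy Sy'] xy].
      by exists y.
    by exists (hstar (y : T n n)) => //; rewrite -hstarB hnm_star.
  - move=> x y [? ?] [? ?]; split; first exact: idl_left.
    by rewrite /= hstarM; exact: idl_left.
  - by move=> x [? ?]; split; rewrite //= hstarK.
have Sh : S (a ;; hstar a) by split; rewrite /= ?hstarM ?hstarK; exact: idl_right.
apply: idl_closed => e e0.
have sh : astar (a ;; hstar a : endo n) = a ;; hstar a by rewrite /= hstarM hstarK.
have e20 : 0 < e ^+ 2 / 2 by rewrite divr_gt0 // exprn_gt0.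
have [u [[Ku _] su u1 hu]] := approx_unit hS Sh sh e20.
exists (hstar a ;; (u : T n n)); first exact: idl_left.
rewrite -(@ltr_pXn2r _ 2) ?nnegrE ?nm_ge0 ?(ltW e0) //.
apply: le_lt_trans (nm_sub_unit (hstar a) (a ;; hstar a : endo n) su u1) _.
rewrite hstarK subrr nm0 add0r; apply: le_lt_trans hu _.
have : 0 < e ^+ 2 by rewrite exprn_gt0.
lra.
Qed.

Lemma idl_endo m : @is_cstar_subalg R (endo m) (K m m).
Proof.
split.
- by split; [exact: idl0|move=> *; exact: idlL].
- by case: idK => _ h _ _; exact: h.
- by move=> x y _; exact: idl_left.
- by move=> x; exact: idl_star.
Qed.

Lemma idl_unit n m (a : T n m) e : K n m a -> 0 < e ->
  exists u : T m m, [/\ K m m u, nm u <= 2 & nm (a - a ;; u) < e].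
Proof.
move=> Ka e0; pose h : endo m := hstar a ;; a.
have Kh : K m m h by exact: idl_left.
have sh : astar h = h by rewrite /h /= hstarM hstarK.
have e20 : 0 < e ^+ 2 / 2 by rewrite divr_gt0 // exprn_gt0.
have [u [Ku su u1 hu]] := approx_unit (idl_endo m) Kh sh e20.
exists u; split=> //.
  rewrite -(@un_uin R (endo m)) -[uin _](subKr 1).
  by apply: le_trans (unB _ _) _; rewrite un1; lra.
rewrite -(@ltr_pXn2r _ 2) ?nnegrE ?nm_ge0 ?(ltW e0) //.
apply: le_lt_trans (nm_sub_unit a h su u1) _.
rewrite subrr nm0 add0r; apply: le_lt_trans hu _.
have : 0 < e ^+ 2 by rewrite exprn_gt0.
lra.
Qed.

(** The quotient norm modulo [K], available on every [T n m] without forming a quotient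
    precategory. *)
Definition dst n m (a : T n m) : R := inf [set nm (a - b) | b in K n m].

Lemma dst_ge0 n m (a : T n m) : 0 <= dst a.
Proof.
apply: lb_le_inf; first by exists (nm (a - 0)), 0 => //; exact: idl0.
by move=> _ [b _ <-]; exact: nm_ge0.
Qed.

Lemma dst_le n m (a b : T n m) : K n m b -> dst a <= nm (a - b).
Proof.
move=> Kb; apply: ge_inf; last by exists b.
by exists 0 => _ [c _ <-]; exact: nm_ge0.
Qed.

Lemma dst_lt n m (a : T n m) r : dst a < r -> exists2 b, K n m b & nm (a - b) < r.
Proof.
move=> h; have ne : [set nm (a - b) | b in K n m] !=set0.
  by exists (nm (a - 0)), 0 => //; exact: idl0.
by have [_ [b Kb <-] hb] := inf_lt ne h; exists b.
Qed.

Lemma dst_le_nm n m (a : T n m) : dst a <= nm a.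
Proof. by rewrite -{2}[a]subr0 dst_le //; exact: idl0. Qed.

Lemma dst_approx n m (a : T n m) e : 0 < e ->
  exists2 b, K n m b & nm (a - b) < dst a + e.
Proof. by move=> e0; apply: dst_lt; lra. Qed.

Lemma dst0P n m (a : T n m) : dst a = 0 <-> K n m a.
Proof.
split=> [h|Ka]; last first.
  by apply/eqP; rewrite eq_le dst_ge0 andbT -[leRHS](@nm0 R (T n m)) -(subrr a) dst_le.
by apply: idl_closed => e e0; apply: dst_lt; rewrite h.
Qed.

Lemma dstD n m (a b : T n m) : dst (a + b) <= dst a + dst b.
Proof.
apply: ler_eps => e e0; have e20 : 0 < e / 2 by rewrite divr_gt0.
have [x Kx hx] := dst_approx a e20; have [y Ky hy] := dst_approx b e20.
apply: le_trans (dst_le _ (idlD Kx Ky)) _.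
by rewrite opprD addrACA; apply: le_trans (nmD _ _) _; lra.
Qed.

Lemma dstZ_le n m (c : R[i]) (a : T n m) : dst (c *: a) <= cabs c * dst a.
Proof.
apply: ler_eps => e e0; have c0 := cabs_ge0 c.
have e20 : 0 < e / (cabs c + 1) by rewrite divr_gt0 //; lra.
have [x Kx hx] := dst_approx a e20.
apply: le_trans (dst_le _ (idlZ c Kx)) _.
rewrite -scalerBr nmZ; apply: le_trans (ler_wpM2l c0 (ltW hx)) _.
rewrite mulrDr lerD2l mulrA ler_pdivrMr; nra.
Qed.

Lemma dstZ n m (c : R[i]) (a : T n m) : dst (c *: a) = cabs c * dst a.
Proof.
apply/eqP; rewrite eq_le dstZ_le /=.
have [->|c0] := eqVneq c 0; first by rewrite cabs0 mul0r dst_ge0.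
have := dstZ_le c^-1 (c *: a); rewrite scalerA mulVf // scale1r => h.
apply: le_trans (ler_wpM2l (cabs_ge0 c) h) _.
by rewrite mulrA -cabsM mulfV // cabs1 mul1r.
Qed.

Lemma dst_star n m (a : T n m) : dst (hstar a) = dst a.
Proof.
have le p q (b : T p q) : dst (hstar b) <= dst b.
  apply: ler_eps => e e0; have [x Kx hx] := dst_approx b e0.
  by apply: le_trans (dst_le _ (idl_star Kx)) _; rewrite -hstarB hnm_star ltW.
by apply/eqP; rewrite eq_le le -{1}[a]hstarK le.
Qed.

Lemma dst_comp n m l (a : T n m) (b : T m l) : dst (a ;; b) <= dst a * dst b.
Proof.
apply: ler_eps => e e0; have a0 := dst_ge0 a; have b0 := dst_ge0 b.
pose d := Num.min 1 (e / (dst a + dst b + 1)).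
have d0 : 0 < d by rewrite lt_min ltr01 divr_gt0 //; lra.
have d1 : d <= 1 by rewrite ge_min lexx.
have d2 : d * (dst a + dst b + 1) <= e.
  by rewrite -ler_pdivlMr; [rewrite ge_min lexx orbT|lra].
have [x Kx hx] := dst_approx a d0; have [y Ky hy] := dst_approx b d0.
have Kz : K n l (a ;; y + x ;; (b - y)).
  by apply: idlD; [exact: idl_left|exact: idl_right].
apply: le_trans (dst_le _ Kz) _.
have -> : a ;; b - (a ;; y + x ;; (b - y)) = (a - x) ;; (b - y).
  by rewrite hcompBl (hcompBr a) opprD addrA.
apply: le_trans (hnmM _ _) _.
apply: le_trans (ler_pM (nm_ge0 _) (nm_ge0 _) (ltW hx) (ltW hy)) _.
have : d * d <= d by rewrite -[leRHS]mulr1 ler_wpM2l // ltW.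
clearbody d; nra.
Qed.

(** For the lower bound on [dst (a^* a)], a self-adjoint [j] of [K] nearly closest to [a^* a] and an
    approximate unit [u] for [j] yield [a u] in [K] with [|a - a u|^2] at most [|a^* a - j|] plus a
    small error. *)
Lemma dst_cstar n m (a : T n m) : dst (hstar a ;; a) = dst a ^+ 2.
Proof.
apply/eqP; rewrite eq_le; apply/andP; split.
  by apply: le_trans (dst_comp _ _) _; rewrite dst_star expr2.
apply: ler_eps => e e0; have e20 : 0 < e / 2 by rewrite divr_gt0.
have [i Ki hi] := dst_approx (hstar a ;; a) e20.
have saa : hstar (hstar a ;; a) = hstar a ;; a by rewrite hstarM hstarK.
pose j : endo m := (2^-1)%:C *: (i + hstar i).
have Kj : K m m j by apply/idlZ/idlD => //; exact: idl_star.
have sj : astar j = j by rewrite /j /= hstarZ conjR hstarD hstarK addrC.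
have hj : nm (hstar a ;; a - (j : T m m)) < dst (hstar a ;; a) + e / 2.
  have -> : hstar a ;; a - (j : T m m) =
      (2^-1)%:C *: ((hstar a ;; a - i) + hstar (hstar a ;; a - i)).
    rewrite hstarB saa addrACA -opprD scalerBr; congr (_ - _).
    by rewrite half_double.
  rewrite nmZ cabs_half; apply: le_lt_trans (ler_wpM2l _ (nmD _ _)) _ => //.
  by rewrite hnm_star; lra.
have [u [Ku su u1 hu]] := approx_unit (idl_endo m) Kj sj e20.
have Kau : K n m (a ;; u) by exact: idl_left.
have := dst_le a Kau.
have := nm_sub_unit a j su u1.
have := dst_ge0 a; have := nm_ge0 (a - a ;; u) => ? ? ? ?.
have : dst a ^+ 2 <= nm (a - a ;; u) ^+ 2 by rewrite ler_pXn2r ?nnegrE.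
lra.
Qed.

End IdealTheory.

End PrecatTheory.

Arguments dst {R T} K {n m} a.

(** * Sums of ideals and saturation *)
Section Casts.
Variables (R : realType) (T : rtCstarPrecat R).

(** Indices such as [(k + n).+1] and [k + n.+1] are equal but not convertible, so hom spaces have to
    be transported. *)
Definition hcast n m n' m' (e1 : n = n') (e2 : m = m') (a : T n m) : T n' m' :=
  match e1 in _ = x, e2 in _ = y return T x y with erefl, erefl => a end.

Lemma hcast_id n m (e1 : n = n) (e2 : m = m) (a : T n m) : hcast e1 e2 a = a.
Proof. by rewrite (eq_irrelevance e1 erefl) (eq_irrelevance e2 erefl). Qed.

(** Anything defined for all indices ignores transports. It is used with an ideal or a
    representation as [rho], which removes most casts at once. *)
Lemma hcast_fun (Z : Type) (rho : forall n m, T n m -> Z) n m n' m'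
  (e1 : n = n') (e2 : m = m') (a : T n m) : rho _ _ (hcast e1 e2 a) = rho _ _ a.
Proof. by case: _ / e1; case: _ / e2. Qed.

Lemma tens_hcast n m n' m' (e1 : n = n') (e2 : m = m') (e3 : n.+1 = n'.+1)
  (e4 : m.+1 = m'.+1) (a : T n m) : tens (hcast e1 e2 a) = hcast e3 e4 (tens a).
Proof. by case: _ / e1 e3 => e3; case: _ / e2 e4 => e4; rewrite !hcast_id. Qed.

Lemma tens_iter_tens k n m (a : T n m) (e1 : (k + n).+1 = (k + n.+1)%N)
  (e2 : (k + m).+1 = (k + m.+1)%N) :
  tens_iter k (tens a) = hcast e1 e2 (tens (tens_iter k a)).
Proof.
elim: k e1 e2 => [|k IH] e1 e2 /=; first by rewrite hcast_id.
by rewrite (IH (esym (addnS _ _)) (esym (addnS _ _))) (tens_hcast _ _ e1 e2).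
Qed.

Lemma tens_iter_iter j k n m (a : T n m) (e1 : (j + k + n)%N = (j + (k + n))%N)
  (e2 : (j + k + m)%N = (j + (k + m))%N) :
  tens_iter j (tens_iter k a) = hcast e1 e2 (tens_iter (j + k) a).
Proof.
elim: j e1 e2 => [|j IH] e1 e2 /=; first by rewrite hcast_id.
by rewrite (IH (esym (addnA _ _ _)) (esym (addnA _ _ _))) (tens_hcast _ _ e1 e2).
Qed.

Lemma fun_tens_iter_tens (Z : Type) (rho : forall n m, T n m -> Z) k n m (a : T n m) :
  rho _ _ (tens_iter k (tens a)) = rho _ _ (tens_iter k.+1 a).
Proof. by rewrite (tens_iter_tens a (esym (addnS _ _)) (esym (addnS _ _))) hcast_fun. Qed.

End Casts.

(** * Quotients of the diagonal algebras *)

Section Quotients.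
Variables (R : realType) (T : rtCstarPrecat R) (N : homfam T).
Arguments N : clear implicits.
Hypothesis idN : is_ideal N.

Lemma dst0 n m : dst N (0 : T n m) = 0.
Proof. by apply/(dst0P idN); exact: idl0. Qed.

Definition quot_prestar (r : nat) : prestar R.
Proof.
refine (@Prestar R (T r r) setT (@dst R T N r r) (@hcomp R T r r r)
  (@hstar R T r r) _ _ _ _ _ _ _ _ _ _ _ _ _ _ _) => //.
- by move=> x _; exact: dst_ge0.
- by move=> x y _ _; exact: dstD.
- by move=> c x _; exact: dstZ.
- by move=> x y _ _; exact: dst_comp.
- by move=> x y z _ _ _; rewrite hcompA subrr dst0.
- by move=> c x y z _ _ _; rewrite hcomp_linl subrr dst0.
- by move=> c x y z _ _ _; rewrite hcomp_linr subrr dst0.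
- by move=> c x y _ _; rewrite hstar_antilin subrr dst0.
- by move=> x _; rewrite hstarK subrr dst0.
- by move=> x y _ _; rewrite hstarM subrr dst0.
- by move=> x _; exact: dst_cstar.
Defined.

Definition quot (r : nat) : cstarAlg R := hcAlg (quot_prestar r).
Definition qmap (r : nat) (a : endo T r) : quot r := @hj R (quot_prestar r) a.

Lemma qmap_starhom r : is_starhom (@qmap r).
Proof.
split=> [c x y|x y|x]; [exact: (@hj_lin R (quot_prestar r))
  |exact: (@hjM R (quot_prestar r))|exact: (@hjS R (quot_prestar r))].
Qed.

Lemma nm_qmap r (a : endo T r) : nm (qmap a) = dst N (a : T r r).
Proof. exact: (@nm_hj R (quot_prestar r)). Qed.

End Quotients.

Section IdealConstructions.
Variables (R : realType) (T : rtCstarPrecat R).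
Implicit Types (K J N I C : homfam T).

Definition iter_preim k N : homfam T :=
  fun n m => [set a | N (k + n)%N (k + m)%N (tens_iter k a)].

Definition chain I k : homfam T :=
  fun n m => [set a | forall i, (i < k)%N -> I (i + n)%N (i + m)%N (tens_iter i a)].

Lemma ideal_iter_preim k N : is_ideal N -> is_ideal (iter_preim k N).
Proof.
move=> idN; split.
- move=> n m; split; first by rewrite /iter_preim /= tens_iter0; exact: idl0.
  by move=> c a b ha hb; rewrite /iter_preim /= tens_iter_lin; exact: idlL.
- move=> n m; apply/closed_nmP => x h; apply: (idl_closed idN) => e /h[y Ny xy].
  exists (tens_iter k y) => //; apply: le_lt_trans xy.
  by rewrite -tens_iterB nm_tens_iter.
- by move=> n m l a b hb; rewrite /iter_preim /= tens_iterM; exact: idl_left.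
- by move=> n m l a b hb; rewrite /iter_preim /= tens_iterM; exact: idl_right.
Qed.

Lemma ideal_cap K N : is_ideal K -> is_ideal N -> is_ideal (fam_cap K N).
Proof.
move=> idK idN; split.
- move=> n m; split; first by split; exact: idl0.
  by move=> c a b [? ?] [? ?]; split; exact: idlL.
- by move=> n m; apply: closedI; [case: idK|case: idN] => _ + _ _; exact.
- by move=> n m l a b [? ?]; split; exact: idl_left.
- by move=> n m l a b [? ?]; split; exact: idl_right.
Qed.

Lemma ideal_chain I k : is_ideal I -> is_ideal (chain I k).
Proof.
move=> idI; have idP i := ideal_iter_preim i idI; split.
- move=> n m; split; first by move=> i _; exact: (idl0 (idP i)).
  by move=> c a b ha hb i ik; apply: (idlL (idP i)); [exact: ha|exact: hb].
- move=> n m; apply/closed_nmP => x h i ik.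
  by apply: (idl_closed (idP i)) => e /h[y /(_ i ik) Ny xy]; exists y.
- by move=> n m l a b hb i ik; apply: (idl_left (idP i)); exact: hb.
- by move=> n m l a b hb i ik; apply: (idl_right (idP i)); exact: hb.
Qed.

(* Writing [f] for the class of the [k]-fold tensoring modulo [N], the part of
   [(a^* a)^2] above the square of [d] is annihilated by [f]. *)
Lemma chain_dst C N k n m (a : T n m) (d : R) : is_ideal C -> is_ideal N ->
  C n m a -> nm a <= 2^-1 -> 0 < d -> d <= 2^-1 -> dst N (tens_iter k a) <= d ->
  dst (fam_cap C (iter_preim k N)) a ^+ 4 <= 2 * d ^+ 2.
Proof.
move=> idC idN Ca a1 d0 d1 ad; pose h : endo T m := hstar a ;; a.
have Ch : C m m h by exact: idl_left.
have sh : astar h = h by rewrite /h /= hstarM hstarK.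
have nh : nm h = nm a ^+ 2 by exact: hnm_cstar.
have h1 : nm h <= 2^-1.
  by rewrite nh; have := nm_ge0 a; rewrite expr2; nra.
have [p [Cp sp mp _ fp]] := truncation_sub (idl_endo idC m) Ch sh h1 d0 d1.
set L := fam_cap _ _; have idL : is_ideal L.
  by apply: ideal_cap => //; exact: ideal_iter_preim.
have Lp : L m m p.
  split=> //; apply/(dst0P idN).
  pose f (x : endo T m) : quot idN (k + m) := qmap idN (tens_iter k (x : T m m) : endo T (k + m)).
  have hq := qmap_starhom idN (k + m).
  have hf : is_starhom f.
    split=> [c x y|x y|x]; rewrite /f /=.
    - by rewrite tens_iter_lin (shom_lin hq).
    - by rewrite tens_iterM (shomM hq).
    - by rewrite tens_iter_star (shomS hq).
  have := fp _ f hf; rewrite {1}/f nm_qmap /h /= tens_iterM tens_iter_star dst_cstar //.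
  have dk := dst_ge0 idN (tens_iter k a).
  move=> /(_ _) e; have : f p = 0 by apply: e; rewrite expr2; nra.
  by rewrite -[X in X = 0]/(qmap _ _) => e0; rewrite -nm_qmap e0 nm0.
(* The difference is [d^2] minus the negative part of [h^2 - d^2], both of norm at most [d^2]. It
   bounds the distance of [h^2] to [L], which is the fourth power of that of [a]. *)
have hp : nm ((h : T m m) ;; h - p) <= 2 * d ^+ 2.
  rewrite -(@un_uin R (endo T m)) uinB.
  set D := _ *: 1 in mp.
  have -> : uin ((h : T m m) ;; h : endo T m) - uin p =
     D - (uin p - uin (h ** h) + D).
    by rewrite opprD addrCA subrr addr0 opprB.
  apply: le_trans (unB _ _) _; rewrite {1}/D unZ un1 mulr1 cabs_pos ?sqr_ge0 //.
  lra.
apply: le_trans hp; apply: le_trans (dst_le _ Lp).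
have -> : (h : T m m) ;; h = hstar (h : T m m) ;; h by congr (_ ;; _); rewrite -[RHS]/(astar h) sh.
by rewrite dst_cstar // /h dst_cstar // -exprM.
Qed.

(* Approximating [j - n] by an approximate unit of [J] shows that [j] is as
   close to [J `&` N] as to [N], up to a constant. *)
Lemma fam_add_step J N n m (a j x j' x' : T n m) (e : R) :
  is_ideal J -> is_ideal N -> J n m j -> N n m x -> J n m j' -> N n m x' ->
  nm (a - (j + x)) < e -> nm (a - (j' + x')) < e ->
  exists j2 x2, [/\ J n m j2, N n m x2, j2 + x2 = j' + x' & nm (j2 - j) < 5 * e].
Proof.
move=> idJ idN Jj Nx Jj' Nx' h h'.
have e0 : 0 < e by exact: le_lt_trans (nm_ge0 _) h.
have JB : J n m (j' - j) by exact: idlB.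
have [u [Ju u2 hu]] := idl_unit idJ JB e0.
pose w := (x - x') ;; u.
have Jw : J n m w by exact: idl_left.
have Nw : N n m w by apply: idl_right => //; exact: idlB.
exists (j' - w), (x' + w); split.
- exact: idlB.
- exact: idlD.
- by rewrite addrACA addNr addr0.
(* The first summand has norm below [e]. The second is a difference of two errors, of norm at most
   [2 e], times [u], of norm at most 2. *)
have -> : j' - w - j = (j' - j - (j' - j) ;; u) + (j' - j - (x - x')) ;; u.
  by rewrite [in RHS](hcompBl (j' - j)) -/w subrKA addrAC.
apply: le_lt_trans (nmD _ _) _.
have h3 : nm (j' - j - (x - x')) <= 2 * e.
  have -> : j' - j - (x - x') = (a - (j + x)) - (a - (j' + x')).
    by rewrite (opprB a) [RHS]addrC subrKA [in RHS]opprD [RHS]addrACA (opprB x).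
  by apply: le_trans (nmD _ _) _; rewrite nmN; lra.
have h4 := hnmM (j' - j - (x - x')) u.
have := nm_ge0 (j' - j - (x - x')); have := nm_ge0 u; nra.
Qed.

(** The point is closedness. Decompositions of approximants of [a] need not converge, but
    [fam_add_step] shifts elements between the summands so that the [J]-components become Cauchy. *)
Lemma ideal_add J N : is_ideal J -> is_ideal N -> is_ideal (fam_add J N).
Proof.
move=> idJ idN.
have addL n m (c : R[i]) (a b : T n m) : fam_add J N n m a -> fam_add J N n m b ->
    fam_add J N n m (c *: a + b).
  move=> [j Jj [x Nx <-]] [j' Jj' [x' Nx' <-]].
  exists (c *: j + j'); first exact: idlL.
  exists (c *: x + x'); first exact: idlL.
  by rewrite scalerDr addrACA.
split.
- move=> n m; split; last by move=> *; exact: addL.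
  by exists 0; [exact: idl0|exists 0; [exact: idl0|rewrite addr0]].
- move=> n m; apply/closed_nmP => a ha.
  pose ep k : R := 2^-1 ^+ k; have ep0 k : 0 < ep k by rewrite exprn_gt0 // invr_gt0.
  pose X := (nat * (T n m * T n m))%type.
  (* A state is an index [k] with a decomposition approximating [a] to within [2^-k]; along [Q] the
     index grows by one and the [J]-component moves by less than [5 * 2^-k]. *)
  pose P (s : X) := [/\ J n m s.2.1, N n m s.2.2 &
    nm (a - (s.2.1 + s.2.2)) < ep s.1].
  pose Q (s t : {s | P s}) :=
    (sval t).1 = (sval s).1.+1 /\ nm ((sval t).2.1 - (sval s).2.1) < 5 * ep (sval s).1.
  have step (s : {s | P s}) : {t | Q s t}.
    case: s => -[k [j x]] Ps; apply: cid; have [/= Jj Nx hx] := Ps.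
    have [_ [j' Jj' [x' Nx' <-]] h'] := ha _ (ep0 k.+1).
    have h'' : nm (a - (j' + x')) < ep k.
      apply: lt_le_trans h' _; rewrite /ep exprS; have := ep0 k; rewrite /ep; lra.
    have [j2 [x2 [Jj2 Nx2 e2 d2]]] := fam_add_step idJ idN Jj Nx Jj' Nx' hx h''.
    have Pt : P (k.+1, (j2, x2)) by split=> //=; rewrite e2.
    by exists (exist _ _ Pt).
  have [_ [j0 Jj0 [x0 Nx0 <-]] h0] := ha _ (ep0 0%N).
  have P0 : P (0%N, (j0, x0)) by [].
  have [f [f0 fS]] := dependent_choice step (exist _ _ P0).
  pose j k := (sval (f k)).2.1; pose x k := (sval (f k)).2.2.
  have fk k : (sval (f k)).1 = k.
    by elim: k => [|k IH]; [rewrite f0|have [-> _] := fS k; rewrite IH].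
  have Jj k : J n m (j k) by case: (svalP (f k)).
  have Nx k : N n m (x k) by case: (svalP (f k)).
  have hjx k : nm (a - (j k + x k)) < ep k.
    by have [_ _] := svalP (f k); rewrite fk.
  have jS k : nm (j k.+1 - j k) < 5 * ep k.
    by have [_] := fS k; rewrite fk.
  (* Telescoping: [ep k - ep k.+1] is half of [ep k], so a move by [5 * ep k] is ten times that
     difference. *)
  have jD k i : nm (j (k + i)%N - j k) <= 10 * (ep k - ep (k + i)%N).
    elim: i => [|i IH]; first by rewrite addn0 !subrr nm0 mulr0.
    rewrite addnS; apply: le_trans (nmBD (j (k + i)%N) _ _) _.
    have := jS (k + i)%N; have -> : ep (k + i).+1 = 2^-1 * ep (k + i)%N by rewrite /ep exprS.
    by have := ep0 (k + i)%N; lra.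
  have epE (e : R) : 0 < e -> exists k0, forall k, (k0 <= k)%N -> ep k < e.
    move=> e0; exists (Num.truncn e^-1).+1 => k Kk.
    rewrite /ep exprVn -[e]invrK ltf_pV2 ?posrE ?invr_gt0 ?exprn_gt0 //.
    apply: lt_le_trans (truncnS_gt _) _; rewrite -natrX ler_nat.
    by apply: leq_trans Kk _; rewrite ltnW // ltn_expl.
  have [l jl] : exists l, slim (@nm R (T n m)) j l.
    apply: scauchy_slim => e e0; have e20 : 0 < e / 20 by rewrite divr_gt0.
    have [K h] := epE _ e20; exists K => p q Kp Kq.
    have d i : (K <= i)%N -> nm (j i - j K) < e / 2.
      move=> Ki; rewrite -(subnKC Ki); apply: le_lt_trans (jD _ _) _.
      by have := ep0 (K + (i - K))%N; have := h K (leqnn _); lra.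
    apply: le_lt_trans (nmBD (j K) _ _) _; rewrite (nmB (j K)).
    by have := d p Kp; have := d q Kq; lra.
  exists l.
    by apply: (idl_closed idJ) => e /jl[K /(_ K (leqnn _)) h]; exists (j K) => //; rewrite nmB.
  exists (a - l); last by rewrite addrC subrK.
  apply: (idl_closed idN) => e e0; have e20 : 0 < e / 2 by rewrite divr_gt0.
  have [K h] := epE _ e20; have [M k] := jl _ e20; pose i := maxn K M.
  exists (x i) => //.
  have -> : a - l - x i = (a - (j i + x i)) + (j i - l).
    by rewrite opprD (addrA a) [RHS]addrAC subrKA.
  apply: le_lt_trans (nmD _ _) _.
  have := h i (leq_maxl _ _); have := k i (leq_maxr _ _); have := hjx i; lra.
- move=> n m l a b [j Jj [x Nx <-]].
  exists (a ;; j); first exact: idl_left.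
  by exists (a ;; x); [exact: idl_left|rewrite hcompDr].
- move=> n m l a b [j Jj [x Nx <-]].
  exists (j ;; b); first exact: idl_right.
  by exists (x ;; b); [exact: idl_right|rewrite hcompDl].
Qed.

End IdealConstructions.

Arguments iter_preim {R T} k N n m _.
Arguments chain {R T} I k n m _.

(** * The steps of the saturation and their closure *)

Section Saturation.
Variables (R : realType) (T : rtCstarPrecat R).
Implicit Types (K J N I C : homfam T).

(** The steps of the saturation are treated algebraically; closedness is restored by a single
    closure of their union. *)
Definition pre_ideal K :=
  [/\ forall n m, is_subspace (K n m),
      forall n m l (a : T n m) (b : T m l), K m l b -> K n l (a ;; b) &
      forall n m l (a : T n m) (b : T m l), K n m a -> K n l (a ;; b)].

Lemma pre_ideal_closure K : pre_ideal K -> is_ideal (fun n m => closure (K n m)).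
Proof.
move=> [sK lK rK]; split.
- move=> n m; have [K0 KL] := sK n m; split; first exact: subset_closure.
  move=> c a b /closure_nmP ha /closure_nmP hb; apply/closure_nmP => e e0.
  have c0 := cabs_ge0 c.
  have e20 : 0 < e / 2 by rewrite divr_gt0.
  have e30 : 0 < e / 2 / (cabs c + 1) by rewrite !divr_gt0 //; lra.
  have [x Kx hx] := ha _ e30; have [y Ky hy] := hb _ e20.
  exists (c *: x + y); first exact: KL.
  rewrite opprD addrACA -scalerBr; apply: le_lt_trans (nmD _ _) _; rewrite nmZ.
  have : nm (a - x) * (cabs c + 1) < e / 2 by rewrite -ltr_pdivlMr //; lra.
  have := nm_ge0 (a - x); nra.
- by move=> n m; exact: closed_closure.
- move=> n m l a b /closure_nmP hb; apply/closure_nmP => e e0.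
  have a0 := nm_ge0 a.
  have e20 : 0 < e / (nm a + 1) by rewrite divr_gt0 //; lra.
  have [y Ky hy] := hb _ e20; exists (a ;; y); first exact: lK.
  rewrite -hcompBr; apply: le_lt_trans (hnmM _ _) _.
  have : nm (b - y) * (nm a + 1) < e by rewrite -ltr_pdivlMr //; lra.
  have := nm_ge0 (b - y); nra.
- move=> n m l a b /closure_nmP hb; apply/closure_nmP => e e0.
  have a0 := nm_ge0 b.
  have e20 : 0 < e / (nm b + 1) by rewrite divr_gt0 //; lra.
  have [y Ky hy] := hb _ e20; exists (y ;; b); first exact: rK.
  rewrite -hcompBl; apply: le_lt_trans (hnmM _ _) _.
  have : nm (a - y) * (nm b + 1) < e by rewrite -ltr_pdivlMr //; lra.
  have := nm_ge0 (a - y); nra.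
Qed.

Lemma sat_step_pre J N k : is_ideal J -> is_ideal N -> pre_ideal (sat_step J N k).
Proof.
move=> idJ idN; elim: k => [|k [sS lS rS]] /=.
  by case: idN => *; split.
split.
- move=> n m; have [S0 SL] := sS n m; split.
    exists 0; last by exists 0; rewrite ?addr0.
    by split; [exact: idl0|rewrite /tens_preim /= tens0; case: (sS n.+1 m.+1)].
  move=> c _ _ [j [Jj Sj] [s Ss <-]] [j' [Jj' Sj'] [s' Ss' <-]].
  exists (c *: j + j').
    split; first exact: idlL.
    by rewrite /tens_preim /= tens_lin; case: (sS n.+1 m.+1) => _; apply.
  by exists (c *: s + s'); [exact: SL|rewrite scalerDr addrACA].
- move=> n m l a _ [j [Jj Sj] [s Ss <-]]; exists (a ;; j).
    by split; [exact: idl_left|rewrite /tens_preim /= tensM; exact: lS].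
  by exists (a ;; s); [exact: lS|rewrite hcompDr].
- move=> n m l _ b [j [Jj Sj] [s Ss <-]]; exists (j ;; b).
    by split; [exact: idl_right|rewrite /tens_preim /= tensM; exact: rS].
  by exists (s ;; b); [exact: rS|rewrite hcompDl].
Qed.

Lemma sat_step_le J N i k n m (a : T n m) : is_ideal J -> is_ideal N ->
  (i <= k)%N -> sat_step J N i n m a -> sat_step J N k n m a.
Proof.
move=> idJ idN; elim: k => [|k IH]; first by rewrite leqn0 => /eqP ->.
rewrite leq_eqVlt => /predU1P[-> //|]; rewrite ltnS => /IH h /h Sa.
exists 0; last by exists a; rewrite ?add0r.
split; first exact: idl0.
have [sS _ _] := sat_step_pre k idJ idN.
by rewrite /tens_preim /= tens0; case: (sS n.+1 m.+1).
Qed.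

Lemma ideal_saturation J N : is_ideal J -> is_ideal N -> is_ideal (saturation J N).
Proof.
move=> idJ idN; apply: pre_ideal_closure; split.
- move=> n m; split.
    by exists 0%N => //; exact: idl0.
  move=> c a b [i _ Sa] [k _ Sb]; exists (maxn i k) => //.
  have [sS _ _] := sat_step_pre (maxn i k) idJ idN.
  by case: (sS n m) => _; apply; apply: sat_step_le; try eassumption;
    [exact: leq_maxl|exact: leq_maxr].
- move=> n m l a b [k _ Sb]; exists k => //.
  by have [_ lS _] := sat_step_pre k idJ idN; exact: lS.
- move=> n m l a b [k _ Sb]; exists k => //.
  by have [_ _ rS] := sat_step_pre k idJ idN; exact: rS.
Qed.

Lemma sub_saturation J N : fam_sub N (saturation J N).
Proof. by move=> n m a Na; apply: subset_closure; exists 0%N. Qed.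

(** The tensoring of the [J]-summand lies in the previous step by the definition of the step; the
    other summand is handled by induction. *)
Lemma invariant_saturation J N : is_ideal J -> is_ideal N -> is_invariant N ->
  is_invariant (saturation J N).
Proof.
move=> idJ idN invN n m a /closure_nmP ha; apply/closure_nmP => e /ha[y [k _ Sy] xy].
exists (tens y); last first.
  by apply: le_lt_trans xy; rewrite -tensB nm_tens.
exists k => //; elim: k n m y Sy {xy ha a} => [|k IH] n m y /=; first exact: invN.
move=> [j [Jj Sj] [s Ss <-]]; rewrite tensD.
have [sS _ _] := sat_step_pre k.+1 idJ idN.
have := sS n.+1 m.+1 => -[_ SL].
rewrite -[tens j]scale1r; apply: SL.
  by apply: (@sat_step_le _ _ k k.+1).
by apply: (@sat_step_le _ _ k k.+1) => //; exact: IH.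
Qed.

(** Since [J] and its tensoring lie in [K], a decomposition [j + s] of an element of [K] has both
    summands in [K]. *)
Lemma sat_step_cap J K N Nt k n m : is_ideal K -> fam_sub J (Jfam K) ->
  (forall n m, N n m = fam_cap Nt K n m) ->
  sat_step J N k n m = fam_cap (sat_step J Nt k) K n m.
Proof.
move=> idK JK NtK; elim: k n m => [|k IH] n m; first exact: NtK.
apply/seteqP; split=> a /=.
  move=> [j [Jj Sj] [s Ss <-]]; have [Kj Kj'] := JK _ _ _ Jj.
  move: Sj Ss; rewrite /tens_preim /= !IH => -[Sj _] [Ss Ks].
  split; last exact: idlD.
  by exists j => //; exists s.
move=> [[j [Jj Sj] [s Ss <-]] Kjs]; have [Kj Kj'] := JK _ _ _ Jj.
exists j; first by split=> //; rewrite /tens_preim /= IH; split.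
exists s => //; rewrite IH; split=> //.
by have := idlB idK Kjs Kj; rewrite addrAC subrr add0r.
Qed.

(** An approximate unit [u] of [K] for [a] moves an approximant [s] of [a] into [K] without leaving
    [S]. As [|u| <= 2], it is enough that [s] is within [e / 4]. *)
Lemma closure_capK K n m (S : set (T n m)) : is_ideal K ->
  (forall s u, S s -> S (s ;; u)) ->
  closure S `&` K n m `<=` closure (S `&` K n m).
Proof.
move=> idK rS a [/closure_nmP Sa Ka]; apply/closure_nmP => e e0.
have e20 : 0 < e / 2 by rewrite divr_gt0.
have e40 : 0 < e / 4 by rewrite divr_gt0.
have [u [Ku u2 hu]] := idl_unit idK Ka e20; have [s Ss hs] := Sa _ e40.
exists (s ;; u); first by split; [exact: rS|exact: idl_left].
apply: le_lt_trans (nmBD (a ;; u) _ _) _.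
rewrite -hcompBl; have := hnmM (a - s) u.
have := nm_ge0 u; have := nm_ge0 (a - s); nra.
Qed.

Lemma saturation_cap J K N Nt : is_ideal K -> is_ideal J -> is_ideal N -> is_ideal Nt ->
  fam_sub J (Jfam K) -> (forall n m, N n m = fam_cap Nt K n m) ->
  forall n m, saturation J N n m = fam_cap (saturation J Nt) K n m.
Proof.
move=> idK idJ idN idNt JK NtK n m.
have e : \bigcup_k sat_step J N k n m = (\bigcup_k sat_step J Nt k n m) `&` K n m.
  rewrite setI_bigcupl; apply: eq_bigcupr => k _.
  by rewrite (sat_step_cap _ _ _ idK JK NtK).
rewrite /saturation /fam_cap e; apply/seteqP; split.
  move=> a ha; split; first by apply: closure_subset ha => x [].
  have /closure_id -> : closed (K n m) by case: idK.
  by apply: closure_subset ha => x [].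
apply: closure_capK => // s u [k _ Sk]; exists k => //.
by have [_ _ rS] := sat_step_pre k idJ idNt; exact: rS.
Qed.

(** Induction on [k], applied to the tensoring of [a]. Writing [a = j + x], the element
    [tens j = tens a - tens x] is then in the [k]-th step, as [N] is invariant. *)
Lemma chain_sat_step J N k n m (a : T n m) : is_ideal J -> is_ideal N -> is_invariant N ->
  chain (fam_add J N) k n m a -> N (k + n)%N (k + m)%N (tens_iter k a) ->
  sat_step J N k n m a.
Proof.
move=> idJ idN invN; elim: k n m a => [//|k IH] n m a ha Na.
have Sa : sat_step J N k n.+1 m.+1 (tens a).
  apply: IH => [i ik|]; last by rewrite (fun_tens_iter_tens N).
  by rewrite (fun_tens_iter_tens (fam_add J N)); apply: ha.
have [j Jj [x Nx e]] : fam_add J N n m a by apply: (ha 0%N).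
exists j; last first.
  by exists x => //; apply: (@sat_step_le _ _ 0 k).
split=> //; rewrite /tens_preim /=.
have -> : tens j = (-1) *: tens x + tens a by rewrite -e tensD scaleN1r addrC addrK.
have [sS _ _] := sat_step_pre k idJ idN.
have [_ SL] := sS n.+1 m.+1; apply: SL => //.
by apply: (@sat_step_le _ _ 0 k) => //; exact: invN.
Qed.

(* If [a] is close to an element [y] of the chain whose [k]-th tensoring is in
   [N], then [y] is in the [k]-th step. *)
Lemma chain_saturation J N n m (a : T n m) : is_ideal J -> is_ideal N -> is_invariant N ->
  (forall k, fam_add J N (k + n)%N (k + m)%N (tens_iter k a)) ->
  (forall e, 0 < e -> exists k, dst N (tens_iter k a) < e) ->
  saturation J N n m a.
Proof.
move=> idJ idN invN hI hN; apply/closure_nmP => e e0.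
pose r := 2 * nm a + 1; have r0 : 0 < r by have := nm_ge0 a; rewrite /r; lra.
pose b := (r^-1)%:C *: a.
have nb : nm b <= 2^-1.
  by rewrite nmZ cabs_pos ?invr_ge0 ?(ltW r0) // ler_pdivrMl // /r; lra.
pose q := e / r; have q0 : 0 < q by rewrite divr_gt0.
(* By [chain_dst] the fourth power of the distance of [b] to [L] is at most [2 d^2], hence at most
   [q^4 / 2]. *)
pose d := Num.min 2^-1 (q ^+ 2 / 2).
have d0 : 0 < d by rewrite lt_min invr_gt0 ltr0n divr_gt0 // exprn_gt0.
have d1 : d <= 2^-1 by rewrite ge_min lexx.
have d2 : d <= q ^+ 2 / 2 by rewrite ge_min lexx orbT.
have [k hk] := hN (r * d) (mulr_gt0 r0 d0).
have bd : dst N (tens_iter k b) <= d.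
  rewrite tens_iterZ dstZ // cabs_pos ?invr_ge0 ?(ltW r0) // ler_pdivrMl //.
  exact: ltW.
have idI := ideal_add idJ idN.
have Cb : chain (fam_add J N) k n m b.
  by move=> i _; rewrite tens_iterZ; apply: (idlZ idI); exact: hI.
have := chain_dst (ideal_chain k idI) idN Cb nb d0 d1 bd.
set L := fam_cap _ _ => h4.
have idL : is_ideal L by apply: ideal_cap; [exact: ideal_chain|exact: ideal_iter_preim].
have hq : dst L b < q.
  rewrite -(@ltr_pXn2r _ 4) ?nnegrE ?dst_ge0 ?(ltW q0) //.
  apply: le_lt_trans h4 _.
  have q4 : q ^+ 4 = q ^+ 2 * q ^+ 2 by rewrite -exprD.
  have q2 : 0 < q ^+ 2 by rewrite exprn_gt0.
  by rewrite q4 expr2; clearbody d; nra.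
have [y Ly hy] := dst_lt idL hq.
exists (r%:C *: y).
  exists k => //; have [Cy Ny] := idlZ idL r%:C Ly.
  exact: chain_sat_step.
have -> : a - r%:C *: y = r%:C *: (b - y).
  by rewrite scalerBr /b scalerA -rmorphM /= mulfV ?gt_eqF // rmorph1 scale1r.
by rewrite nmZ cabs_pos ?(ltW r0) // mulrC -ltr_pdivlMr.
Qed.

End Saturation.

(** * Representations by operators on semi-inner product modules *)
(* A family of semi-inner products, regarded as a single one along the filter
   [pm_filter]: the seminorm is a limit superior along it. *)
Record premod (R : realType) := Premod {
  pm_sort :> lmodType R[i];
  pm_dom : set pm_sort;
  pm_filter : set_system nat;
  pm_filterP : Filter pm_filter;
  pm_alg : nat -> cstarAlg R;
  pm_form : forall r, pm_sort -> pm_sort -> pm_alg r;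
  pm_dom0 : pm_dom 0;
  pm_domL : forall (c : R[i]) x y, pm_dom x -> pm_dom y -> pm_dom (c *: x + y);
  pm_form_linr : forall r (c : R[i]) x y z, pm_dom x -> pm_dom y -> pm_dom z ->
    pm_form r x (c *: y + z) = c *: pm_form r x y + pm_form r x z;
  pm_form_star : forall r x y, pm_dom x -> pm_dom y ->
    astar (pm_form r x y) = pm_form r y x;
  pm_form_pos : forall r x, pm_dom x -> cpos (pm_form r x x);
  pm_form_CS : forall r x y, pm_dom x -> pm_dom y ->
    nm (pm_form r x y) ^+ 2 <= nm (pm_form r x x) * nm (pm_form r y y);
  pm_form_bnd : forall x, pm_dom x ->
    exists M, pm_filter [set r | nm (pm_form r x x) <= M]
}.

Section Operators.
Variables (R : realType) (X : premod R).
Local Notation W := (@pm_dom R X).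
Local Notation F := (@pm_filter R X).
Local Notation "<< x , y >>_ r" := (@pm_form R X r x y) (at level 0, r at level 2).
Implicit Types (x y z : X) (f g : X -> X).

#[local] Instance pm_filterI : Filter F := @pm_filterP R X.

Lemma pmD x y : W x -> W y -> W (x + y).
Proof. by move=> ? ?; rewrite -[x]scale1r; exact: pm_domL. Qed.
Lemma pmZ (c : R[i]) x : W x -> W (c *: x).
Proof. by move=> ?; rewrite -[_ *: _]addr0; apply: pm_domL => //; exact: pm_dom0. Qed.
Lemma pmB x y : W x -> W y -> W (x - y).
Proof. by move=> ? ?; rewrite addrC -scaleN1r; exact: pm_domL. Qed.

Lemma formDr r x y z : W x -> W y -> W z -> <<x, y + z>>_r = <<x, y>>_r + <<x, z>>_r.
Proof. by move=> ? ? ?; rewrite -[y]scale1r pm_form_linr // !scale1r. Qed.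
Lemma form0r r x : W x -> <<x, 0>>_r = 0.
Proof.
move=> Wx; have W0 := pm_dom0 X.
by apply: (addrI <<x, 0>>_r); rewrite -formDr // !addr0.
Qed.
Lemma formZr r (c : R[i]) x y : W x -> W y -> <<x, c *: y>>_r = c *: <<x, y>>_r.
Proof.
by move=> ? ?; rewrite -[c *: y]addr0 pm_form_linr ?form0r ?addr0 //; exact: pm_dom0.
Qed.
Lemma formBr r x y z : W x -> W y -> W z -> <<x, y - z>>_r = <<x, y>>_r - <<x, z>>_r.
Proof.
by move=> Wx Wy Wz; rewrite addrC -scaleN1r pm_form_linr // scaleN1r addrC.
Qed.
Lemma formBl r x y z : W x -> W y -> W z -> <<y - z, x>>_r = <<y, x>>_r - <<z, x>>_r.
Proof.
move=> Wx Wy Wz; rewrite -[LHS]astarK pm_form_star ?formBr //; try exact: pmB.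
by rewrite astarB !pm_form_star.
Qed.
Lemma formDl r x y z : W x -> W y -> W z -> <<y + z, x>>_r = <<y, x>>_r + <<z, x>>_r.
Proof.
move=> Wx Wy Wz; rewrite -[LHS]astarK pm_form_star ?formDr //; try exact: pmD.
by rewrite astarD !pm_form_star.
Qed.
Lemma form_linl r (c : R[i]) x y z : W x -> W y -> W z ->
  <<c *: y + z, x>>_r = c^* *: <<y, x>>_r + <<z, x>>_r.
Proof.
move=> Wx Wy Wz; rewrite -[LHS]astarK pm_form_star ?pm_form_linr //; try exact: pm_domL.
by rewrite astar_antilin !pm_form_star.
Qed.
Lemma form0l r x : W x -> <<0, x>>_r = 0.
Proof.
by move=> Wx; rewrite -pm_form_star ?form0r ?astar0 //; exact: pm_dom0.
Qed.

Definition pnbound x M := 0 <= M /\ F [set r | nm <<x, x>>_r <= M ^+ 2].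
Definition pn x : R := inf [set M | pnbound x M].

Lemma pn_ex x : W x -> exists M, pnbound x M.
Proof.
move=> /pm_form_bnd[M hM]; exists (Num.max 1 M); split.
  by rewrite le_max ler01.
apply: filterS hM => r /= h; apply: le_trans h _.
have : 1 <= Num.max 1 M by rewrite le_max lexx.
have : M <= Num.max 1 M by rewrite le_max lexx orbT.
rewrite expr2; move: (Num.max 1 M) => t; nra.
Qed.

Lemma pn_ge0 x : W x -> 0 <= pn x.
Proof. by move=> /pn_ex ne; apply: lb_le_inf => // M []. Qed.

Lemma pn_le x M : pnbound x M -> pn x <= M.
Proof. by move=> h; apply: ge_inf => //; exists 0 => ? []. Qed.

Lemma pn_near x M : W x -> pn x < M -> F [set r | nm <<x, x>>_r <= M ^+ 2].
Proof.
move=> /pn_ex ne h; have [K [K0 hK] KM] := inf_lt ne h.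
apply: filterS hK => r /= /le_trans; apply.
by rewrite ler_pXn2r ?nnegrE ?(ltW (le_lt_trans K0 KM)) // ltW.
Qed.

Lemma pn_sqr_le x c : 0 <= c -> F [set r | nm <<x, x>>_r <= c] -> W x -> pn x ^+ 2 <= c.
Proof.
move=> c0 h Wx; rewrite -[leRHS]sqr_sqrtr // ler_pXn2r ?nnegrE ?pn_ge0 ?sqrtr_ge0 //.
by apply: pn_le; split; [exact: sqrtr_ge0|rewrite sqr_sqrtr].
Qed.

Lemma pn0 : pn 0 = 0.
Proof.
have W0 := pm_dom0 X; apply/eqP; rewrite eq_le pn_ge0 // andbT; apply: pn_le.
by split=> //; apply: nearW => r; rewrite /= form0r // nm0 expr0n.
Qed.

Lemma pn_eq0 x : W x -> (forall r, <<x, x>>_r = 0) -> pn x = 0.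
Proof.
move=> Wx h; apply/eqP; rewrite eq_le pn_ge0 // andbT; apply: pn_le.
by split=> //; apply: nearW => r; rewrite /= h nm0 expr0n.
Qed.

(** Cauchy-Schwarz for limits superior. Taken with [z = f x] and [y = opstar f (f x)], it yields the
    C*-inequality for operators. *)
Lemma pn_CS x y z : W x -> W y -> W z ->
  (forall r, nm <<z, z>>_r <= nm <<x, y>>_r) -> pn z ^+ 2 <= pn x * pn y.
Proof.
move=> Wx Wy Wz h; apply: ler_eps => e e0.
have x0 := pn_ge0 Wx; have y0 := pn_ge0 Wy.
pose d := Num.min 1 (e / (pn x + pn y + 1)).
have d0 : 0 < d by rewrite lt_min ltr01 divr_gt0 //; lra.
have d1 : d <= 1 by rewrite ge_min lexx.
have d2 : d * (pn x + pn y + 1) <= e.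
  by rewrite -ler_pdivlMr; [rewrite ge_min lexx orbT|lra].
have xd : pn x < pn x + d by lra.
have yd : pn y < pn y + d by lra.
apply: (@le_trans _ _ ((pn x + d) * (pn y + d))); last first.
  have : d * d <= d by rewrite -[leRHS]mulr1 ler_wpM2l // ltW.
  by clearbody d; nra.
apply: pn_sqr_le => //; first by rewrite mulr_ge0 //; lra.
apply: filterS2 (pn_near Wx xd) (pn_near Wy yd) => r /= hx hy.
apply: le_trans (h r) _.
rewrite -(@ler_pXn2r _ 2) ?nnegrE ?nm_ge0 ?mulr_ge0 //; try lra.
apply: le_trans (pm_form_CS r Wx Wy) _; rewrite exprMn.
by apply: ler_pM; rewrite ?nm_ge0.
Qed.

Lemma pnD x y : W x -> W y -> pn (x + y) <= pn x + pn y.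
Proof.
move=> Wx Wy; have Wxy := pmD Wx Wy; apply: ler_eps => e e0.
have e20 : 0 < e / 2 by rewrite divr_gt0.
have x0 := pn_ge0 Wx; have y0 := pn_ge0 Wy.
pose p := pn x + e / 2; pose q := pn y + e / 2.
have xp : pn x < p by rewrite /p; lra.
have yq : pn y < q by rewrite /q; lra.
have -> : pn x + pn y + e = p + q by rewrite /p /q; lra.
apply: pn_le; split; first by lra.
apply: filterS2 (pn_near Wx xp) (pn_near Wy yq) => r /= hx hy.
have hxy : nm <<x, y>>_r <= p * q.
  rewrite -(@ler_pXn2r _ 2) ?nnegrE ?nm_ge0 ?mulr_ge0 //; try lra.
  apply: le_trans (pm_form_CS r Wx Wy) _; rewrite exprMn.
  by apply: ler_pM; rewrite ?nm_ge0.
have hyx : nm <<y, x>>_r <= p * q by rewrite -pm_form_star // nm_astar.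
rewrite formDr // !formDl //.
have h1 := nmD (<<x, x>>_r + <<y, x>>_r) (<<x, y>>_r + <<y, y>>_r).
have h2 := nmD <<x, x>>_r <<y, x>>_r; have h3 := nmD <<x, y>>_r <<y, y>>_r.
by rewrite !expr2 in hx hy *; lra.
Qed.

Lemma pnZ_le (c : R[i]) x : W x -> pn (c *: x) <= cabs c * pn x.
Proof.
move=> Wx; apply: ler_eps => e e0; have c0 := cabs_ge0 c.
have e20 : 0 < e / (cabs c + 1) by rewrite divr_gt0 //; lra.
have xd : pn x < pn x + e / (cabs c + 1) by lra.
have x0 := pn_ge0 Wx.
apply: (@le_trans _ _ (cabs c * (pn x + e / (cabs c + 1)))); last first.
  rewrite mulrDr lerD2l mulrA ler_pdivrMr; nra.
apply: pn_le; split; first by rewrite mulr_ge0 //; lra.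
apply: filterS (pn_near Wx xd) => r /= hx.
have Wcx := pmZ c Wx.
rewrite formZr // nmZ -pm_form_star // nm_astar formZr // nmZ mulrA.
by rewrite exprMn expr2 ler_wpM2l // mulr_ge0.
Qed.

Lemma pnN x : W x -> pn (- x) = pn x.
Proof.
move=> Wx; have le y : W y -> pn (- y) <= pn y.
  by move=> Wy; have := pnZ_le (-1) Wy; rewrite scaleN1r cabsN cabs1 mul1r.
apply/eqP; rewrite eq_le le //= -{1}[x]opprK le //.
by rewrite -scaleN1r; exact: pmZ.
Qed.

Lemma pn_eqB x y : W x -> W y -> pn (x - y) = 0 -> pn x = pn y.
Proof.
move=> Wx Wy h; have WB := pmB Wx Wy.
apply/eqP; rewrite eq_le; apply/andP; split.
  by have := pnD WB Wy; rewrite subrK h add0r.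
by have := pnD (pmB Wy Wx) Wx; rewrite subrK -(opprB x) pnN // h add0r.
Qed.

Definition nice f := [/\ forall (c : R[i]) x y, W x -> W y -> f (c *: x + y) = c *: f x + f y,
  forall x, W x -> W (f x) & exists M, opbound W pn f M].

Definition adj f g := forall r x y, W x -> W y -> <<f x, y>>_r = <<x, g y>>_r.

Definition opdom f := nice f /\ exists2 g, nice g & adj f g.

(** A choice is made because an adjoint is unique only up to vectors of seminorm 0, see
    [adj_uniq]. *)
Definition opstar f : X -> X := xget f [set g | nice g /\ adj f g].

Definition opnu f : R := opn W pn f.

Lemma opstarP f : opdom f -> nice (opstar f) /\ adj f (opstar f).
Proof.
move=> [_ [g ng fg]]; rewrite /opstar; case: xgetP => [h -> //|/(_ g) /= []].
by split.
Qed.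

Lemma adj_sym f g : nice f -> nice g -> adj f g -> adj g f.
Proof.
move=> [_ fW _] [_ gW _] fg r x y Wx Wy.
have Wgx := gW x Wx; have Wfy := fW y Wy.
by rewrite -(pm_form_star r Wy Wgx) -fg // pm_form_star.
Qed.

Lemma opnuP f x : nice f -> W x -> pn (f x) <= opnu f * pn x.
Proof. by move=> [_ _ [M b]]; apply: (opnP _ b) => y; exact: pn_ge0. Qed.

Lemma opnu_le f M : 0 <= M -> (forall x, W x -> pn (f x) <= M * pn x) -> opnu f <= M.
Proof. by move=> M0 h; exact: opn_le. Qed.

Lemma opnu_ge0 f : 0 <= opnu f. Proof. exact: opn_ge0. Qed.

Lemma opnu_eq0 f : (forall x, W x -> pn (f x) = 0) -> opnu f = 0.
Proof.
move=> h; apply/eqP; rewrite eq_le opnu_ge0 andbT; apply: opnu_le => // x Wx.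
by rewrite h // mul0r.
Qed.

Lemma adj_uniq f g g' x : nice f -> nice g -> nice g' -> adj f g -> adj f g' ->
  W x -> pn (g x - g' x) = 0.
Proof.
move=> nf ng ng' fg fg' Wx; have [_ gW _] := ng; have [_ g'W _] := ng'.
have Wu : W (g x - g' x) by apply: pmB; [exact: gW|exact: g'W].
apply: pn_eq0 => // r; rewrite formBr //; try by [exact: gW|exact: g'W].
by rewrite -fg // -fg' // subrr.
Qed.

Lemma nice_lin (c : R[i]) f g : nice f -> nice g -> nice (c *: f + g).
Proof.
move=> nf ng; have [fL fW _] := nf; have [gL gW _] := ng; split.
- move=> d x y Wx Wy.
  rewrite -[LHS]/(c *: f (d *: x + y) + g (d *: x + y)) fL // gL //.
  rewrite -[(c *: f + g) x]/(c *: f x + g x) -[(c *: f + g) y]/(c *: f y + g y).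
  by rewrite !scalerDr !scalerA [c * d]mulrC addrACA.
- move=> x Wx; rewrite -[(c *: f + g) x]/(c *: f x + g x).
  by apply: pm_domL; [exact: fW|exact: gW].
- exists (cabs c * opnu f + opnu g); split.
    by rewrite addr_ge0 ?mulr_ge0 ?cabs_ge0 ?opnu_ge0.
  move=> x Wx; rewrite -[(c *: f + g) x]/(c *: f x + g x).
  have Wf := fW x Wx; have Wg := gW x Wx.
  apply: le_trans (pnD (pmZ c Wf) Wg) _; rewrite mulrDl; apply: lerD; last exact: opnuP.
  apply: le_trans (pnZ_le c Wf) _; rewrite -mulrA ler_wpM2l ?cabs_ge0 //.
  exact: opnuP.
Qed.

Lemma nice_comp f g : nice f -> nice g -> nice (f \o g).
Proof.
move=> nf ng; have [fL fW _] := nf; have [gL gW _] := ng; split.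
- by move=> d x y Wx Wy /=; rewrite gL // fL //; exact: gW.
- by move=> x Wx; apply/fW/gW.
- exists (opnu f * opnu g); split; first by rewrite mulr_ge0 ?opnu_ge0.
  move=> x Wx /=; apply: le_trans (opnuP nf (gW x Wx)) _.
  by rewrite -mulrA ler_wpM2l ?opnu_ge0 // opnuP.
Qed.

Lemma nice0 : nice 0.
Proof.
split=> [c x y _ _|x _|]; first by rewrite scaler0 addr0.
  exact: pm_dom0.
by exists 0; split=> // x Wx; rewrite mul0r pn0.
Qed.

Lemma adj_lin (c : R[i]) f g f' g' : nice f -> nice g -> nice f' -> nice g' ->
  adj f f' -> adj g g' -> adj (c *: f + g) (c^* *: f' + g').
Proof.
move=> [_ fW _] [_ gW _] [_ f'W _] [_ g'W _] ff gg r x y Wx Wy.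
rewrite -[(c *: f + g) x]/(c *: f x + g x) -[(_ + g') y]/(c^* *: f' y + g' y).
rewrite form_linl ?pm_form_linr ?ff ?gg //; try by [exact: fW|exact: gW|exact: f'W|exact: g'W].
Qed.

Lemma adj_comp f g f' g' : nice f -> nice g -> nice f' -> nice g' ->
  adj f f' -> adj g g' -> adj (f \o g) (g' \o f').
Proof.
move=> [_ fW _] [_ gW _] [_ f'W _] [_ g'W _] ff gg r x y Wx Wy /=.
by rewrite ff ?gg //; [exact: f'W|exact: gW].
Qed.

Lemma opnu_sqr_le f : opdom f -> opnu f ^+ 2 <= opnu (opstar f \o f).
Proof.
move=> df; have [nf _] := df; have [nfs fs] := opstarP df.
have nff := nice_comp nfs nf; set c := opnu (_ \o _).
have c0 : 0 <= c by exact: opnu_ge0.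
have [_ fW _] := nf; have [_ fsW _] := nfs.
rewrite -[leRHS]sqr_sqrtr // ler_pXn2r ?nnegrE ?opnu_ge0 ?sqrtr_ge0 //.
apply: opnu_le => [|x Wx]; first exact: sqrtr_ge0.
have Wf := fW x Wx; have Wff := fsW _ Wf.
rewrite -(@ler_pXn2r _ 2) ?nnegrE ?pn_ge0 ?mulr_ge0 ?sqrtr_ge0 ?pn_ge0 //.
rewrite exprMn sqr_sqrtr //.
have := pn_CS Wx Wff Wf (fun r => _ : nm <<f x, f x>>_r <= nm <<x, opstar f (f x)>>_r).
rewrite /c => h; apply: le_trans (h _) _; first by move=> r; rewrite fs.
have := opnuP nff Wx; rewrite /= => h1.
rewrite expr2 mulrCA; apply: ler_wpM2l => //; exact: pn_ge0.
Qed.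

Lemma opnuM f g : nice f -> nice g -> opnu (f \o g) <= opnu f * opnu g.
Proof.
move=> nf ng; apply: opnu_le => [|x Wx /=]; first by rewrite mulr_ge0 ?opnu_ge0.
have [_ gW _] := ng; apply: le_trans (opnuP nf (gW x Wx)) _.
by rewrite -mulrA ler_wpM2l ?opnu_ge0 // opnuP.
Qed.

Lemma opdom_star f : opdom f -> opdom (opstar f).
Proof.
move=> df; have [nf _] := df; have [nfs fs] := opstarP df.
by split=> //; exists f => //; exact: adj_sym.
Qed.

Lemma opnu_eq f g : nice f -> nice g -> opnu (f - g) = 0 -> opnu f = opnu g.
Proof.
have le f' g' : nice f' -> nice g' -> (forall x, W x -> pn (f' x - g' x) = 0) ->
    opnu f' <= opnu g'.
  move=> nf ng h; apply: opnu_le => [|x Wx]; first exact: opnu_ge0.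
  have [_ fW _] := nf; have [_ gW _] := ng.
  by rewrite (pn_eqB (fW x Wx) (gW x Wx) (h x Wx)) opnuP.
move=> nf ng h; have [_ fW _] := nf; have [_ gW _] := ng.
have nfg : nice (f - g).
  by rewrite addrC -scaleN1r; exact: nice_lin.
have h0 x : W x -> pn (f x - g x) = 0.
  move=> Wx; apply/eqP; rewrite eq_le pn_ge0 ?andbT; last first.
    by apply: pmB; [exact: fW|exact: gW].
  by have := opnuP nfg Wx; rewrite h mul0r.
apply/eqP; rewrite eq_le le //= le // => x Wx.
rewrite -(opprB (f x)) pnN ?h0 //.
by apply: pmB; [exact: fW|exact: gW].
Qed.

Lemma opstar_null f g : nice g -> adj f g -> opdom f -> opnu (opstar f - g) = 0.
Proof.
move=> ng fg df; have [nf _] := df; have [nfs fs] := opstarP df.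
by apply: opnu_eq0 => x Wx; exact: (adj_uniq nf nfs ng fs fg).
Qed.

Lemma opnu_star f : opdom f -> opnu (opstar f) = opnu f.
Proof.
have le g : opdom g -> opnu g <= opnu (opstar g).
  move=> dg; have [ng _] := dg; have [ngs _] := opstarP dg.
  apply: ler_sqrW; rewrite ?opnu_ge0 // -expr2.
  exact: le_trans (opnu_sqr_le dg) (opnuM ngs ng).
move=> df; apply/eqP; rewrite eq_le le // andbT.
have ds := opdom_star df; apply: le_trans (le _ ds) _.
have [nf _] := df; have [nfs fs] := opstarP df.
have [nss _] := opstarP ds.
rewrite (opnu_eq nss nf) //; apply: opstar_null => //; exact: adj_sym.
Qed.

Lemma opnu_null f g : (forall x, W x -> f x = g x) -> opnu (f - g) = 0.
Proof.
by move=> h; apply: opnu_eq0 => x Wx; rewrite -[(f - g) x]/(f x - g x) h // subrr pn0.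
Qed.

Lemma opdom_lin (c : R[i]) f g : opdom f -> opdom g -> opdom (c *: f + g).
Proof.
move=> [nf [f' nf' ff]] [ng [g' ng' gg]]; split; first exact: nice_lin.
by exists (c^* *: f' + g'); [exact: nice_lin|exact: adj_lin].
Qed.

Lemma opdom_comp f g : opdom f -> opdom g -> opdom (f \o g).
Proof.
move=> [nf [f' nf' ff]] [ng [g' ng' gg]]; split; first exact: nice_comp.
by exists (g' \o f'); [exact: nice_comp|exact: adj_comp].
Qed.

Definition op_prestar : prestar R.
Proof.
refine (@Prestar R (X -> X) opdom opnu (fun f g => f \o g) opstar
  _ _ _ _ _ _ _ _ _ _ _ _ _ _ _).
- split; first exact: nice0.
  exists 0; first exact: nice0.
  by move=> r x y Wx Wy; rewrite /= form0l // form0r.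
- exact: opdom_lin.
- exact: opdom_comp.
- exact: opdom_star.
- by move=> f _; exact: opnu_ge0.
- move=> f g [nf _] [ng _]; apply: opnu_le => [|x Wx].
    by rewrite addr_ge0 ?opnu_ge0.
  have [_ fW _] := nf; have [_ gW _] := ng.
  by rewrite mulrDl; apply: le_trans (pnD (fW x Wx) (gW x Wx)) _; apply: lerD; exact: opnuP.
- have le (c : R[i]) f : opdom f -> opnu (c *: f) <= cabs c * opnu f.
    move=> [nf _]; apply: opnu_le => [|x Wx]; first by rewrite mulr_ge0 ?cabs_ge0 ?opnu_ge0.
    have [_ fW _] := nf; apply: le_trans (pnZ_le c (fW x Wx)) _.
    by rewrite -mulrA ler_wpM2l ?cabs_ge0 // opnuP.
  move=> c f df; apply/eqP; rewrite eq_le le //=.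
  have [->|c0] := eqVneq c 0; first by rewrite cabs0 mul0r opnu_ge0.
  have dcf : opdom (c *: f).
    rewrite -[c *: f]addr0; apply: opdom_lin => //; split; first exact: nice0.
    exists 0; first exact: nice0.
    by move=> r x y Wx Wy; rewrite /= form0l // form0r.
  have := le c^-1 _ dcf; rewrite scalerA mulVf // scale1r => h.
  apply: le_trans (ler_wpM2l (cabs_ge0 c) h) _.
  by rewrite mulrA -cabsM mulfV // cabs1 mul1r.
- by move=> f g [nf _] [ng _]; exact: opnuM.
- by move=> f g h _ _ _; apply: opnu_null.
- by move=> c f g h _ _ _; apply: opnu_null.
- move=> c f g h [[fL fW _] _] [[_ gW _] _] [[_ hW _] _]; apply: opnu_null => x Wx /=.
  by apply: fL; [exact: gW|exact: hW].
- move=> c f g df dg; have [nfs fs] := opstarP df; have [ngs gs] := opstarP dg.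
  have [nf _] := df; have [ng _] := dg.
  apply: opstar_null; [exact: nice_lin|exact: adj_lin|exact: opdom_lin].
- move=> f df; have [nf _] := df; have [nfs fs] := opstarP df.
  by apply: opstar_null => //; [exact: adj_sym|exact: opdom_star].
- move=> f g df dg; have [nfs fs] := opstarP df; have [ngs gs] := opstarP dg.
  have [nf _] := df; have [ng _] := dg.
  apply: opstar_null; [exact: nice_comp|exact: adj_comp|exact: opdom_comp].
- move=> f df; have [nf _] := df; have [nfs _] := opstarP df.
  apply/eqP; rewrite eq_le opnu_sqr_le // andbT.
  by apply: le_trans (opnuM nfs nf) _; rewrite opnu_star // expr2.
Defined.

End Operators.

Section Representation.
Variables (R : realType) (T : rtCstarPrecat R) (K : homfam T) (X : premod R).
Arguments K : clear implicits.
Local Notation W := (@pm_dom R X).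
Variable L : forall n m, T n m -> X -> X.
Hypotheses (idK : is_ideal K)
  (L_lin : forall n m (a : T n m) (c : R[i]) x y, K n m a -> W x -> W y ->
     L a (c *: x + y) = c *: L a x + L a y)
  (L_dom : forall n m (a : T n m) x, K n m a -> W x -> W (L a x))
  (L_add : forall n m (c : R[i]) (a b : T n m) x, K n m a -> K n m b -> W x ->
     L (c *: a + b) x = c *: L a x + L b x)
  (L_mul : forall n m k l (a : T n m) (b : T (k + m)%N l) x,
     K n m a -> K (k + m)%N l b -> W x ->
     L a (L b x) = L (tens_iter k a ;; b) x)
  (L_adj : forall n m (a : T n m) r x y, K n m a -> W x -> W y ->
     pm_form r (L a x) y = pm_form r x (L (hstar a) y)).

(* With [a^* a = 2 g - g^2] for [|a| <= 1], the vector [y = x - g x] satisfies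
   [<a x, a x> + <y, y> = <x, x>]. *)
Lemma L_contr n m (a : T n m) r x : K n m a -> nm a <= 1 -> W x ->
  nm (pm_form r (L a x) (L a x)) <= nm (pm_form r x x).
Proof.
move=> Ka a1 Wx; pose h : endo T m := hstar a ;; a.
have Kh : K m m h by exact: idl_left.
have sh : astar h = h by rewrite /h /= hstarM hstarK.
have h1 : nm h <= 1.
  by rewrite [nm h](hnm_cstar a) expr_le1 // nm_ge0.
have [g [Kg sg eg]] := csquare_ex (idl_endo idK m) Kh sh h1.
pose y := x - L g x.
have Wg : W (L g x) by exact: L_dom.
have Wy : W y by exact: pmB.
have KM p q s (c : T p q) (d : T q s) : K q s d -> K p s (c ;; d) by exact: idl_left.
have Lh : L h x = L g x + L g x - L g (L g x).
  rewrite (@L_mul m m 0 m g g x Kg Kg Wx) /= -eg.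
  have -> : (g + g - (g : T m m) ;; g : T m m) = (-1) *: ((g : T m m) ;; g) + (1 *: g + g).
    by rewrite scaleN1r scale1r addrC.
  rewrite !L_add ?scaleN1r ?scale1r //; first by rewrite addrC.
  - exact: KM.
  - exact: (idlD idK).
have e1 : pm_form r (L a x) (L a x) = pm_form r x (L h x).
  have Wa : W (L a x) by exact: L_dom.
  by rewrite L_adj // (@L_mul m n 0 m) //; exact: idl_star.
have e2 : pm_form r y y = pm_form r x x - pm_form r x (L h x).
  have sg' : hstar (g : T m m) = g by exact: sg.
  have Wgg : W (L g (L g x)) by exact: L_dom.
  rewrite Lh formBr //; last exact: pmD.
  rewrite formDr // /y formBl // !formBr //.
  have -> : pm_form r (L g x) x = pm_form r x (L g x) by rewrite L_adj // sg'.
  have -> : pm_form r (L g x) (L g x) = pm_form r x (L g (L g x)).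
    by rewrite L_adj // sg'.
  by rewrite -addrA -opprD addrA.
rewrite e1; have -> : pm_form r x x = pm_form r x (L h x) + pm_form r y y.
  by rewrite e2 addrC subrK.
by apply: cpos_le; [rewrite -e1; apply: pm_form_pos; exact: L_dom|exact: pm_form_pos].
Qed.

(** Boundedness is automatic: [L_contr] applies to a multiple of [a] of norm at most 1. *)
Lemma L_nice n m (a : T n m) : K n m a -> nice (L a).
Proof.
move=> Ka; split.
- by move=> c x y; exact: L_lin.
- by move=> x; exact: L_dom.
pose c := nm a + 1; have c0 : 0 < c by have := nm_ge0 a; rewrite /c; lra.
exists c; split; first exact: ltW.
move=> x Wx; have x0 := pn_ge0 Wx.
pose b := (c^-1)%:C *: a; have Kb : K n m b by exact: idlZ.
have b1 : nm b <= 1.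
  by rewrite nmZ cabs_pos ?invr_ge0 ?(ltW c0) // ler_pdivrMl // mulr1 /c; lra.
have Wb : W (L b x) by exact: L_dom.
have L0 : L (0 : T n m) x = 0.
  have K0 := idl0 idK n m.
  have := L_add (-1) K0 K0 Wx; rewrite scaler0 addr0 scaleN1r addNr //.
have eL : L a x = c%:C *: L b x.
  have K0 := idl0 idK n m.
  have := L_add c%:C Kb K0 Wx; rewrite L0 !addr0 => <-.
  by rewrite scalerA -rmorphM /= mulfV ?gt_eqF // rmorph1 scale1r.
rewrite eL; apply: le_trans (pnZ_le _ Wb) _; rewrite cabs_pos ?(ltW c0) //.
rewrite ler_wpM2l ?(ltW c0) //; apply: ler_eps => e e0; apply: pn_le.
split; first lra.
have xe : pn x < pn x + e by lra.
have FI : Filter (@pm_filter R X) := @pm_filterP R X.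
apply: filterS (pn_near Wx xe) => r /= h.
exact: le_trans (L_contr r Kb b1 Wx) h.
Qed.

Lemma L_opdom n m (a : T n m) : K n m a -> opdom (L a).
Proof.
move=> Ka; split; first exact: L_nice.
exists (L (hstar a)); first by apply: L_nice; exact: idl_star.
by move=> r x y Wx Wy; exact: L_adj.
Qed.

Definition op_rep n m (a : T n m) : hcAlg (op_prestar X) := @hj R (op_prestar X) (L a).

Lemma op_rep_eq (f g : X -> X) : opdom f -> opdom g ->
  (forall x, W x -> pn (f x - g x) = 0) ->
  @hj R (op_prestar X) f = @hj R (op_prestar X) g.
Proof.
move=> df dg h; apply/subr0_eq/nm_eq0; rewrite nm_hjB //.
exact: opnu_eq0.
Qed.

Lemma op_repP : is_rep K op_rep.
Proof.
split.
- move=> n m c a b Ka Kb.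
  rewrite -(@hj_lin R (op_prestar X)); try exact: L_opdom.
  apply: op_rep_eq; [apply: L_opdom; exact: idlL|apply: opdom_lin; exact: L_opdom|].
  by move=> x Wx; rewrite L_add // subrr pn0.
- move=> n m a Ka; rewrite /op_rep -(@hjS R (op_prestar X)); last exact: L_opdom.
  have da := L_opdom Ka; have [ns fs] := opstarP da.
  have Ks := idl_star idK Ka.
  apply: op_rep_eq; [exact: opdom_star|exact: L_opdom|move=> x Wx].
  apply: (adj_uniq (L_nice Ka) ns (L_nice Ks) fs) => // r y z Wy Wz.
  exact: L_adj.
- move=> n m k l a b Ka Kb.
  rewrite /op_rep -(@hjM R (op_prestar X)); try exact: L_opdom.
  apply: op_rep_eq.
  - by apply: opdom_comp; exact: L_opdom.
  - by apply: L_opdom; exact: idl_left.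
  - by move=> x Wx /=; rewrite L_mul // subrr pn0.
Qed.

Lemma op_rep0 n m (a : T n m) x : K n m a -> op_rep a = 0 -> W x -> pn (L a x) = 0.
Proof.
move=> Ka h Wx; have := @nm_hj R (op_prestar X) _ (L_opdom Ka).
rewrite -/(op_rep a) h nm0 => /esym e0.
apply/eqP; rewrite eq_le pn_ge0 ?andbT; last exact: L_dom.
by have := opnuP (L_nice Ka) Wx; rewrite [opnu _]e0 mul0r.
Qed.

End Representation.

(** * The Fock representation *)
Section Families.
Variables (R : realType) (T : rtCstarPrecat R).

(** Operators act on the index [p] and leave [r] alone. All [r] are kept together so that a limit
    along [r] can be taken. *)
Definition famT := forall p r : nat, T p r.
HB.instance Definition _ := gen_eqMixin famT.
HB.instance Definition _ := gen_choiceMixin famT.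

Lemma famP (x y : famT) : (forall p r, x p r = y p r) -> x = y.
Proof.
by move=> h; apply: functional_extensionality_dep => p; apply: functional_extensionality_dep.
Qed.

Definition fam0 : famT := fun p r => 0.
Definition famD (x y : famT) : famT := fun p r => x p r + y p r.
Definition famN (x : famT) : famT := fun p r => - x p r.
Definition famZ (c : R[i]) (x : famT) : famT := fun p r => c *: x p r.

Fact famDA : associative famD.
Proof. by move=> x y z; apply: famP => p r; exact: addrA. Qed.
Fact famDC : commutative famD.
Proof. by move=> x y; apply: famP => p r; exact: addrC. Qed.
Fact fam0D : left_id fam0 famD.
Proof. by move=> x; apply: famP => p r; exact: add0r. Qed.
Fact famND : left_inverse fam0 famN famD.
Proof. by move=> x; apply: famP => p r; exact: addNr. Qed.
HB.instance Definition _ := GRing.isZmodule.Build famT famDA famDC fam0D famND.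

Fact famZA a b v : famZ a (famZ b v) = famZ (a * b) v.
Proof. by apply: famP => p r; exact: scalerA. Qed.
Fact famZ1 : left_id 1 famZ.
Proof. by move=> v; apply: famP => p r; exact: scale1r. Qed.
Fact famZDr : right_distributive famZ +%R.
Proof. by move=> c u v; apply: famP => p r; exact: scalerDr. Qed.
Fact famZDl v : {morph famZ^~ v : a b / a + b}.
Proof. by move=> a b; apply: famP => p r; exact: scalerDl. Qed.
HB.instance Definition _ :=
  GRing.Zmodule_isLmodule.Build R[i] famT famZA famZ1 famZDr famZDl.

Lemma fam_linE (c : R[i]) (x y : famT) p r : (c *: x + y) p r = c *: x p r + y p r.
Proof. by []. Qed.
Implicit Types x y z : famT.

Definition fsum (B r : nat) x y : T r r := \sum_(p < B) hstar (x p r) ;; y p r.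

Definition fsupp x (r B : nat) := forall p, (B <= p)%N -> x p r = 0.

Lemma fsum_stable B B' r x y : fsupp x r B -> (B <= B')%N ->
  fsum B' r x y = fsum B r x y.
Proof.
move=> h BB'; rewrite /fsum -(subnKC BB') big_split_ord /= [X in _ + X]big1 ?addr0 //.
by move=> i _; rewrite h ?hstar0 ?hcomp0l // leq_addr.
Qed.

Lemma fsum_star B r x y : hstar (fsum B r x y) = fsum B r y x.
Proof.
rewrite /fsum (big_morph (@hstar R T r r) (@hstarD R T r r) (hstar0 T r r)).
by apply: eq_bigr => i _; rewrite hstarM hstarK.
Qed.

Lemma fsum_linr B r (c : R[i]) x y z :
  fsum B r x (c *: y + z) = c *: fsum B r x y + fsum B r x z.
Proof.
rewrite /fsum scaler_sumr -big_split; apply: eq_bigr => i _ /=.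
by rewrite fam_linE hcomp_linr.
Qed.

Lemma fsum_le B r x (M : R) : (\sum_(p < B) nm (x p r) <= M) ->
  nm (fsum B r x x) <= M * M.
Proof.
move=> hM; have h0 : 0 <= \sum_(p < B) nm (x p r) by apply: sumr_ge0 => i _; exact: nm_ge0.
apply: (@le_trans _ _ ((\sum_(p < B) nm (x p r)) * (\sum_(p < B) nm (x p r)))); last first.
  by apply: ler_pM.
rewrite /fsum; elim: B {hM h0} => [|B IH]; first by rewrite !big_ord0 nm0 mul0r.
rewrite !big_ord_recr /=; apply: le_trans (nmD _ _) _.
have h0 : 0 <= \sum_(p < B) nm (x p r) by apply: sumr_ge0 => i _; exact: nm_ge0.
have := nm_ge0 (x B r); rewrite hnm_cstar expr2; nra.
Qed.

End Families.

Section QuotientPositivity.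
Variables (R : realType) (T : rtCstarPrecat R) (I : homfam T).
Hypothesis idI : is_ideal I.
Implicit Types x y : famT T.

Lemma qmap_sum r (J : Type) (s : seq J) (G : J -> T r r) :
  qmap idI (\sum_(i <- s) G i : endo T r) = \sum_(i <- s) qmap idI (G i : endo T r).
Proof.
have hq := qmap_starhom idI r.
exact: (big_morph _ (shomD hq) (shom0 hq)).
Qed.

(** The positivity axiom [hom_pos] enters here, since [a] need not be an endomorphism. *)
Lemma cpos_hom p r (a : T p r) : cpos (qmap idI (hstar a ;; a : endo T r)).
Proof.
have [b ->] := hom_pos a; exists (qmap idI (b : endo T r)).
have hq := qmap_starhom idI r.
by rewrite -(shomS hq) -(shomM hq).
Qed.

Lemma cpos_fsum B r x : cpos (qmap idI (fsum B r x x : endo T r)).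
Proof. by rewrite /fsum qmap_sum; apply: cpos_sum => i; exact: cpos_hom. Qed.

Lemma setT_subalg (A : cstarAlg R) : is_cstar_subalg [set: A].
Proof. by split=> //; exact: closedT. Qed.

(* For [t > |X|], the element [t^2 Y - t a^* a] is the sum of the positive
   element of the hypothesis and of [t - X] compressed by [a]. *)
Lemma CS_of_cpos (A : cstarAlg R) (X Y a : A) : astar X = X ->
  (forall t : R, 0 < t -> cpos (astar a ** X ** a -
     (t%:C *: (astar a ** a) + t%:C *: (astar a ** a)) + (t * t)%:C *: Y)) ->
  nm a ^+ 2 <= nm X * nm Y.
Proof.
move=> sX H.
have Ht t : nm X < t -> nm a ^+ 2 <= t * nm Y.
  move=> Xt; have t0 : 0 < t by apply: le_lt_trans (nm_ge0 _) Xt.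
  have pz := H t t0.
  have sX' : astar ((t^-1)%:C *: X) = (t^-1)%:C *: X by rewrite astarZ conjR sX.
  have nX : nm ((t^-1)%:C *: X) <= 1.
    by rewrite nmZ cabs_pos ?invr_ge0 ?(ltW t0) // ler_pdivrMl // mulr1 ltW.
  have [g [_ sg eg]] := csquare_ex (setT_subalg A) (Logic.I : [set: A] _) sX' nX.
  pose b := a - g ** a.
  have eb : astar b ** b = astar a ** a - (t^-1)%:C *: (astar a ** X ** a).
    have -> : (t^-1)%:C *: (astar a ** X ** a) = astar a ** ((t^-1)%:C *: X) ** a.
      by rewrite amulZr amulZl.
    rewrite -eg /b astarB astarM sg !(amulBl, amulBr, amulDl, amulDr) !amulA.
    by rewrite -addrA -opprD addrA.
  have tb : cpos (t%:C *: (astar b ** b)).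
    exists ((Num.sqrt t)%:C *: b); rewrite astarZ conjR amulZl amulZr scalerA.
    by rewrite -rmorphM /= -expr2 sqr_sqrtr // ltW.
  have ta : cpos (t%:C *: (astar a ** a)).
    exists ((Num.sqrt t)%:C *: a); rewrite astarZ conjR amulZl amulZr scalerA.
    by rewrite -rmorphM /= -expr2 sqr_sqrtr // ltW.
  have := cpos_le ta (cposD pz tb).
  have -> : t%:C *: (astar a ** a) + (astar a ** X ** a -
     (t%:C *: (astar a ** a) + t%:C *: (astar a ** a)) + (t * t)%:C *: Y +
     t%:C *: (astar b ** b)) = (t * t)%:C *: Y.
    rewrite eb scalerBr scalerA -rmorphM /= mulfV ?gt_eqF // rmorph1 scale1r.
    set A1 := _ *: (_ ** _); set A2 := _ ** a; set A3 := _ *: Y.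
    rewrite [A1 - A2]addrC addrACA [A3 + A1]addrC.
    rewrite [A2 - _]addrC -[- (A1 + A1) + A2 - A2]addrA subrr addr0.
    by rewrite !addrA opprD addrA subrr add0r addNr add0r.
  rewrite !nmZ nm_cstar !cabs_pos ?mulr_ge0 ?(ltW t0) // -mulrA ler_pM2l //.
move: (nm_ge0 X) (nm_ge0 Y) Ht; move: (nm X) (nm Y) (nm a) => X' Y' a' X0 Y0 Ht.
apply: ler_eps => e e0.
have e1 : 0 < e / (Y' + 1) by rewrite divr_gt0 //; lra.
have := Ht (X' + e / (Y' + 1)); rewrite mulrDl => h.
apply: le_trans (h _) _; first by lra.
by rewrite lerD2l mulrAC ler_pdivrMr; nra.
Qed.

(** The classical vector [x c - t y] of the Cauchy-Schwarz argument, where [c] is the inner product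
    of [x] and [y]. *)
Lemma fsum_square B r (t : R) x y (c := fsum B r x y) :
  exists z, fsum B r z z = (hstar c ;; fsum B r x x ;; c -
     (t%:C *: (hstar c ;; c) + t%:C *: (hstar c ;; c))) + (t * t)%:C *: fsum B r y y.
Proof.
(* Since [c] lies in [T r r], the vector makes sense only in column [r]; the other columns are
   filled with 0. *)
pose z : famT T := fun p s =>
  if pselect (s = r) is left e then
    hcast erefl (esym e) (x p r ;; c - t%:C *: y p r) else 0.
have zr p : z p r = x p r ;; c - t%:C *: y p r.
  by rewrite /z; case: pselect => // e; rewrite hcast_id.
exists z; clearbody z.
have cl (F : 'I_B -> T r r) : hstar c ;; (\sum_(p < B) F p) = \sum_(p < B) hstar c ;; F p.
  exact: (big_morph (hcomp (hstar c)) (hcompDr (hstar c)) (hcomp0r r (hstar c))).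
have cr (F : 'I_B -> T r r) : (\sum_(p < B) F p) ;; c = \sum_(p < B) F p ;; c.
  exact: (big_morph (fun w => hcomp w c) (fun u v => hcompDl u v c) (hcomp0l r c)).
have cc1 : hstar c ;; c = \sum_(p < B) hstar c ;; (hstar (x p r) ;; y p r).
  by rewrite -cl.
have cc2 : hstar c ;; c = \sum_(p < B) (hstar (y p r) ;; x p r) ;; c.
  by rewrite -cr -/(fsum B r y x) -fsum_star.
rewrite {1}cc1 {1}cc2 !scaler_sumr -big_split.
rewrite /fsum cl cr /= -sumrB -big_split; apply: eq_bigr => p _ /=.
rewrite !zr hstarB hstarM hstarZ conjR hcompBl !hcompBr.
rewrite !hcompZl !hcompZr !scalerA !hcompA -?rmorphM /=.
by rewrite opprB opprD !addrA addrAC.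
Qed.

Lemma fsum_CS B r x y :
  nm (qmap idI (fsum B r x y : endo T r)) ^+ 2 <=
  nm (qmap idI (fsum B r x x : endo T r)) * nm (qmap idI (fsum B r y y : endo T r)).
Proof.
have hq := qmap_starhom idI r.
apply: CS_of_cpos => [|t t0]; first by rewrite -(shomS hq) [astar _]fsum_star.
have [z ez] := fsum_square B r t x y.
rewrite -(shomS hq) -!(shomM hq) -!(shomZ hq) -!(shomD hq) -(shomB hq) -(shomD hq).
by have := cpos_fsum B r z; rewrite ez.
Qed.

End QuotientPositivity.

Section FockModule.
Variables (R : realType) (T : rtCstarPrecat R) (I : homfam T).
Hypothesis idI : is_ideal I.
Variables (F : set_system nat) (FF : Filter F) (E : set (famT T)).
Hypotheses (E0 : E 0)
  (EL : forall (c : R[i]) x y, E x -> E y -> E (c *: x + y)).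
Implicit Types x y z : famT T.

(** Finite support makes the form a finite sum. The bound on sums of norms, uniform in [r], makes
    the seminorm finite along any filter. The condition [E] leaves room for restricting the
    families. *)
Definition fock_dom x := [/\ forall r, exists B, fsupp x r B,
  exists M : R, forall B r, \sum_(p < B) nm (x p r) <= M & E x].

Definition suppb x r : nat := xget 0%N [set B | fsupp x r B].

Lemma suppbP x r : fock_dom x -> fsupp x r (suppb x r).
Proof.
by move=> [h _ _]; rewrite /suppb; case: xgetP => [B -> //|]; have [B hB] := h r => /(_ B).
Qed.

Arguments suppbP {x} r _ _ _.

(** A chosen support bound of [x] fixes the length of the sum; by [fock_formE] any other bound gives
    the same value. *)
Definition fock_form r x y : quot idI r := qmap idI (fsum (suppb x r) r x y : endo T r).

Lemma fock_formE r x y B : fock_dom x -> fsupp x r B ->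
  fock_form r x y = qmap idI (fsum B r x y : endo T r).
Proof.
move=> Wx h; rewrite /fock_form; congr (qmap idI _).
rewrite -(fsum_stable y h (leq_maxl B (suppb x r))).
by rewrite (fsum_stable y (suppbP r Wx) (leq_maxr B _)).
Qed.

Lemma fock_domL (c : R[i]) x y : fock_dom x -> fock_dom y -> fock_dom (c *: x + y).
Proof.
move=> [sx [M hM] Ex] [sy [M' hM'] Ey]; split; last exact: EL.
- move=> r; have [B hB] := sx r; have [B' hB'] := sy r; exists (maxn B B') => p.
  rewrite geq_max => /andP[/hB e /hB' e'].
  by rewrite fam_linE e e' scaler0 addr0.
- exists (cabs c * M + M') => B r.
  apply: (@le_trans _ _ (\sum_(p < B) (cabs c * nm (x p r) + nm (y p r)))).
    by apply: ler_sum => p _; rewrite fam_linE -nmZ; exact: nmD.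
  rewrite big_split /= -mulr_sumr; apply: lerD; last exact: hM'.
  by apply: (ler_wpM2l (cabs_ge0 c)); exact: hM.
Qed.

Lemma fsupp_le x r B B' : fsupp x r B -> (B <= B')%N -> fsupp x r B'.
Proof. by move=> h BB' p /(leq_trans BB') /h. Qed.

Lemma fock_dom0 : fock_dom 0.
Proof.
split=> //; first by move=> r; exists 0%N.
by exists 0 => B r; rewrite big1 // => p _; rewrite nm0.
Qed.

Lemma fock_form_linr r (c : R[i]) x y z : fock_dom x -> fock_dom y -> fock_dom z ->
  fock_form r x (c *: y + z) = c *: fock_form r x y + fock_form r x z.
Proof.
by move=> Wx Wy Wz; rewrite /fock_form fsum_linr (shom_lin (qmap_starhom idI r)).
Qed.

Lemma fock_form_star r x y : fock_dom x -> fock_dom y ->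
  astar (fock_form r x y) = fock_form r y x.
Proof.
move=> Wx Wy; pose B := maxn (suppb x r) (suppb y r).
have hx : fsupp x r B by apply: fsupp_le (suppbP r Wx) _; exact: leq_maxl.
have hy : fsupp y r B by apply: fsupp_le (suppbP r Wy) _; exact: leq_maxr.
rewrite (fock_formE y Wx hx) (fock_formE x Wy hy) -(shomS (qmap_starhom idI r)).
by rewrite [astar _]fsum_star.
Qed.

Lemma fock_form_pos r x : fock_dom x -> cpos (fock_form r x x).
Proof. by move=> _; exact: cpos_fsum. Qed.

Lemma fock_form_CS r x y : fock_dom x -> fock_dom y ->
  nm (fock_form r x y) ^+ 2 <= nm (fock_form r x x) * nm (fock_form r y y).
Proof.
move=> Wx Wy; pose B := maxn (suppb x r) (suppb y r).
have hx : fsupp x r B by apply: fsupp_le (suppbP r Wx) _; exact: leq_maxl.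
have hy : fsupp y r B by apply: fsupp_le (suppbP r Wy) _; exact: leq_maxr.
rewrite (fock_formE y Wx hx) (fock_formE x Wx hx) (fock_formE y Wy hy).
exact: fsum_CS.
Qed.

Lemma fock_form_bnd x : fock_dom x -> exists M, F [set r | nm (fock_form r x x) <= M].
Proof.
move=> [_ [M hM] _]; exists (M * M); apply: nearW => r.
by apply: le_trans (shom_nm (qmap_starhom idI r) _) _; exact: fsum_le.
Qed.

Definition fock : premod R :=
  @Premod R (famT T) fock_dom F FF (quot idI) fock_form fock_dom0 fock_domL
    fock_form_linr fock_form_star fock_form_pos fock_form_CS fock_form_bnd.

End FockModule.

(** * The operators on families *)

Section FockOperators.
Variables (R : realType) (T : rtCstarPrecat R).
Implicit Types x y z : famT T.

Definition fockL n m (a : T n m) x : famT T := fun i r =>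
  if pselect (is_true (n <= i)%N) is left h then
    hcast (subnK h) erefl (tens_iter (i - n) a ;; x (i - n + m)%N r)
  else 0.

Lemma fockLE n m (a : T n m) x k r :
  fockL a x (k + n)%N r = tens_iter k a ;; x (k + m)%N r.
Proof.
rewrite /fockL; case: pselect => [h|]; last by rewrite leq_addl.
by move: (subnK h); rewrite addnK => e; rewrite hcast_id.
Qed.

Lemma fockL0 n m (a : T n m) x i r : (i < n)%N -> fockL a x i r = 0.
Proof. by rewrite /fockL; case: pselect => // h; rewrite ltnNge h. Qed.

Lemma index_split n i : (i < n)%N \/ exists k, i = (k + n)%N.
Proof. by case: (ltnP i n) => h; [left|right; exists (i - n)%N; rewrite subnK]. Qed.

Lemma fockL_lin n m (a : T n m) (c : R[i]) x y :
  fockL a (c *: x + y) = c *: fockL a x + fockL a y.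
Proof.
apply: famP => i r; rewrite fam_linE; case: (index_split n i) => [h|[k ->]].
  by rewrite !fockL0 // scaler0 addr0.
by rewrite !fockLE fam_linE hcomp_linr.
Qed.

Lemma fockL_add n m (c : R[i]) (a b : T n m) x :
  fockL (c *: a + b) x = c *: fockL a x + fockL b x.
Proof.
apply: famP => i r; rewrite fam_linE; case: (index_split n i) => [h|[k ->]].
  by rewrite !fockL0 // scaler0 addr0.
by rewrite !fockLE tens_iter_lin hcomp_linl.
Qed.

Lemma fam_hcast x i j (e : i = j) r : x j r = hcast e erefl (x i r).
Proof. by case: _ / e. Qed.

Lemma hcomp_hcast n m l n' m' l' (e1 : n = n') (e2 e2' : m = m') (e3 : l = l')
  (a : T n m) (b : T m l) : hcast e1 e2 a ;; hcast e2' e3 b = hcast e1 e3 (a ;; b).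
Proof. by case: _ / e1; case: _ / e3; case: _ / e2 e2' => e2'; rewrite !hcast_id. Qed.

Lemma hcastK n m n' m' (e1 : n = n') (e2 : m = m') (f1 : n' = n) (f2 : m' = m) (a : T n m) :
  hcast f1 f2 (hcast e1 e2 a) = a.
Proof. by case: _ / e1 f1 => f1; case: _ / e2 f2 => f2; rewrite !hcast_id. Qed.

Lemma fockL_mul n m k l (a : T n m) (b : T (k + m)%N l) x :
  fockL a (fockL b x) = fockL (tens_iter k a ;; b) x.
Proof.
apply: famP => i r; case: (index_split n i) => [h|[j ->]].
  by rewrite !fockL0 // ltn_addl.
rewrite fockLE; case: (index_split k j) => [h|[i' ->]].
  by rewrite fockL0 ?ltn_add2r // hcomp0r fockL0 // ltn_add2r.
rewrite (fam_hcast _ (addnA i' k m)) fockLE.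
rewrite (fam_hcast _ (addnA i' k n)) fockLE.
rewrite tens_iterM -hcompA (tens_iter_iter a (esym (addnA _ _ _)) (esym (addnA _ _ _))).
by rewrite -(hcomp_hcast _ (addnA i' k m) (addnA i' k m)) hcastK.
Qed.

Lemma fockL_supp n m (a : T n m) x r B : fsupp x r (B + m) -> fsupp (fockL a x) r (B + n).
Proof.
move=> h p; case: (index_split n p) => [pn _|[k ->]]; first by rewrite fockL0.
by rewrite leq_add2r => Bk; rewrite fockLE h ?hcomp0r // leq_add2r.
Qed.

Lemma sum_shift (V : zmodType) n B (G : nat -> V) : (forall i, (i < n)%N -> G i = 0) ->
  \sum_(i < B + n) G i = \sum_(k < B) G (k + n)%N.
Proof.
move=> h; rewrite addnC big_split_ord /= big1 ?add0r; last by move=> i _; exact: h.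
by apply: eq_bigr => i _; rewrite addnC.
Qed.

(** On both sides exactly the terms indexed by [k < B] survive, at coordinates [k + n] and [k + m];
    this dictates the two lengths. *)
Lemma fockL_adj n m (a : T n m) x y B r :
  fsum (B + n) r (fockL a x) y = fsum (B + m) r x (fockL (hstar a) y).
Proof.
rewrite /fsum (sum_shift (n := n) _ (G := fun p => hstar (fockL a x p r) ;; y p r)).
  rewrite (sum_shift (n := m) _ (G := fun p => hstar (x p r) ;; fockL (hstar a) y p r)).
    by apply: eq_bigr => k _; rewrite !fockLE hstarM tens_iter_star hcompA.
  by move=> i im; rewrite fockL0 // hcomp0r.
by move=> i im; rewrite fockL0 // hstar0 hcomp0l.
Qed.

Lemma fockL_sum n m (a : T n m) x (M : R) :
  (forall B r, \sum_(p < B) nm (x p r) <= M) ->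
  forall B r, \sum_(p < B) nm (fockL a x p r) <= nm a * M.
Proof.
move=> hM B r.
apply: (@le_trans _ _ (\sum_(p < B + n) nm (fockL a x p r))).
  by rewrite big_split_ord /= lerDl; apply: sumr_ge0 => i _; exact: nm_ge0.
rewrite (sum_shift (n := n) _ (G := fun p => nm (fockL a x p r))); last first.
  by move=> i im; rewrite fockL0 // nm0.
apply: (@le_trans _ _ (\sum_(k < B) nm a * nm (x (k + m)%N r))).
  apply: ler_sum => k _; rewrite fockLE; apply: le_trans (hnmM _ _) _.
  by rewrite ler_wpM2r ?nm_ge0 // nm_tens_iter.
rewrite -mulr_sumr ler_wpM2l ?nm_ge0 //; apply: le_trans (hM (m + B)%N r).
rewrite big_split_ord /= -[leLHS]add0r lerD //.
  by apply: sumr_ge0 => i _; exact: nm_ge0.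
by apply: ler_sum => i _; rewrite addnC.
Qed.

(** The defect of coisometry is confined to coordinate [n]. *)
Lemma fockL_tens n m (a : T n m) x i r : i != n -> fockL a x i r = fockL (tens a) x i r.
Proof.
case: (index_split n.+1 i) => [|[k ->] _].
  by rewrite ltnS leq_eqVlt => /predU1P[->|h _]; rewrite ?eqxx // !fockL0 // ltnW.
rewrite fockLE (fam_hcast _ (addSnnS k n)) fockLE.
rewrite (tens_iter_tens a (esym (addnS _ _)) (esym (addnS _ _))) /=.
rewrite (fam_hcast _ (addSnnS k m)).
by rewrite (hcomp_hcast _ _ _ (erefl r)); congr hcast; exact: eq_irrelevance.
Qed.

Lemma fockL_n n m (a : T n m) x r : fockL a x n r = a ;; x m r.
Proof. exact: (fockLE a x 0). Qed.

End FockOperators.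

Section FockRepresentation.
Variables (R : realType) (T : rtCstarPrecat R) (K I : homfam T).
Arguments K : clear implicits.
Arguments I : clear implicits.
Hypotheses (idK : is_ideal K) (idI : is_ideal I).
Variables (F : set_system nat) (FF : Filter F) (E : set (famT T)).
Hypotheses (E0 : E 0)
  (EL : forall (c : R[i]) x y, E x -> E y -> E (c *: x + y))
  (E_L : forall n m (a : T n m) x, E x -> E (fockL a x)).
Let X := fock idI FF E0 EL.

Lemma fock_dom_L n m (a : T n m) (x : famT T) : fock_dom E x -> fock_dom E (fockL a x).
Proof.
move=> [sx [M hM] Ex]; split; last exact: E_L.
- move=> r; have [B hB] := sx r; exists (B + n)%N; apply: fockL_supp.
  by apply: fsupp_le hB _; exact: leq_addr.
- by exists (nm a * M); exact: fockL_sum.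
Qed.

Lemma fock_form_adj n m (a : T n m) r (x y : famT T) : fock_dom E x -> fock_dom E y ->
  fock_form idI r (fockL a x) y = fock_form idI r x (fockL (hstar a) y).
Proof.
move=> Wx Wy; have Wa := fock_dom_L a Wx.
have [sx _ _] := Wx; have [B hB] := sx r.
have hx : fsupp x r (B + m) by apply: fsupp_le hB _; exact: leq_addr.
rewrite (fock_formE idI y Wa (fockL_supp a hx)) (fock_formE idI (fockL (hstar a) y) Wx hx).
by rewrite fockL_adj.
Qed.

Definition fock_rep := @op_rep R T X (@fockL R T : forall n m, T n m -> X -> X).

Lemma fock_repP : is_rep K fock_rep.
Proof.
apply: op_repP => //.
- by move=> n m a c x y _ _ _; exact: fockL_lin.
- by move=> n m a x _; exact: fock_dom_L.
- by move=> n m c a b x _ _ _; exact: fockL_add.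
- by move=> n m k l a b x _ _ _; exact: fockL_mul.
- by move=> n m a r x y _; exact: fock_form_adj.
Qed.

Lemma fock_opdom n m (a : T n m) : K n m a -> opdom (fockL a : X -> X).
Proof.
apply: L_opdom => //.
- by move=> n' m' a' c x y _ _ _; exact: fockL_lin.
- by move=> n' m' a' x _; exact: fock_dom_L.
- by move=> n' m' c a' b x _ _ _; exact: fockL_add.
- by move=> n' m' k l a' b x _ _ _; exact: fockL_mul.
- by move=> n' m' a' r x y _; exact: fock_form_adj.
Qed.

Lemma fock_rep_pn0 n m (a : T n m) (x : famT T) : K n m a -> fock_rep a = 0 ->
  fock_dom E x -> @pn R X (fockL a x) = 0.
Proof.
move=> Ka ra Wx; apply: (@op_rep0 R T K X (@fockL R T : forall n m, T n m -> X -> X) idK) => //.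
- by move=> n' m' a' c y z _ _ _; exact: fockL_lin.
- by move=> n' m' a' y _; exact: fock_dom_L.
- by move=> n' m' c a' b y _ _ _; exact: fockL_add.
- by move=> n' m' k l a' b y _ _ _; exact: fockL_mul.
- by move=> n' m' a' r y z _; exact: fock_form_adj.
Qed.

End FockRepresentation.

Section FockKernel.
Variables (R : realType) (T : rtCstarPrecat R) (K I : homfam T).
Arguments K : clear implicits.
Arguments I : clear implicits.
Hypotheses (idK : is_ideal K) (idI : is_ideal I).
Variables (F : set_system nat) (FF : Filter F) (E : set (famT T)).
Hypotheses (E0 : E 0)
  (EL : forall (c : R[i]) x y, E x -> E y -> E (c *: x + y))
  (E_L : forall n m (a : T n m) x, E x -> E (fockL a x)).
Let X := fock idI FF E0 EL.
Local Notation W := (fock_dom E).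

Lemma fock_pn0 (x : famT T) : W x -> F [set r | forall p, I p r (x p r)] ->
  @pn R X x = 0.
Proof.
move=> Wx h; apply/eqP; rewrite eq_le (@pn_ge0 R X) // andbT; apply: pn_le; split=> //.
apply: filterS h => r /= h; rewrite expr0n /=.
rewrite -[nm _]/(nm (fock_form idI r x x)) /fock_form nm_qmap (_ : dst _ _ = 0) //.
apply/(dst0P idI).
rewrite /fsum; elim/big_rec: _ => [|p y _ Iy]; first exact: idl0.
by apply: (idlD idI) => //; apply: (idl_left idI); exact: h.
Qed.

Lemma fock_rep_eq n m n' m' (a : T n m) (b : T n' m') : K n m a -> K n' m' b ->
  (forall x, W x -> F [set r | forall p, I p r (fockL a x p r - fockL b x p r)]) ->
  fock_rep idI FF E0 EL a = fock_rep idI FF E0 EL b.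
Proof.
move=> Ka Kb h; apply: op_rep_eq; try exact: fock_opdom Ka; try exact: fock_opdom Kb.
move=> x Wx; apply: fock_pn0 (h x Wx).
by apply: (@pmB R X); exact: fock_dom_L.
Qed.

Lemma fockL_0 n m x : fockL (0 : T n m) x = 0.
Proof.
apply: famP => i r; case: (index_split n i) => [h|[k ->]]; first exact: fockL0.
by rewrite fockLE tens_iter0 hcomp0l.
Qed.

Lemma fock_rep_vanish n m (a : T n m) : K n m a ->
  (forall k, I (k + n)%N (k + m)%N (tens_iter k a)) -> fock_rep idI FF E0 EL a = 0.
Proof.
move=> Ka Ia.
have r0 : fock_rep idI FF E0 EL (0 : T n m) = 0.
  have [h _ _] := fock_repP idK idI FF E0 EL E_L.
  have K0 := idl0 idK n m.
  by have := h n m (-1) 0 0 K0 K0; rewrite scaler0 addr0 scaleN1r addNr.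
rewrite -r0; apply: fock_rep_eq (idl0 idK n m) _ => // x Wx; apply: nearW => r p.
rewrite fockL_0 subr0; case: (index_split n p) => [h|[k ->]].
  by rewrite fockL0 //; exact: idl0.
by rewrite fockLE; exact: idl_right.
Qed.

Lemma fock_rep_coisometric J : fam_sub J (Jfam K) ->
  (forall n m (a : T n m) x, J n m a -> W x -> F [set r | I n r (a ;; x m r)]) ->
  coisometric_on J (fun n m => fock_rep idI FF E0 EL (n:=n) (m:=m)).
Proof.
move=> JK h n m a Ja; have [Ka Kta] := JK n m a Ja.
apply: fock_rep_eq => // x Wx; apply: filterS (h n m a x Ja Wx) => r /= Ia p.
have [->|pn] := eqVneq p n.
  by rewrite fockL_n [X in _ - X]fockL0 ?subr0.
by rewrite (fockL_tens _ _ _ pn) subrr; exact: idl0.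
Qed.

Definition diag_fam (e : forall r, T r r) : famT T := fun p r =>
  if pselect (p = r) is left h then hcast erefl h (e p) else 0.

Lemma diag_famE (e : forall r, T r r) r : diag_fam e r r = e r.
Proof. by rewrite /diag_fam; case: pselect => // h; rewrite hcast_id. Qed.

Lemma diag_fam0 (e : forall r, T r r) p r : p != r -> diag_fam e p r = 0.
Proof. by rewrite /diag_fam; case: pselect => // h /negP[]; exact/eqP. Qed.

Lemma diag_fam_dom (e : forall r, T r r) (M : R) :
  (forall r, nm (e r) <= M) -> E (diag_fam e) -> W (diag_fam e).
Proof.
move=> hM Ee; split=> //.
- by move=> r; exists r.+1 => p rp; rewrite diag_fam0 // gtn_eqF.
exists M => B r; case: (ltnP r B) => rB.
  rewrite (bigD1 (Ordinal rB)) //= diag_famE big1 ?addr0 // => i ir.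
  by rewrite diag_fam0 ?nm0 //; apply: contraNneq ir => ir; apply/eqP/val_inj.
rewrite big1 => [|i _]; first exact: le_trans (nm_ge0 _) (hM 0%N).
by rewrite diag_fam0 ?nm0 // ltn_eqF // (leq_trans (ltn_ord i)).
Qed.

(* Applied to the diagonal vector with entries [c^* c], where [c] is the
   iterated tensoring of [a], the operator of [a] yields [c c^* c]. *)
Lemma fock_rep0 n m (a : T n m) (e : forall r, T r r) (M : R) :
  K n m a -> fock_rep idI FF E0 EL a = 0 ->
  F [set r | forall k, r = (k + m)%N -> e (k + m)%N = tens_iter k (hstar a ;; a)] ->
  (forall r, nm (e r) <= M) -> E (diag_fam e) ->
  forall eps : R, 0 < eps ->
  F [set r | forall k, r = (k + m)%N -> dst I (tens_iter k a) < eps].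
Proof.
move=> Ka ra he hM Ee eps eps0; have We := diag_fam_dom hM Ee.
have Wae := fock_dom_L E_L a We.
have pn0 := fock_rep_pn0 idK E_L Ka ra We.
(* With [c] the iterated tensoring of [a], the seminorm only controls [c c^* c]. As
   [dst c ^+ 4 <= |a| * dst (c c^* c)], this bound by [d] suffices. *)
have na := nm_ge0 a; pose d := eps ^+ 4 / (nm a + 1).
have d0 : 0 < d by rewrite divr_gt0 ?exprn_gt0 //; lra.
have /(@pn_near R X _ d Wae) : @pn R X (fockL a (diag_fam e)) < d by rewrite pn0.
apply: (filterS2 _ _ he) => r {}he h k rk; subst r.
have := h; rewrite /= -[nm _]/(nm (fock_form idI _ _ _)).
have {}he := he k erefl.
have s : fsupp (fockL a (diag_fam e)) (k + m)%N (k + n).+1.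
  move=> p; case: (index_split n p) => [pn _|[j ->]]; first by rewrite fockL0.
  by rewrite ltn_add2r => kj; rewrite fockLE diag_fam0 ?hcomp0r // eqn_add2r gtn_eqF.
rewrite (fock_formE _ _ Wae s) nm_qmap.
pose c := tens_iter k a.
have -> : fsum (k + n).+1 (k + m)%N (fockL a (diag_fam e)) (fockL a (diag_fam e)) =
    hstar (c ;; (hstar c ;; c)) ;; (c ;; (hstar c ;; c)).
  rewrite /fsum big_ord_recr /= big1 ?add0r => [|i _]; last first.
    case: (index_split n i) => [h'|[j ej]]; first by rewrite fockL0 // hcomp0r.
    rewrite ej fockLE diag_fam0 ?hcomp0r // eqn_add2r ltn_eqF //.
    by have := ltn_ord i; rewrite ej ltn_add2r.
  by rewrite fockLE diag_famE he tens_iterM tens_iter_star.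
rewrite dst_cstar // => {}h.
have c0 := dst_ge0 idI c; have cc0 := dst_ge0 idI (c ;; (hstar c ;; c)).
have {}h : dst I (c ;; (hstar c ;; c)) <= d.
  by rewrite -(@ler_pXn2r _ 2) ?nnegrE // ltW.
have h4 : dst I c ^+ 4 <= nm a * dst I (c ;; (hstar c ;; c)).
  (* The fourth power is the distance of [c^* c c^* c], read as [c^*] times [c c^* c]. *)
  rewrite (exprM _ 2 2) -!dst_cstar // hstarM hstarK -hcompA.
  apply: le_trans (dst_comp idI _ _) _; rewrite dst_star //; apply: ler_wpM2r => //.
  exact: le_trans (dst_le_nm idI _) (nm_tens_iter _ _).
rewrite -(@ltr_pXn2r _ 4) ?nnegrE ?(ltW eps0) //.
apply: le_lt_trans h4 _; apply: (@le_lt_trans _ _ (nm a * d)); first by rewrite ler_wpM2l.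
rewrite /d mulrA ltr_pdivrMr ?mulrDr ?mulr1; last by lra.
by rewrite mulrC ltrDl exprn_gt0.
Qed.
End FockKernel.

(** * The kernel of the universal representation *)
Section Osub.
Variables (R : realType) (T : rtCstarPrecat R).
Implicit Types (N K : homfam T) (O B : cstarAlg R).

Lemma Osub_vanish N O (iota : forall n m, T n m -> O) B (Psi : O -> B) x :
  is_starhom Psi -> (forall n m (a : T n m), N n m a -> Psi (iota n m a) = 0) ->
  Osub N iota x -> Psi x = 0.
Proof.
move=> hPsi h; have h0 y : lspan (rep_image N iota) y -> Psi y = 0.
  apply: (@smallest_sub _ (@is_subspace R O) _ ([set z | Psi z = 0])).
    split=> [|c z w /= z0 w0]; first exact: (shom0 hPsi).
    by rewrite (shom_lin hPsi) z0 w0 scaler0 addr0.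
  by move=> _ [n _ [m _ [a Na <-]]]; exact: h.
move=> /closure_nmP hx; apply: nm_eq0; apply/eqP; rewrite eq_le nm_ge0 andbT.
apply: ler_eps => e /hx[y /h0 y0 xy]; rewrite add0r ltW //; apply: le_lt_trans xy.
by apply: le_trans (shom_nm hPsi _); rewrite (shomB hPsi) y0 subr0.
Qed.

Definition tens_diag m (b : T m m) r : T r r :=
  if pselect (is_true (m <= r)%N) is left h then
    hcast (subnK h) (subnK h) (tens_iter (r - m) b) else 0.

Lemma tens_diagE m (b : T m m) k : tens_diag b (k + m)%N = tens_iter k b.
Proof.
rewrite /tens_diag; case: pselect => [h|]; last by rewrite leq_addl.
by move: (subnK h); rewrite addnK => e; rewrite hcast_id.
Qed.

Lemma nm_tens_diag m (b : T m m) r : nm (tens_diag b r) <= nm b.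
Proof.
case: (index_split m r) => [h|[k ->]]; last by rewrite tens_diagE nm_tens_iter.
by rewrite /tens_diag; case: pselect => [h'|_]; [rewrite ltnNge h' in h|rewrite nm0 nm_ge0].
Qed.

End Osub.

Section Kernel.
Variables (R : realType) (T : rtCstarPrecat R) (K J N Nt : homfam T).
Arguments K : clear implicits.
Arguments J : clear implicits.
Arguments N : clear implicits.
Arguments Nt : clear implicits.
Hypotheses (idK : is_ideal K) (idJ : is_ideal J) (idNt : is_ideal Nt)
  (invNt : is_invariant Nt) (JK : fam_sub J (Jfam K))
  (NtK : forall n m, N n m = fam_cap Nt K n m).
Variables (O : cstarAlg R) (iota : forall n m, T n m -> O).
Arguments iota : clear implicits.
Hypothesis univ : is_universal K J iota.

Lemma invariant_iter k n m (a : T n m) : Nt n m a -> Nt (k + n)%N (k + m)%N (tens_iter k a).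
Proof. by move=> Na; elim: k => //= k; exact: invNt. Qed.

(** By universality [pi] factors through [iota], and the factor kills O(N). This is how explicit
    representations bound the kernel. *)
Lemma rep_vanish (B : cstarAlg R) (pi : forall n m, T n m -> B) n m (a : T n m) :
  is_rep K pi -> coisometric_on J pi -> (forall n m (b : T n m), N n m b -> pi n m b = 0) ->
  K n m a -> Osub N iota (iota n m a) -> pi n m a = 0.
Proof.
move=> rp cp h Ka Oa; have [_ _ _ /(_ _ _ rp cp)[Psi [hPsi ePsi]]] := univ.
rewrite ePsi //; apply: (Osub_vanish hPsi) Oa => p q b Nb.
by rewrite -ePsi ?h //; move: Nb; rewrite NtK => -[].
Qed.

Let setL (c : R[i]) (x y : famT T) : [set: famT T] x -> [set: famT T] y ->
  [set: famT T] (c *: x + y). Proof. by []. Qed.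

(* The coordinates along a fixed [r] form a representation modulo [J + Nt]. *)
Lemma kernel_sum n m (a : T n m) k : K n m a -> Osub N iota (iota n m a) ->
  fam_add J Nt (k + n)%N (k + m)%N (tens_iter k a).
Proof.
move=> Ka Oa; have idI := ideal_add idJ idNt.
(* The principal filter at [k + m] makes the seminorm that of the single column [r = k + m]. *)
have FF : Filter (globally [set (k + m)%N]) by exact: globally_filter.
have EL p q (b : T p q) x : [set: famT T] x -> [set: famT T] (fockL b x) by [].
have subJ p q b : J p q b -> fam_add J Nt p q b.
  by move=> Jb; exists b => //; exists 0; [exact: idl0|rewrite addr0].
have subN p q b : Nt p q b -> fam_add J Nt p q b.
  by move=> Nb; exists 0; [exact: idl0|exists b => //; rewrite add0r].
have a0 : fock_rep idI FF (Logic.I : setT 0) setL a = 0.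
  pose pi p q := fock_rep idI FF (Logic.I : setT 0) setL (n := p) (m := q).
  apply: (rep_vanish (pi := pi)) => //.
  - exact: (fock_repP idK).
  (* The defect is a product with left factor in [J], hence zero modulo [J + Nt]. *)
  - apply: (fock_rep_coisometric idK) => // p q b x Jb _ r _ /=.
    by apply: (subJ p r); exact: (idl_right idJ).
  - move=> p q b; rewrite NtK => -[Nb Kb]; apply: (fock_rep_vanish idK) => // j.
    by apply: subN; exact: invariant_iter.
apply/(dst0P idI)/eqP; rewrite eq_le dst_ge0 // andbT; apply: ler_eps => e e0.
rewrite add0r ltW //.
have := fock_rep0 idK EL Ka a0 _ (nm_tens_diag (hstar a ;; a)) Logic.I e0.
by apply=> //= r -> j _; exact: tens_diagE.
Qed.

Definition escaping (x : famT T) := forall P, exists r0, forall r, (r0 <= r)%N ->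
  forall p, (p < P)%N -> x p r = 0.

Lemma escaping0 : escaping 0. Proof. by move=> P; exists 0%N. Qed.

Lemma escapingL (c : R[i]) x y : escaping x -> escaping y -> escaping (c *: x + y).
Proof.
move=> hx hy P; have [r1 h1] := hx P; have [r2 h2] := hy P; exists (maxn r1 r2) => r.
by rewrite geq_max => /andP[/h1{}h1 /h2{}h2] p pP; rewrite fam_linE h1 ?h2 // scaler0 addr0.
Qed.

Lemma escaping_fockL n m (a : T n m) x : escaping x -> escaping (fockL a x).
Proof.
move=> hx P; have [r0 h] := hx (P + m)%N; exists r0 => r /h{}h p pP.
case: (index_split n p) => [pn|[k ep]]; first by rewrite fockL0.
rewrite ep fockLE h ?hcomp0r // ltn_add2r; apply: leq_ltn_trans pP.
by rewrite ep leq_addr.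
Qed.

(* Along [r -> oo] the coordinate where [a] and its tensoring act differently
   escapes, so that the operators of the two agree in the limit. *)
Lemma kernel_limit n m (a : T n m) e : K n m a -> Osub N iota (iota n m a) ->
  0 < e -> exists k, dst Nt (tens_iter k a) < e.
Proof.
move=> Ka Oa e0; have FF : Filter \oo by exact: _.
have a0 : fock_rep idNt FF escaping0 escapingL a = 0.
  apply: (rep_vanish (pi := fun n m => fock_rep idNt FF escaping0 escapingL (n:=n) (m:=m))) => //.
  - exact: (fock_repP idK _ _ _ _ escaping_fockL).
  - apply: (fock_rep_coisometric idK) => // [p q c y|p q b x Jb [_ _ Ex]].
      exact: escaping_fockL.
    (* The defect is a product with coordinate [q] of an escaping family, which vanishes for large
       [r]. *)
    have [r0 h] := Ex q.+1; exists r0 => // r /= /h -> //.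
    by rewrite hcomp0r; exact: idl0.
  - move=> p q b; rewrite NtK => -[Nb Kb]; apply: (fock_rep_vanish idK) => // [|j].
      exact: escaping_fockL.
    exact: invariant_iter.
have dE : escaping (diag_fam (tens_diag (hstar a ;; a))).
  by move=> P; exists P => r Pr p pP; rewrite diag_fam0 // ltn_eqF // (leq_trans pP).
have he : \oo [set r | forall k, r = (k + m)%N ->
    tens_diag (hstar a ;; a) (k + m)%N = tens_iter k (hstar a ;; a)].
  by exists 0%N => // r _ j _; exact: tens_diagE.
have /(_ _ _ he (nm_tens_diag _) dE e e0)[r0 _ h] := fock_rep0 idK escaping_fockL Ka a0.
exists r0; exact: (h (r0 + m)%N (leq_addr _ _)).
Qed.

Lemma kernel_saturation n m (a : T n m) : K n m a -> Osub N iota (iota n m a) ->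
  saturation J Nt n m a.
Proof.
move=> Ka Oa; apply: chain_saturation => // [k|e e0]; first exact: kernel_sum.
exact: kernel_limit Oa e0.
Qed.

End Kernel.

(** * The ideal of O generated by N *)
Section Subspaces.
Variables (R : realType).

Lemma subspace_lspan (V : completeNormedModType R[i]) (A : set V) : is_subspace (lspan A).
Proof.
split=> [S [[S0 _] _] //|c x y hx hy S SA].
by case: (SA) => -[_ SL] _; apply: SL; [exact: hx|exact: hy].
Qed.

Lemma subspace_closure (V : completeNormedModType R[i]) (A : set V) :
  is_subspace A -> is_subspace (closure A).
Proof.
move=> [A0 AL]; split=> [|c x y /closure_nmP hx /closure_nmP hy]; first exact: subset_closure.
apply/closure_nmP => e e0; have c0 := cabs_ge0 c.
have e1 : 0 < e / (2 * (cabs c + 1)) by rewrite divr_gt0 //; lra.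
have e2 : 0 < e / 2 by rewrite divr_gt0.
have [x' Ax' xx'] := hx _ e1; have [y' Ay' yy'] := hy _ e2.
exists (c *: x' + y'); first exact: AL.
rewrite opprD addrACA -scalerBr; apply: le_lt_trans (nmD _ _) _; rewrite nmZ.
have : cabs c * nm (x - x') <= e / 2.
  apply: le_trans (_ : cabs c * (e / (2 * (cabs c + 1))) <= _).
    by rewrite ler_wpM2l // ltW.
  rewrite mulrA ler_pdivrMr ?mulr_gt0 //; last by lra.
  by rewrite mulrA divfK //; nra.
lra.
Qed.

Lemma lspan_min (V : completeNormedModType R[i]) (A S : set V) :
  is_subspace S -> A `<=` S -> lspan A `<=` S.
Proof. by move=> sS AS x; apply; split. Qed.

Lemma sub_lspan (V : completeNormedModType R[i]) (A : set V) : A `<=` lspan A.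
Proof. by move=> x Ax S [_]; apply. Qed.

End Subspaces.

Section OsubTheory.
Variables (R : realType) (T : rtCstarPrecat R) (N : homfam T) (O : cstarAlg R)
  (iota : forall n m, T n m -> O).
Arguments N : clear implicits.
Local Notation I := (Osub N iota).

Lemma Osub_subspace : is_subspace I.
Proof. exact/subspace_closure/subspace_lspan. Qed.

Lemma Osub_closed : closed I. Proof. exact: closed_closure. Qed.

Lemma Osub_iota n m (a : T n m) : N n m a -> I (iota a).
Proof.
move=> Na; apply: subset_closure; apply: (@sub_lspan R).
by exists n => //; exists m => //; exists a.
Qed.

Lemma Osub_min (S : set O) : is_subspace S -> closed S ->
  (forall n m (a : T n m), N n m a -> S (iota a)) -> I `<=` S.
Proof.
move=> sS cS h; rewrite [S](_ : _ = closure S); last by rewrite -(closure_id S).1.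
apply: closure_subset; apply: lspan_min => // _ [n _ [m _ [a Na <-]]]; exact: h.
Qed.

End OsubTheory.

Section RepTheory.
Variables (R : realType) (T : rtCstarPrecat R) (K : homfam T).
Arguments K : clear implicits.
Hypothesis idK : is_ideal K.
Variables (B : cstarAlg R) (pi : forall n m, T n m -> B).
Arguments pi : clear implicits.
Hypothesis rp : is_rep K pi.

Lemma rep_lin n m (c : R[i]) (a b : T n m) : K n m a -> K n m b ->
  pi n m (c *: a + b) = c *: pi n m a + pi n m b.
Proof. by case: rp => h _ _; exact: h. Qed.

Lemma rep_star n m (a : T n m) : K n m a -> astar (pi n m a) = pi m n (hstar a).
Proof. by case: rp => _ h _; exact: h. Qed.

Lemma rep_mul n m k l (a : T n m) (b : T (k + m)%N l) : K n m a -> K (k + m)%N l b ->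
  pi n m a ** pi (k + m)%N l b = pi (k + n)%N l (tens_iter k a ;; b).
Proof. by case: rp => _ _ h; exact: h. Qed.

(** The relation for a longer left factor is the adjoint of the one for a longer right factor; it
    uses that ideals are self-adjoint. *)
Lemma rep_mulr n m k l (a : T n (k + m)%N) (b : T m l) : K n (k + m)%N a -> K m l b ->
  pi n (k + m)%N a ** pi m l b = pi n (k + l)%N (a ;; tens_iter k b).
Proof.
move=> Ka Kb; have Ka' := idl_star idK Ka; have Kb' := idl_star idK Kb.
rewrite -[LHS]astarK astarM !rep_star // rep_mul // rep_star.
  by rewrite hstarM hstarK tens_iter_star hstarK.
exact: (idl_left idK).
Qed.

Lemma rep0 n m : pi n m 0 = 0.
Proof.
have K0 := idl0 idK n m; have := rep_lin (-1) K0 K0.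
by rewrite scaler0 addr0 scaleN1r addNr.
Qed.

Lemma rep_B n m (a b : T n m) : K n m a -> K n m b -> pi n m (a - b) = pi n m a - pi n m b.
Proof. by move=> Ka Kb; rewrite addrC -scaleN1r rep_lin // scaleN1r addrC. Qed.

(** On the closed subalgebra [K m m] a representation is a homomorphism, hence contractive; the
    C*-identity extends this to all [K n m]. *)
Lemma rep_nm n m (a : T n m) : K n m a -> nm (pi n m a) <= nm a.
Proof.
move=> Ka; have hS : is_starhom_on (K m m : set (endo T m)) (pi m m).
  split=> [c x y Kx Ky|x y Kx Ky|x Kx]; first exact: rep_lin.
    by rewrite (rep_mul (k := 0) Kx Ky).
  by rewrite rep_star.
rewrite -(@ler_pXn2r _ 2) ?nnegrE ?nm_ge0 // -nm_cstar rep_star //.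
rewrite (rep_mul (k := 0)) //; last exact: idl_star.
rewrite -hnm_cstar; apply: (starhom_on_nm (idl_endo idK m) hS).
exact: (idl_left idK).
Qed.

End RepTheory.

Lemma index_cases m m' : (exists k, m' = (k + m)%N) \/ (exists k, m = (k + m')%N).
Proof.
by case: (leqP m m') => [|/ltnW] h; [left; exists (m' - m)%N|right; exists (m - m')%N];
  rewrite subnK.
Qed.

Section IdealOfO.
Variables (R : realType) (T : rtCstarPrecat R) (K J N Nt : homfam T).
Arguments K : clear implicits.
Arguments J : clear implicits.
Arguments N : clear implicits.
Arguments Nt : clear implicits.
Hypotheses (idK : is_ideal K) (idJ : is_ideal J) (idN : is_ideal N) (idNt : is_ideal Nt)
  (invNt : is_invariant Nt) (JK : fam_sub J (Jfam K))
  (NtK : forall n m, N n m = fam_cap Nt K n m).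
Variables (O : cstarAlg R) (iota : forall n m, T n m -> O).
Arguments iota : clear implicits.
Local Notation I := (Osub N iota).

Let NK n m (a : T n m) : N n m a -> K n m a.
Proof. by rewrite NtK => -[]. Qed.

Lemma Osub_star : is_rep K iota -> forall x, I x -> I (astar x).
Proof.
move=> rp; have [I0 IL] := Osub_subspace N iota.
apply: Osub_min => [||n m a Na].
- by split=> [|c x y Ix Iy]; rewrite /= ?astar0 // astar_antilin; exact: IL.
- apply/closed_nmP => x hx /=; have /closed_nmP := @Osub_closed _ _ N _ iota.
  apply=> e /hx[y Iy xy]; exists (astar y) => //.
  by rewrite -astarB nm_astar.
by rewrite /= (rep_star rp (NK Na)); apply: Osub_iota; exact: idl_star.
Qed.

(** The idealizer [G] of O(N) is a closed *-subalgebra, so it is enough that it contains the image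
    of [K]. *)
Lemma Osub_ideal : is_rep K iota ->
  smallest (@is_cstar_subalg R O) (rep_image K iota) = [set: O] -> is_alg_ideal I.
Proof.
move=> rp gen; have [I0 IL] := Osub_subspace N iota.
have /closed_nmP cI := @Osub_closed _ _ N _ iota; have sI := Osub_star rp.
pose G : set O := [set x | forall y, I y -> I (x ** y) /\ I (y ** x)].
suff GT x : G x.
  by split=> [||x y /(GT x)[]|x y /(GT y)[]] //; exact: Osub_closed.
have : [set: O] x by []; rewrite -gen; apply; split; first split.
- split=> [y Iy|c u v Gu Gv y Iy]; first by rewrite amul0l amul0r.
  have [u1 u2] := Gu y Iy; have [v1 v2] := Gv y Iy.
  by rewrite amul_linl amul_linr; split; exact: IL.
- apply/closed_nmP => u hu y Iy; have y0 := nm_ge0 y.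
  split; apply: cI => e e0.
    have [|v /(_ y Iy)[Iv _] uv] := hu (e / (nm y + 1)); first by rewrite divr_gt0 //; lra.
    exists (v ** y) => //; rewrite -amulBl; apply: le_lt_trans (nmM _ _) _.
    move: uv; rewrite ltr_pdivlMr; last lra.
    by have := nm_ge0 (u - v); nra.
  have [|v /(_ y Iy)[_ Iv] uv] := hu (e / (nm y + 1)); first by rewrite divr_gt0 //; lra.
  exists (y ** v) => //; rewrite -amulBr; apply: le_lt_trans (nmM _ _) _.
  move: uv; rewrite ltr_pdivlMr; last lra.
  by have := nm_ge0 (u - v); nra.
- move=> u v Gu Gv y Iy; have [v1 v2] := Gv y Iy; have [u1 u2] := Gu y Iy.
  split; first by rewrite -amulA; case: (Gu _ v1).
  by rewrite amulA; case: (Gv _ u2).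
- move=> u Gu y Iy; have [u1 u2] := Gu _ (sI _ Iy).
  split; [rewrite -[y]astarK -astarM|rewrite -[y]astarK -astarM]; exact: sI.
move=> _ [n _ [m _ [a Ka <-]]].
have left p q r s (b : T p q) (c : T r s) : K p q b -> N r s c -> I (iota p q b ** iota r s c).
  move=> Kb Nc; case: (index_cases q r) => -[k e]; subst.
    by rewrite (rep_mul rp) //; [apply: Osub_iota; exact: idl_left|exact: NK].
  rewrite (rep_mulr idK rp) //; last exact: NK.
  (* Invariance puts the tensoring of [c] into [Nt] only; the product with [b] lies in [K] as well,
     hence in [N]. *)
  apply: Osub_iota; rewrite NtK; split; last exact: idl_right.
  by apply: idl_left => //; apply: (invariant_iter invNt); move: Nc; rewrite NtK => -[].
have L p q (b : T p q) : K p q b -> forall y, I y -> I (iota p q b ** y).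
  move=> Kb; apply: Osub_min => [||r s c Nc]; last exact: left.
    by split=> [|c x' y' h1 h2]; rewrite /= ?amul0r // amul_linr; exact: IL.
  apply/closed_nmP => u hu; apply: cI => e e0; set z := iota p q b.
  have z0 := nm_ge0 z.
  have [|v Iv uv] := hu (e / (nm z + 1)); first by rewrite divr_gt0 //; lra.
  exists (z ** v) => //; rewrite -amulBr; apply: le_lt_trans (nmM _ _) _.
  move: uv; rewrite ltr_pdivlMr; last lra.
  by have := nm_ge0 (u - v); nra.
move=> y Iy; split; first exact: L.
rewrite -[y ** _]astarK astarM (rep_star rp) //; apply/sI/L; last exact: sI.
exact: idl_star.
Qed.

(** For [b] in [J] coisometry gives [iota b = iota (tens b)], so membership of [tens b] in a step
    passes to [b]; contractivity of [iota] handles the closure. *)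
Lemma saturation_sub_kernel : is_universal K J iota -> forall n m (a : T n m),
  saturation J N n m a -> K n m a /\ I (iota n m a).
Proof.
move=> [rp cp _ _]; have [I0 IL] := Osub_subspace N iota.
have /closed_nmP cI := @Osub_closed _ _ N _ iota.
have step k n m (a : T n m) : sat_step J N k n m a -> K n m a /\ I (iota n m a).
  elim: k n m a => [|k IH] n m a /=.
    by move=> Na; split; [exact: NK|exact: Osub_iota].
  move=> [b [Jb /IH[_ Ib]] [c /IH[Kc Ic] <-]].
  have Kb : K n m b by have [] := JK Jb.
  split; first exact: (idlD idK).
  rewrite -[b]scale1r (rep_lin rp) // scale1r -[iota n m b]scale1r.
  by apply: IL => //; rewrite (cp n m b Jb).
move=> n m a /closure_nmP ha; have Ka : K n m a.
  by apply: (idl_closed idK) => e /ha[y [k _ /step[Ky _]] ay]; exists y.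
split=> //; apply: cI => e /ha[y [k _ /step[Ky Iy]] ay]; exists (iota n m y) => //.
rewrite -(rep_B rp) //; apply: le_lt_trans ay; apply: (rep_nm idK rp).
exact: (idlB idK).
Qed.

(** The explicit representations work with the invariant ideal [Nt] and bound the kernel by its
    saturation; intersecting with [K] gives the saturation of [N]. *)
Lemma saturation_kernel : is_universal K J iota -> forall n m,
  saturation J N n m = [set a | K n m a /\ I (iota n m a)].
Proof.
move=> univ n m; apply/seteqP; split=> a /=; first exact: saturation_sub_kernel.
move=> [Ka Ia]; rewrite (saturation_cap idK idJ idN idNt JK NtK); split=> //.
exact: (kernel_saturation idK idJ idNt invNt JK NtK univ).
Qed.

Lemma Osub_saturation : is_universal K J iota -> Osub (saturation J N) iota = I.
Proof.
move=> univ; apply/seteqP; split.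
  apply: Osub_min => [||n m a /(saturation_sub_kernel univ)[]] //.
    exact: Osub_subspace.
  exact: Osub_closed.
apply: Osub_min => [||n m a Na]; [exact: Osub_subspace|exact: Osub_closed|].
by apply: Osub_iota; exact: sub_saturation.
Qed.

End IdealOfO.

(** * Products up to tensoring *)
Section TensorProduct.
Variables (R : realType) (T : rtCstarPrecat R).

Lemma hcast_lin n m n' m' (e1 : n = n') (e2 : m = m') (c : R[i]) (a b : T n m) :
  hcast e1 e2 (c *: a + b) = c *: hcast e1 e2 a + hcast e1 e2 b.
Proof. by case: _ / e1; case: _ / e2; rewrite !hcast_id. Qed.

Lemma hcast_star n m n' m' (e1 : n = n') (e2 : m = m') (a : T n m) :
  hstar (hcast e1 e2 a) = hcast e2 e1 (hstar a).
Proof. by case: _ / e1; case: _ / e2; rewrite !hcast_id. Qed.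

Definition twk k j n m r s (e : (j + r = k + m)%N) (x : T n m) (y : T r s) :
  T (k + n)%N (j + s)%N := tens_iter k x ;; hcast e erefl (tens_iter j y).

Fact tw_index m r : (m - r + r = r - m + m)%N. Proof. lia. Qed.

(* The product [x y] in the quotient where every [a] is identified with its
   tensoring; at least one of the two truncated differences is zero. *)
Definition tw n m r s (x : T n m) (y : T r s) := twk (tw_index m r) x y.

Lemma twk_fun (Z : Type) (rho : forall n m, T n m -> Z) k j k' j' n m r s
  (e : (j + r = k + m)%N) (e' : (j' + r = k' + m)%N) (x : T n m) (y : T r s) :
  k = k' -> rho _ _ (twk e x y) = rho _ _ (twk e' x y).
Proof.
move=> kk; subst k'; have jj : j = j' by lia.
by subst j'; rewrite (eq_irrelevance e e').
Qed.

Lemma tw_fun (Z : Type) (rho : forall n m, T n m -> Z) k j n m r s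
  (e : (j + r = k + m)%N) (x : T n m) (y : T r s) :
  k = 0%N \/ j = 0%N -> rho _ _ (tw x y) = rho _ _ (twk e x y).
Proof. by move=> h; apply: twk_fun; lia. Qed.

Lemma tw_left (Z : Type) (rho : forall n m, T n m -> Z) k n m s
  (x : T n m) (y : T (k + m)%N s) : rho _ _ (tw x y) = rho _ _ (tens_iter k x ;; y).
Proof. by rewrite (tw_fun rho (erefl : (0 + (k + m) = k + m)%N)); [|right]. Qed.

Lemma tw_right (Z : Type) (rho : forall n m, T n m -> Z) k n r s
  (x : T n (k + r)%N) (y : T r s) : rho _ _ (tw x y) = rho _ _ (x ;; tens_iter k y).
Proof. by rewrite (tw_fun rho (erefl : (k + r = 0 + (k + r))%N)); [|left]. Qed.

Lemma tw_linr n m r s (c : R[i]) (x : T n m) (y y' : T r s) :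
  tw x (c *: y + y') = c *: tw x y + tw x y'.
Proof. by rewrite /tw /twk tens_iter_lin hcast_lin hcomp_linr. Qed.

Lemma tw_star (Z : Type) (rho : forall n m, T n m -> Z) n m r s (x : T n m) (y : T r s) :
  rho _ _ (hstar (tw x y)) = rho _ _ (tw (hstar y) (hstar x)).
Proof.
rewrite (tw_fun rho (esym (tw_index m r))); last by lia.
rewrite /tw /twk hstarM hcast_star -!tens_iter_star.
move: (tens_iter _ (hstar y)) (tens_iter _ (hstar x)) (tw_index m r).
move: (r - m + m)%N (m - r + r)%N => p q a b e.
by case: _ / e b => b; rewrite !hcast_id.
Qed.

(** Common normal form of the two bracketings of a triple product. The equations [e] and [f]
    determine [j] and [i] from [k], so comparing two such forms amounts to comparing [k]. *)
Definition tri k j i n m r s p q (e : (j + r = k + m)%N) (f : (i + p = j + s)%N)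
    (x : T n m) (y : T r s) (z : T p q) : T (k + n)%N (i + q)%N :=
  tens_iter k x ;; hcast e erefl (tens_iter j y ;; hcast f erefl (tens_iter i z)).

Lemma tri_fun (Z : Type) (rho : forall n m, T n m -> Z) k j i k' j' i' n m r s p q
  (e : (j + r = k + m)%N) (f : (i + p = j + s)%N)
  (e' : (j' + r = k' + m)%N) (f' : (i' + p = j' + s)%N)
  (x : T n m) (y : T r s) (z : T p q) : k = k' ->
  rho _ _ (tri e f x y z) = rho _ _ (tri e' f' x y z).
Proof.
move=> kk; subst k'; have jj : j = j' by lia.
subst j'; have ii : i = i' by lia.
by subst i'; rewrite (eq_irrelevance e e') (eq_irrelevance f f').
Qed.

Lemma tens_iter_hcast k n m n' m' (e1 : n = n') (e2 : m = m')
  (e3 : (k + n = k + n')%N) (e4 : (k + m = k + m')%N) (a : T n m) :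
  tens_iter k (hcast e1 e2 a) = hcast e3 e4 (tens_iter k a).
Proof. by case: _ / e1 e3 => e3; case: _ / e2 e4 => e4; rewrite !hcast_id. Qed.

Lemma fun_triple (Z : Type) (rho : forall n m, T n m -> Z)
  n m r s p q n' m' r' s' (x : T n m) (y : T r s) (z : T p q)
  (e : r = m) (f : p = s) (a1 : n = n') (a2 : m = m') (b1 : r = r') (b2 : s = s')
  (e' : r' = m') (f' : p = s') :
  rho _ _ (hcast a1 a2 x ;; hcast e' erefl (hcast b1 b2 y) ;; hcast f' erefl z) =
  rho _ _ (x ;; hcast e erefl (y ;; hcast f erefl z)).
Proof.
by subst; rewrite !hcast_id -hcompA.
Qed.

Lemma tri_left (Z : Type) (rho : forall n m, T n m -> Z) k j l i n m r s p q
  (e : (j + r = k + m)%N) (f : (i + p = l + (j + s))%N)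
  (e' : (l + j + r = l + k + m)%N) (f' : (i + p = l + j + s)%N)
  (x : T n m) (y : T r s) (z : T p q) :
  rho _ _ (twk f (twk e x y) z) = rho _ _ (tri e' f' x y z).
Proof.
have e1 : (l + (j + r) = l + (k + m))%N by lia.
rewrite /twk /tri tens_iterM (tens_iter_hcast e erefl e1 erefl).
rewrite (tens_iter_iter x (esym (addnA _ _ _)) (esym (addnA _ _ _))).
rewrite (tens_iter_iter y (esym (addnA _ _ _)) (esym (addnA _ _ _))).
exact: fun_triple.
Qed.

Lemma fun_triple_r (Z : Type) (rho : forall n m, T n m -> Z)
  n m r s p q r' s' p' q' (x : T n m) (y : T r s) (z : T p q)
  (e : r = m) (f : p = s) (b1 : r = r') (b2 : s = s') (c1 : p = p') (c2 : q = q')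
  (e' : r' = m) (f' : p' = s') :
  rho _ _ (x ;; hcast e' erefl (hcast b1 b2 y ;; hcast f' erefl (hcast c1 c2 z))) =
  rho _ _ (x ;; hcast e erefl (y ;; hcast f erefl z)).
Proof.
by subst; rewrite !hcast_id.
Qed.

Lemma tri_right (Z : Type) (rho : forall n m, T n m -> Z) k j l i n m r s p q
  (e : (l + (j + r) = k + m)%N) (f : (i + p = j + s)%N)
  (e' : (l + j + r = k + m)%N) (f' : (l + i + p = l + j + s)%N)
  (x : T n m) (y : T r s) (z : T p q) :
  rho _ _ (twk e x (twk f y z)) = rho _ _ (tri e' f' x y z).
Proof.
have f1 : (l + (i + p) = l + (j + s))%N by lia.
rewrite /twk /tri tens_iterM (tens_iter_hcast f erefl f1 erefl).
rewrite (tens_iter_iter y (esym (addnA _ _ _)) (esym (addnA _ _ _))).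
rewrite (tens_iter_iter z (esym (addnA _ _ _)) (esym (addnA _ _ _))).
exact: fun_triple_r.
Qed.

(** Both sides are brought to the form [tri]; what remains is an identity between truncated
    differences. *)
Lemma tw_assoc (Z : Type) (rho : forall n m, T n m -> Z) n m r s p q
  (x : T n m) (y : T r s) (z : T p q) :
  rho _ _ (tw (tw x y) z) = rho _ _ (tw x (tw y z)).
Proof.
rewrite /tw tri_left; try lia; move=> e1 f1.
rewrite tri_right; try lia; move=> e2 f2.
apply: tri_fun; lia.
Qed.

End TensorProduct.

(** * Left multiplication on the algebra of N *)
Section TensorProductRep.
Variables (R : realType) (T : rtCstarPrecat R) (K N Nt : homfam T).
Arguments K : clear implicits.
Arguments N : clear implicits.
Arguments Nt : clear implicits.
Hypotheses (idK : is_ideal K) (idNt : is_ideal Nt) (invNt : is_invariant Nt)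
  (NtK : forall n m, N n m = fam_cap Nt K n m).

Lemma tw_ideal n m r s (x : T n m) (y : T r s) : K n m x -> K r s y -> K _ _ (tw x y).
Proof.
move=> Kx Ky; case: (index_cases m r) => -[k e]; subst.
  by rewrite (tw_left K); exact: idl_left.
by rewrite (tw_right K); exact: idl_right.
Qed.

Lemma tw_invl n m r s (x : T n m) (y : T r s) : Nt n m x -> Nt _ _ (tw x y).
Proof.
move=> Nx; case: (index_cases m r) => -[k e]; subst.
  by rewrite (tw_left Nt); apply: idl_right => //; exact: invariant_iter.
by rewrite (tw_right Nt); exact: idl_right.
Qed.

Lemma tw_invr n m r s (x : T n m) (y : T r s) : Nt r s y -> Nt _ _ (tw x y).
Proof.
move=> Ny; case: (index_cases m r) => -[k e]; subst.
  by rewrite (tw_left Nt); exact: idl_left.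
by rewrite (tw_right Nt); apply: idl_left => //; exact: invariant_iter.
Qed.

Lemma tw_subl n m r s (x : T n m) (y : T r s) : N n m x -> K r s y -> N _ _ (tw x y).
Proof.
by rewrite !NtK => -[Nx Kx] Ky; split; [exact: tw_invl|exact: tw_ideal].
Qed.

Lemma tw_subr n m r s (x : T n m) (y : T r s) : K n m x -> N r s y -> N _ _ (tw x y).
Proof.
by rewrite !NtK => Kx [Ny Ky]; split; [exact: tw_invr|exact: tw_ideal].
Qed.

Lemma rep_tw (B : cstarAlg R) (pi : forall n m, T n m -> B) n m r s (x : T n m) (y : T r s) :
  is_rep K pi -> K n m x -> K r s y -> pi n m x ** pi r s y = pi _ _ (tw x y).
Proof.
move=> rp Kx Ky; case: (index_cases m r) => -[k e]; subst.
  by rewrite (tw_left pi) (rep_mul rp).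
by rewrite (tw_right pi) (rep_mulr idK rp).
Qed.

End TensorProductRep.

Section LeftModule.
Variables (R : realType) (A : cstarAlg R) (W : set A).
Hypotheses (W0 : W 0) (WL : forall (c : R[i]) x y, W x -> W y -> W (c *: x + y)).

Fact left_form_linr (r : nat) (c : R[i]) (x y z : A) : W x -> W y -> W z ->
  astar x ** (c *: y + z) = c *: (astar x ** y) + astar x ** z.
Proof. by move=> _ _ _; exact: amul_linr. Qed.

Fact left_form_star (r : nat) (x y : A) : W x -> W y ->
  astar (astar x ** y) = astar y ** x.
Proof. by rewrite astarM astarK. Qed.

Fact left_form_pos (r : nat) (x : A) : W x -> cpos (astar x ** x).
Proof. by exists x. Qed.

Fact left_form_CS (r : nat) (x y : A) : W x -> W y ->
  nm (astar x ** y) ^+ 2 <= nm (astar x ** x) * nm (astar y ** y).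
Proof.
move=> _ _; rewrite !nm_cstar -exprMn ler_pXn2r ?nnegrE ?mulr_ge0 ?nm_ge0 //.
by rewrite -(nm_astar x) nmM.
Qed.

Fact left_form_bnd (x : A) : W x ->
  exists M, globally [set 0%N] [set r : nat | nm (astar x ** x) <= M].
Proof. by exists (nm (astar x ** x)) => r _ /=. Qed.

(** The algebra as a right module over itself, with a dummy index. The domain is a subspace [W]
    because multiplication by elements of [K] will be defined on a span only. *)
Definition left_premod : premod R :=
  @Premod R A W (globally [set 0%N]) (globally_filter _) (fun _ => A)
    (fun _ x y => astar x ** y) W0 WL left_form_linr left_form_star left_form_pos
    left_form_CS left_form_bnd.

Lemma pn_left (x : A) : W x -> @pn R left_premod x = nm x.
Proof.
move=> Wx; apply/eqP; rewrite eq_le; apply/andP; split.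
  apply: pn_le; split; first exact: nm_ge0.
  by move=> r _ /=; rewrite -[leLHS]/(nm (astar x ** x)) nm_cstar.
apply: ler_eps => e e0; have p0 := @pn_ge0 R left_premod _ Wx.
have /(@pn_near R left_premod _ _ Wx) h : @pn R left_premod x < @pn R left_premod x + e by lra.
have := h 0%N erefl; rewrite /= -[leLHS]/(nm (astar x ** x)) nm_cstar.
by rewrite ler_pXn2r ?nnegrE ?nm_ge0 //; lra.
Qed.

End LeftModule.

Lemma fun_comp_hcast (R : realType) (T : rtCstarPrecat R) (Z : Type)
  (rho : forall n m, T n m -> Z) n m r s s' (x : T n m) (y : T r s)
  (e e' : r = m) (f : s = s') :
  rho _ _ (x ;; hcast e erefl y) = rho _ _ (x ;; hcast e' f y).
Proof. by subst; rewrite (eq_irrelevance e' erefl). Qed.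

Section IdealIso.
Variables (R : realType) (T : rtCstarPrecat R) (K J N Nt : homfam T).
Arguments K : clear implicits.
Arguments J : clear implicits.
Arguments N : clear implicits.
Arguments Nt : clear implicits.
Hypotheses (idK : is_ideal K) (idJ : is_ideal J) (idN : is_ideal N) (idNt : is_ideal Nt)
  (invNt : is_invariant Nt) (JK : fam_sub J (Jfam K))
  (NtK : forall n m, N n m = fam_cap Nt K n m).
Variables (A : cstarAlg R) (rho : forall n m, T n m -> A).
Arguments rho : clear implicits.
Hypotheses (rhoN : is_rep N rho) (rhoJ : coisometric_on (fam_cap J N) rho)
  (genA : smallest (@is_cstar_subalg R A) (rep_image N rho) = [set: A]).

Let NK n m (a : T n m) : N n m a -> K n m a.
Proof. by rewrite NtK => -[]. Qed.

Let W : set A := lspan (rep_image N rho).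
Let W0 : W 0. Proof. by have [] := subspace_lspan (rep_image N rho). Qed.
Let WL (c : R[i]) x y : W x -> W y -> W (c *: x + y).
Proof. by have [_] := subspace_lspan (rep_image N rho); apply. Qed.
Let W_rho n m (a : T n m) : N n m a -> W (rho n m a).
Proof. by move=> Na; apply: (@sub_lspan R); exists n => //; exists m => //; exists a. Qed.
Let X := left_premod W0 WL.

(** Applied to [N] itself in the role of [K], [Osub_ideal] makes the closed span a C*-subalgebra; it
    contains the generators, so it is everything. *)
Lemma lspan_dense (x : A) e : 0 < e -> exists2 y, W y & nm (x - y) < e.
Proof.
move=> e0; have NN n m : N n m = fam_cap Nt N n m.
  apply/seteqP; split=> [a Na|a []//]; split=> //.
  by move: Na; rewrite NtK => -[].
have [sO cO hl hr] := Osub_ideal idN idN idNt invNt NN rhoN genA.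
have : Osub N rho x.
  have : [set: A] x by [].
  rewrite -genA; apply; split; first split=> //.
  - by move=> u v _; exact: hl.
  - exact: (Osub_star idN NN rhoN).
  by move=> _ [n _ [m _ [a Na <-]]]; exact: Osub_iota.
by move=> /closure_nmP /(_ e e0).
Qed.

Lemma lspan_star x : W x -> W (astar x).
Proof.
apply: (lspan_min (S := [set y | W (astar y)])) => [|_ [n _ [m _ [a Na <-]]]] /=.
  by split=> [|c u v Wu Wv] /=; rewrite ?astar0 // astar_antilin; exact: WL.
by rewrite (rep_star rhoN Na); apply: W_rho; exact: idl_star.
Qed.

(** Approximating [w^*] by elements [y] of the span gives [w^* w] as a limit of the products
    [y w = 0]. *)
Lemma left_regular (w : A) : (forall n m (a : T n m), N n m a -> rho n m a ** w = 0) -> w = 0.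
Proof.
move=> h; have hW y : W y -> y ** w = 0.
  apply: (lspan_min (S := [set y | y ** w = 0])) => [|_ [n _ [m _ [a Na <-]]]] /=.
    by split=> [|c u v /= u0 v0]; rewrite /= ?amul0l // amul_linl u0 v0 scaler0 addr0.
  exact: h.
apply: nm_eq0; apply/eqP; rewrite -sqrf_eq0 -nm_cstar eq_le nm_ge0 andbT.
apply: ler_eps => e e0; have w0 := nm_ge0 w.
have [|y Wy wy] := @lspan_dense (astar w) (e / (nm w + 1)); first by rewrite divr_gt0 //; lra.
rewrite add0r -[astar w ** w]subr0 -(hW y Wy) -amulBl; apply: le_trans (nmM _ _) _.
move: wy; rewrite ltr_pdivlMr; last lra.
by have := nm_ge0 (astar w - y); nra.
Qed.

(** For [a] in [K] outside [N] the value of [rho] is meaningless, but [x a] lies in [N]. The product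
    of [a] and [z] is thus pinned down by its left multiples, which determine it by
    [left_regular]. *)
Definition left_mult n m (a : T n m) (z w : A) := forall r s (x : T r s), N r s x ->
  rho r s x ** w = rho _ _ (tw x a) ** z.

Lemma left_mult_uniq n m (a : T n m) z w w' :
  left_mult a z w -> left_mult a z w' -> w = w'.
Proof.
move=> h h'; apply/subr0_eq/left_regular => r s x Nx.
by rewrite amulBr h // h' // subrr.
Qed.

Lemma left_mult_rho n m r s (a : T n m) (b : T r s) : K n m a -> N r s b ->
  left_mult a (rho r s b) (rho _ _ (tw a b)).
Proof.
move=> Ka Nb p q x Nx; rewrite !(rep_tw idN) //.
- by rewrite (tw_assoc rho).
- exact: (tw_subl idK idNt invNt NtK).
- exact: (tw_subr idK idNt invNt NtK).
Qed.

Lemma left_mult_ex n m (a : T n m) z : K n m a -> W z ->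
  exists w, W w /\ left_mult a z w.
Proof.
move=> Ka; apply: (lspan_min (S := [set z | exists w, W w /\ left_mult a z w])).
  split=> [|c u v [u' [Wu hu]] [v' [Wv hv]]].
    by exists 0; split=> // r s x Nx; rewrite !amul0r.
  exists (c *: u' + v'); split; first exact: WL.
  by move=> r s x Nx; rewrite !amul_linr hu // hv.
move=> _ [r _ [s _ [b Nb <-]]]; exists (rho _ _ (tw a b)); split; last exact: left_mult_rho.
by apply: W_rho; exact: (tw_subr idK idNt invNt NtK).
Qed.

(* The product [rho a ** z], where [rho a] only makes sense as a multiplier. *)
Definition Lmul n m (a : T n m) (z : A) : A := xget 0 [set w | W w /\ left_mult a z w].

Lemma LmulP n m (a : T n m) z : K n m a -> W z -> W (Lmul a z) /\ left_mult a z (Lmul a z).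
Proof.
by move=> Ka Wz; rewrite /Lmul; case: xgetP => [w _ //|h]; have [w /h] := left_mult_ex Ka Wz.
Qed.

Lemma LmulE n m (a : T n m) z w : K n m a -> W z -> left_mult a z w -> Lmul a z = w.
Proof. by move=> Ka Wz; apply: left_mult_uniq; case: (LmulP Ka Wz). Qed.

Lemma Lmul_lin n m (a : T n m) (c : R[i]) x y : K n m a -> W x -> W y ->
  Lmul a (c *: x + y) = c *: Lmul a x + Lmul a y.
Proof.
move=> Ka Wx Wy; apply: LmulE => //; first exact: WL.
have [_ hx] := LmulP Ka Wx; have [_ hy] := LmulP Ka Wy.
by move=> r s z Nz; rewrite !amul_linr hx // hy.
Qed.

Lemma Lmul_add n m (c : R[i]) (a b : T n m) x : K n m a -> K n m b -> W x ->
  Lmul (c *: a + b) x = c *: Lmul a x + Lmul b x.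
Proof.
move=> Ka Kb Wx; apply: LmulE => //; first exact: (idlL idK).
have [_ ha] := LmulP Ka Wx; have [_ hb] := LmulP Kb Wx.
move=> r s z Nz; rewrite amul_linr ha // hb // tw_linr (rep_lin rhoN) ?amul_linl //;
  exact: (tw_subl idK idNt invNt NtK).
Qed.

Lemma Lmul_mul n m k l (a : T n m) (b : T (k + m)%N l) x :
  K n m a -> K (k + m)%N l b -> W x -> Lmul a (Lmul b x) = Lmul (tens_iter k a ;; b) x.
Proof.
move=> Ka Kb Wx; apply/esym/LmulE => //; first exact: (idl_left idK).
have [Wb hb] := LmulP Kb Wx; have [_ ha] := LmulP Ka Wb.
move=> r s z Nz; rewrite ha // hb; last exact: (tw_subl idK idNt invNt NtK).
rewrite (tw_assoc rho); congr (_ ** _).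
exact: (tw_left (fun p q c => rho _ _ (tw z c))).
Qed.

Lemma Lmul_adj n m (a : T n m) (x y : A) : K n m a -> W x -> W y ->
  astar (Lmul a x) ** y = astar x ** Lmul (hstar a) y.
Proof.
move=> Ka Wx; have Ka' := idl_star idK Ka; have [_ hx] := LmulP Ka Wx.
move=> Wy; suff [] : W y /\ astar (Lmul a x) ** y = astar x ** Lmul (hstar a) y by [].
apply: (lspan_min (S := [set y | W y /\ astar (Lmul a x) ** y = astar x ** Lmul (hstar a) y])) Wy.
  split=> [|c u v [Wu hu] [Wv hv]]; split=> //.
  - rewrite (_ : Lmul (hstar a) 0 = 0) ?amul0r //.
    by apply: LmulE => // r s z Nz; rewrite !amul0r.
  - exact: WL.
  - by rewrite Lmul_lin // !amul_linr hu hv.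
move=> _ [r _ [s _ [b Nb <-]]]; split; first exact: W_rho.
have Nb' := idl_star idN Nb.
rewrite (LmulE Ka' (W_rho Nb) (left_mult_rho Ka' Nb)).
have Ntw := tw_subl idK idNt invNt NtK Nb' Ka.
rewrite -[LHS]astarK astarM astarK (rep_star rhoN Nb) hx // astarM (rep_star rhoN Ntw).
by rewrite (tw_star rho) hstarK.
Qed.

Lemma Lmul_tens n m (a : T n m) x : J n m a -> W x -> Lmul a x = Lmul (tens a) x.
Proof.
move=> Ja Wx; have [Ka Kta] := JK Ja; apply/esym/LmulE => //.
have [_ h] := LmulP Ka Wx; move=> r s z Nz; rewrite h //; congr (_ ** _).
(* If [n = k + s], the two products are an element of [J] and [N] and its tensoring, and coisometry
   of [rho] applies. If [s > n], both are [x] times the same iterated tensoring of [a]. *)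
case: (index_split s n) => [ns|[k e]]; last first.
  subst n; rewrite (tw_left rho) (tw_left rho (k := k.+1)) /= -tensM rhoJ //.
  have := tw_subl idK idNt invNt NtK Nz Ka; rewrite (tw_left N) => h1.
  by split=> //; exact: (idl_left idJ).
have [k e] : exists k, s = (k + n.+1)%N by exists (s - n.+1)%N; rewrite subnK.
subst s; rewrite [RHS](tw_right rho).
have e : (k.+1 + n = 0 + (k + n.+1))%N by lia.
rewrite (tw_fun rho e); last by left.
rewrite (tens_iter_tens a (esym (addnS _ _)) (esym (addnS _ _))) /twk /=.
exact: fun_comp_hcast.
Qed.

Lemma ideal_iso (B : cstarAlg R) (iota : forall n m, T n m -> B) :
  is_universal K J iota -> forall Phi : A -> B, is_starhom Phi ->
  (forall n m (a : T n m), N n m a -> Phi (rho n m a) = iota n m a) ->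
  forall z, nm z <= nm (Phi z).
Proof.
move=> [_ _ _ univ] Phi hPhi ePhi.
pose L n m (a : T n m) : X -> X := @Lmul n m a.
have [Ll Ld La Lm Lj] : [/\
  forall n m (a : T n m) (c : R[i]) (x y : X), K n m a -> W x -> W y ->
     L n m a (c *: x + y) = c *: L n m a x + L n m a y,
  forall n m (a : T n m) (x : X), K n m a -> W x -> W (L n m a x),
  forall n m (c : R[i]) (a b : T n m) (x : X), K n m a -> K n m b -> W x ->
     L n m (c *: a + b) x = c *: L n m a x + L n m b x,
  forall n m k l (a : T n m) (b : T (k + m)%N l) (x : X),
     K n m a -> K (k + m)%N l b -> W x ->
     L n m a (L _ _ b x) = L _ _ (tens_iter k a ;; b) x &
  forall n m (a : T n m) r (x y : X), K n m a -> W x -> W y ->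
     @pm_form R X r (L n m a x) y = @pm_form R X r x (L m n (hstar a) y)].
  split; [exact: Lmul_lin|by move=> n m a x Ka Wx; case: (LmulP Ka Wx)|exact: Lmul_add
    |exact: Lmul_mul|by move=> n m a r x y; exact: Lmul_adj].
have dL n m (a : T n m) : K n m a -> opdom (L n m a).
  exact: (L_opdom idK Ll Ld La Lm Lj).
have rp := op_repP idK Ll Ld La Lm Lj.
have cp : coisometric_on J (fun n m => @op_rep R T X L n m).
  move=> n m a Ja; have [Ka Kta] := JK Ja.
  apply: op_rep_eq; [exact: dL|exact: dL|move=> x Wx].
  by rewrite /L (Lmul_tens Ja Wx) subrr pn0.
have [Psi [hPsi ePsi]] := univ _ _ rp cp.
(* On the span, [Psi (Phi z)] is the class of left multiplication by [z]: this holds for [z = rho a]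
   and is a linear condition. *)
have comp z : W z -> exists f : X -> X, [/\ opdom f, Psi (Phi z) = @hj R (op_prestar X) f &
    forall w : X, W w -> f w = z ** w].
  apply: (lspan_min (S := [set z | exists f : X -> X, [/\ opdom f,
    Psi (Phi z) = @hj R (op_prestar X) f & forall w : X, W w -> f w = z ** w]])).
    have K0 := idl0 idK 0%N 0%N; split=> [|c u v [f [df ef hf]] [g [dg eg hg]]].
      exists (L 0%N 0%N 0); split; [exact: dL| |].
        by rewrite (shom0 hPhi) (shom0 hPsi) -(rep0 idK rp 0%N 0%N).
      move=> w Ww; rewrite amul0l; apply: LmulE => // r s x Nx.
      rewrite amul0r (_ : tw x 0 = 0) ?(rep0 idN rhoN) ?amul0l //.
      by have := tw_linr (-1) x (0 : T 0%N 0%N) 0; rewrite scaler0 addr0 scaleN1r addNr.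
    exists (c *: f + g); split; first exact: opdom_lin.
      rewrite (shom_lin hPhi) (shom_lin hPsi) ef eg.
      by rewrite -(@hj_lin R (op_prestar X)).
    by move=> w Ww; rewrite amul_linl -hf // -hg.
  move=> _ [n _ [m _ [a Na <-]]]; have Ka := NK Na; exists (L n m a); split.
  - exact: dL.
  - by rewrite ePhi // -ePsi.
  move=> w Ww; apply: LmulE => // r s x Nx.
  by rewrite amulA (rep_tw idN).
(* Testing left multiplication on [astar z] gives [|z|^2 <= |f| |z|], and [|f| = |Psi (Phi z)|] is
   at most [|Phi z|]. *)
have leW z : W z -> nm z <= nm (Phi z).
  move=> Wz; have [f [df ef hf]] := comp z Wz; have Ws := lspan_star Wz.
  have h := opnuP (proj1 df) (Ws : @pm_dom R X (astar z)).
  have Wf : W (f (astar z)) by have [[_ fW _] _] := df; exact: fW.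
  move: h; rewrite (pn_left W0 WL Wf) (pn_left W0 WL Ws) hf // -{1}(astarK z).
  rewrite nm_cstar nm_astar expr2 => h.
  apply: le_trans (_ : nm (Psi (Phi z)) <= _); last exact: shom_nm.
  rewrite ef (@nm_hj R (op_prestar X)) //.
  have := nm_ge0 z; rewrite le_eqVlt => /predU1P[<-|z0]; first exact: opnu_ge0.
  by rewrite -(ler_pM2r z0).
move=> z; apply: ler_eps => e e0; have e20 : 0 < e / 2 by rewrite divr_gt0.
have [y Wy zy] := lspan_dense z e20.
have h1 := leW y Wy; have h2 := nmD (z - y) y; rewrite subrK in h2.
have h3 := nmD (Phi y - Phi z) (Phi z); rewrite subrK -(shomB hPhi) in h3.
have h4 := shom_nm hPhi (y - z); rewrite nmB in h4.
lra.
Qed.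

End IdealIso.

(** * The isomorphisms *)
Section HomFacts.
Variables (R : realType) (A B : cstarAlg R).

Lemma starhom_ext (S : set A) (f g : A -> B) :
  is_starhom f -> is_starhom g -> (forall x, S x -> f x = g x) ->
  smallest (@is_cstar_subalg R A) S = [set: A] -> forall x, f x = g x.
Proof.
move=> hf hg fg gen x; have : [set: A] x by [].
rewrite -gen; apply: (smallest_sub (X := [set y | f y = g y])) => [|y /fg //]; split.
- split=> [|c u v /= eu ev]; first by rewrite /= (shom0 hf) (shom0 hg).
  by rewrite (shom_lin hf) (shom_lin hg) eu ev.
- apply/closed_nmP => y h /=; apply/subr0_eq/nm_eq0/eqP; rewrite eq_le nm_ge0 andbT.
  apply: ler_eps => e e0; have e20 : 0 < e / 2 by rewrite divr_gt0.
  have [z /= fgz yz] := h _ e20; rewrite add0r.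
  apply: le_trans (nmBD (f z) _ _) _; rewrite {2}fgz -(shomB hf) -(shomB hg).
  have h1 := shom_nm hf (y - z); have h2 := shom_nm hg (z - y).
  by rewrite (nmB z) in h2; lra.
- by move=> u v /= eu ev; rewrite (shomM hf) (shomM hg) eu ev.
- by move=> u /= eu; rewrite (shomS hf) (shomS hg) eu.
Qed.

Lemma isometry_range_closed (f : A -> B) : is_starhom f ->
  (forall x, nm x <= nm (f x)) -> closed (range f).
Proof.
move=> hf isof; apply/closed_nmP => x h.
have /choice[u hu] : forall k, exists y, nm (x - f y) < k.+1%:R^-1.
  move=> k; have [|_ [y _ <-] xy] := h k.+1%:R^-1; first by rewrite invr_gt0.
  by exists y.
have cu : scauchy (@nm R A) u.
  move=> e e0; have e20 : 0 < e / 2 by rewrite divr_gt0.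
  have [k hk] := invS_lt e20.
  exists k => p q /hk kp /hk kq; apply: le_lt_trans (isof _) _.
  rewrite (shomB hf); apply: le_lt_trans (nmBD x _ _) _; rewrite (nmB _ x).
  by have := lt_trans (hu p) kp; have := lt_trans (hu q) kq; lra.
have [y uy] := scauchy_slim cu; exists y => //.
apply/esym/subr0_eq/nm_eq0/eqP; rewrite eq_le nm_ge0 andbT.
apply: ler_eps => e e0; have e20 : 0 < e / 2 by rewrite divr_gt0.
have [k hk] := invS_lt e20; have [l hl] := uy _ e20; pose i := maxn k l.
apply: le_trans (nmBD (f (u i)) _ _) _; rewrite -(shomB hf).
have := lt_trans (hu i) (hk i (leq_maxl _ _)); have := hl i (leq_maxr _ _).
by have := shom_nm hf (u i - y); lra.
Qed.

End HomFacts.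

Section IdealIsomorphism.
Variables (R : realType) (T : rtCstarPrecat R) (K J N Nt : homfam T).
Arguments K : clear implicits.
Arguments J : clear implicits.
Arguments N : clear implicits.
Arguments Nt : clear implicits.
Hypotheses (idK : is_ideal K) (idJ : is_ideal J) (idN : is_ideal N) (idNt : is_ideal Nt)
  (invNt : is_invariant Nt) (JK : fam_sub J (Jfam K))
  (NtK : forall n m, N n m = fam_cap Nt K n m).
Variables (O : cstarAlg R) (iota : forall n m, T n m -> O).
Arguments iota : clear implicits.
Hypothesis univ : is_universal K J iota.
Local Notation I := (Osub N iota).

Let NK n m (a : T n m) : N n m a -> K n m a.
Proof. by rewrite NtK => -[]. Qed.

Lemma ideal_isomorphism : natural_ideal_iso iota I N (fam_cap J N).
Proof.
move=> A rho [rN rJ genA uA]; have [rK cJ genO _] := univ.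
have rN' : is_rep N iota.
  split=> [n m c a b Na Nb|n m a Na|n m k l a b Na Nb].
  - by apply: (rep_lin rK); exact: NK.
  - by apply: (rep_star rK); exact: NK.
  - by apply: (rep_mul rK); exact: NK.
have cN' : coisometric_on (fam_cap J N) iota by move=> n m a [Ja _]; exact: cJ.
have [Phi [hPhi ePhi]] := uA _ _ rN' cN'.
have iso := ideal_iso idK idJ idN idNt invNt JK NtK rN rJ genA univ hPhi
  (fun n m a Na => esym (ePhi n m a Na)).
exists Phi; split=> //; last by move=> n m a Na; rewrite ePhi.
  move=> x y xy; apply/subr0_eq/nm_eq0/eqP; rewrite eq_le nm_ge0 andbT.
  by apply: le_trans (iso _) _; rewrite (shomB hPhi) xy subrr nm0.
(* The range contains O(N) because it is a closed subspace, by isometry. Conversely, the preimage of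
   the ideal O(N) is a closed *-subalgebra containing the generators. *)
apply/seteqP; split; last first.
  apply: Osub_min => [||n m a Na]; last by exists (rho n m a) => //; rewrite ePhi.
    split=> [|c _ _ [x _ <-] [y _ <-]]; first by exists 0 => //; rewrite (shom0 hPhi).
    by exists (c *: x + y) => //; rewrite (shom_lin hPhi).
  exact: isometry_range_closed.
have [sI cI hl hr] := Osub_ideal idK idN idNt invNt NtK rK genO.
move=> _ [x _ <-]; have : [set: A] x by [].
rewrite -genA; apply: (smallest_sub (X := [set y | I (Phi y)])); last first.
  by move=> _ [n _ [m _ [a Na <-]]]; rewrite /= -ePhi //; exact: Osub_iota.
have [I0 IL] := sI; have /closed_nmP cI' := cI; split; first split.
- by rewrite /= (shom0 hPhi).
- by move=> c u v /= Iu Iv; rewrite (shom_lin hPhi); exact: IL.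
- apply/closed_nmP => u h /=; apply: cI' => e /h[v Iv uv]; exists (Phi v) => //.
  by rewrite -(shomB hPhi); apply: le_lt_trans uv; exact: shom_nm.
- by move=> u v /= _; rewrite (shomM hPhi); exact: hl.
- by move=> u /= Iu; rewrite (shomS hPhi); exact: (Osub_star idN NtK rK).
Qed.

Lemma quotient_isomorphism : natural_quotient_iso iota I K J Nt.
Proof.
move=> D p [[plin pT pker _] hp] Q q [qq qM qS qT] A rho [rQ cQ genA uA].
have [rK cJ genO uO] := univ.
have qlin n m : linear (q n m) by have [] := qq n m.
have qker n m a : q n m a = 0 <-> Nt n m a by have [_ _ h _] := qq n m.
have qB n m (a b : T n m) : q n m (a - b) = q n m a - q n m b.
  by rewrite addrC -scaleN1r qlin scaleN1r addrC.
have q_iter k n m (a : T n m) : q _ _ (tens_iter k a) = tens_iter k (q n m a).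
  by elim: k => //= k <-; rewrite qT.
have im n m (a : T n m) : K n m a -> fam_image q K n m (q n m a) by exists a.
have r1 : is_rep K (fun n m a => rho n m (q n m a)).
  split=> [n m c a b Ka Kb|n m a Ka|n m k l a b Ka Kb].
  - by rewrite qlin; apply: (rep_lin rQ); exact: im.
  - by rewrite qS; apply: (rep_star rQ); exact: im.
  - by rewrite qM q_iter; apply: (rep_mul rQ); exact: im.
have c1 : coisometric_on J (fun n m a => rho n m (q n m a)).
  by move=> n m a Ja; rewrite qT; apply: cQ; exists a.
have [Psi [hPsi ePsi]] := uO _ _ r1 c1.
have Psi0 x : I x -> Psi x = 0.
  move=> Ix; apply: (Osub_vanish hPsi _ Ix) => n m a Na; rewrite -ePsi; last exact: NK.
  have /qker -> : Nt n m a by move: Na; rewrite NtK => -[].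
  have {1}-> : (0 : Q n m) = q n m 0 by have := qB n m 0 0; rewrite !subrr.
  exact: (rep0 idK r1).
have /choice[g hg] : forall d : D, exists z : O, p z = d.
  by move=> d; have : [set: D] d by []; rewrite -pT => -[y _ <-]; exists y.
have Psi_g x : Psi (g (p x)) = Psi x.
  apply/subr0_eq; rewrite -(shomB hPsi); apply/Psi0/pker.
  by rewrite (shomB hp) hg subrr.
pose Phi d := Psi (g d).
have Phi_p x : Phi (p x) = Psi x by exact: Psi_g.
have hPhi : is_starhom Phi.
  split=> [c x y|x y|x].
  - by rewrite -{1}(hg x) -{1}(hg y) -(shom_lin hp) Phi_p (shom_lin hPsi).
  - by rewrite -{1}(hg x) -{1}(hg y) -(shomM hp) Phi_p (shomM hPsi).
  - by rewrite -{1}(hg x) -(shomS hp) Phi_p (shomS hPsi).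
(* A lift of [b] to [K] is chosen. Two lifts differ by an element of both [K] and [Nt], that is of
   [N], which [p \o iota] kills. *)
pose tau n m (b : Q n m) : D := p (iota n m (xget 0 [set a | K n m a /\ q n m a = b])).
have tauE n m (a : T n m) : K n m a -> tau n m (q n m a) = p (iota n m a).
  move=> Ka; rewrite /tau; case: xgetP => [b -> [Kb qb]|/(_ a)[]//].
  apply/subr0_eq; rewrite -(shomB hp) -(rep_B rK) //; apply/pker/Osub_iota.
  by rewrite NtK; split; [apply/qker; rewrite qB qb subrr|exact: (idlB idK)].
have r2 : is_rep (fam_image q K) tau.
  split=> [n m c _ _ [a Ka <-] [b Kb <-]|n m _ [a Ka <-]|n m k l _ _ [a Ka <-] [b Kb <-]].
  - rewrite -qlin !tauE //; last exact: (idlL idK).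
    by rewrite (rep_lin rK) // (shom_lin hp).
  - rewrite -qS !tauE //; last exact: (idl_star idK).
    by rewrite -(shomS hp) (rep_star rK).
  - rewrite -q_iter -qM !tauE //; last exact: (idl_left idK).
    by rewrite -(shomM hp) (rep_mul rK).
have c2 : coisometric_on (fam_image q J) tau.
  move=> n m _ [a Ja <-]; have [Ka Kta] := JK Ja.
  by rewrite -qT !tauE // (cJ n m a Ja).
have [Ups [hUps eUps]] := uA _ _ r2 c2.
exists Phi; split=> //; last by move=> n m a Ka; rewrite Phi_p -ePsi.
have Ups_Phi x : Ups (Phi (p x)) = p x.
  apply: (starhom_ext (f := Ups \o Phi \o p) _ hp _ genO).
    split=> [c u v|u v|u] /=.
    - by rewrite (shom_lin hp) (shom_lin hPhi) (shom_lin hUps).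
    - by rewrite (shomM hp) (shomM hPhi) (shomM hUps).
    - by rewrite (shomS hp) (shomS hPhi) (shomS hUps).
  move=> _ [n _ [m _ [a Ka <-]]] /=.
  by rewrite Phi_p -ePsi // -eUps ?tauE //; exact: im.
exists Ups => [d|x]; first by rewrite -(hg d) Ups_Phi.
apply: (starhom_ext (f := Phi \o Ups) (g := id) _ _ _ genA) => //.
  split=> [c u v|u v|u] /=.
  - by rewrite (shom_lin hUps) (shom_lin hPhi).
  - by rewrite (shomM hUps) (shomM hPhi).
  - by rewrite (shomS hUps) (shomS hPhi).
move=> _ [n _ [m _ [_ [a Ka <-] <-]]] /=.
by rewrite -eUps ?tauE ?Phi_p -?ePsi //; exact: im.
Qed.

End IdealIsomorphism.

Theorem theorem6p9 (R : realType) (T : rtCstarPrecat R)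
    (K J N Nt : homfam T)
    (idealK : is_ideal K) (idealJ : is_ideal J) (idealN : is_ideal N)
    (JK : fam_sub J (Jfam K))
    (NK : fam_sub N K) (invN : is_K_invariant K N)
    (idealNt : is_ideal Nt) (invNt : is_invariant Nt)
    (NtK : forall n m, N n m = fam_cap Nt K n m)
    (O : cstarAlg R) (iota : forall n m, T n m -> O)
    (univ : is_universal K J iota) :
  [/\ is_alg_ideal (Osub N iota),
      natural_ideal_iso iota (Osub N iota) N (fam_cap J N) &
      natural_quotient_iso iota (Osub N iota) K J Nt]
  /\
  (forall n m,
     saturation J N n m = [set a | K n m a /\ Osub N iota (iota n m a)])
  /\
  [/\ Osub (saturation J N) iota = Osub N iota,
      natural_ideal_iso iota (Osub N iota)
        (saturation J N) (fam_cap J (saturation J N)) &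
      natural_quotient_iso iota (Osub N iota) K J (saturation J Nt)].
Proof.
have eO : Osub (saturation J N) iota = Osub N iota.
  exact: (Osub_saturation idealK JK NtK univ).
have idS := ideal_saturation idealJ idealN.
have idSt := ideal_saturation idealJ idealNt.
have invSt := invariant_saturation idealJ idealNt invNt.
(* The saturations of [N] and [Nt] stand in the same relation as [N] and [Nt], so both isomorphisms
   apply to them verbatim. *)
have capS := saturation_cap idealK idealJ idealN idealNt JK NtK.
have [rK _ genO _] := univ; split; first split.
- exact: (Osub_ideal idealK idealN idealNt invNt NtK rK genO).
- exact: (ideal_isomorphism idealK idealJ idealN idealNt invNt JK NtK univ).
- exact: (quotient_isomorphism idealK JK NtK univ).
split; first exact: (saturation_kernel idealK idealJ idealN idealNt invNt JK NtK univ).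
split=> //; rewrite -eO.
  exact: (ideal_isomorphism idealK idealJ idS idSt invSt JK capS univ).
exact: (quotient_isomorphism idealK JK capS univ).
Qed.
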